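(* Let $k\ge1$ and let $g$ be a variable of type $\overline{k+1}\rightarrow\overline{k+1}$. Every ${\mathrm{PCF}}^\Omega_k$-denotable procedure $\Gamma\vdash p$, with $\Gamma$ a $g$-regular environment, is non-$g$-spinal.
   Context: Pure types $\overline0=\mathbb{N}$, $\overline{k+1}=\overline k\rightarrow\mathbb{N}$; ${\mathrm{lv}}(\mathbb{N})=0$, ${\mathrm{lv}}(\sigma\rightarrow\tau)=\max({\mathrm{lv}}\,\sigma+1,{\mathrm{lv}}\,\tau)$. ${\mathrm{PCF}}^\Omega_k$: simply typed $\lambda$-calculus over $\mathbb{N}$ with $\underline n,\mathit{suc},\mathit{pre},\mathit{ifzero}$, oracles $C_f$ ($f:\mathbb{N}\rightharpoonup\mathbb{N}$), and $Y_\sigma:(\sigma\rightarrow\sigma)\rightarrow\sigma$ only for ${\mathrm{lv}}(\sigma)\le k$. NSPs: coinductively generated well-typed trees $p::=\lambda\vec x.e$, $e::=\bot\mid n\mid\mathtt{case}\ a\ \mathtt{of}\ (i\Rightarrow e_i\mid i\in\mathbb{N})$, $a::=x\,q_0\cdots q_{r-1}$, modulo $\alpha$. $\langle\!\langle-\rangle\!\rangle$: evaluation of meta-terms (limit of reduction by $\beta$, $\mathtt{case}\ \bot\rightsquigarrow\bot$, $\mathtt{case}\ n\ \mathtt{of}(i\Rightarrow E_i)\rightsquigarrow E_n$, case-of-case). Application $(\lambda x_0\cdots x_r.e)\cdot q=\lambda x_1\cdots x_r.\langle\!\langle e[x_0\mapsto q]\rangle\!\rangle$; $x^\eta=\lambda\vec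 z.\mathtt{case}\ x\vec z^{\,\eta}\ \mathtt{of}(i\Rightarrow i)$. $\Gamma\vdash p$ is ${\mathrm{PCF}}^\Omega_k$-denotable if $p=[\![M]\!]_\Gamma$ for a ${\mathrm{PCF}}^\Omega_k$ term $\Gamma\vdash M$, where $[\![x]\!]=x^\eta$, $[\![\underline n]\!]=\lambda.n$, $[\![\mathit{suc}]\!]=\lambda x.\mathtt{case}\ x\ \mathtt{of}(i\Rightarrow i+1)$, $[\![\mathit{pre}]\!]=\lambda x.\mathtt{case}\ x\ \mathtt{of}(0\Rightarrow0\mid i+1\Rightarrow i)$, $[\![\mathit{ifzero}]\!]=\lambda xyz.\mathtt{case}\ x\ \mathtt{of}(0\Rightarrow\mathtt{case}\ y\ \mathtt{of}(j\Rightarrow j)\mid i+1\Rightarrow\mathtt{case}\ z\ \mathtt{of}(j\Rightarrow j))$, $[\![C_f]\!]=\lambda x.\mathtt{case}\ x\ \mathtt{of}(i\Rightarrow f(i))$, $[\![Y_\sigma]\!]=\lambda g.F_\sigma[g]$ with $F_\sigma[g]=\lambda\vec x.\mathtt{case}\ g(F_\sigma[g])\vec x^{\,\eta}\ \mathtt{of}(i\Rightarrow i)$, $[\![\lambda x.M]\!]=\lambda x.[\![M]\!]$, $[\![MN]\!]=[\![M]\!]\cdot[\![N]\!]$. $p\preceq p'$ for closed $p,p'$ of type $\sigma$ iff $r\cdot p\sqsubseteq r\cdot p'$ for all closed $r$ of type $\sigma\rightarrow\mathbb{N}$ (flat order on $\mathbb{N}_\bot$); for open terms in environment $\vec x$,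 compare $\langle\!\langle\lambda\vec x.t\rangle\!\rangle$. $g$-regular environment: contains $g$, all other variables of level $\le k$; $g$-regular term: all free and bound variables of level $\le k$ except free occurrences of $g$. Local variable environment of a context $E[-]$: variables bound in $E[-]$ whose scope includes the hole. A substitution $[\vec w\mapsto\vec r\,]$ is $x,V$-closed if the $r_i$ have no free variables except that $r_i$ may contain $x$ free when $w_i\in V$ and ${\mathrm{lv}}(w_i)<k$. For $g$-regular $\Gamma\vdash e$ with $x^{\overline k}\in\Gamma$, $V\subseteq\Gamma$, ''$e$ is $g$-head-spinal w.r.t. $x,V$'' is the largest relation such that $e=\mathtt{case}\ g(\lambda x'.E[e'])\,o\ \mathtt{of}(\cdots)$ with $E[-]$ an expression context, $o^\circ\succeq x^\eta$ for some $x,V$-closed $^\circ$ covering exactly the free variables of $o$ other than $x$, and $e'$ $g$-head-spinal w.r.t. $x',V'$ with $V'$ the local variable environment of $E[-]$. A term is $g$-spinal if it contains a subexpression $g$-head-spinal w.r.t. some $x,V$. *)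

(* Defs.v *)
(* Nested sequential procedures (NSPs), PCF^Omega_k and its
   NSP denotation, observational order, and g-spinality.
   Variables are de Bruijn indices (so alpha-equivalence is syntactic identity). *)
From Stdlib Require Import List Arith Relations ClassicalEpsilon.
Import ListNotations.

Inductive ty : Type := N : ty | Arr : ty -> ty -> ty.

Fixpoint lv (s : ty) : nat :=
  match s with N => 0 | Arr a b => Nat.max (lv a + 1) (lv b) end.

Fixpoint pure (k : nat) : ty :=
  match k with 0 => N | S k' => Arr (pure k') N end.

Fixpoint argtys (s : ty) : list ty :=
  match s with N => [] | Arr a b => a :: argtys b end.

(* ---------- meta-terms (NSPs are the meta-terms whose heads are variables) ----
   A procedure  MLam [t0;..;t(n-1)] e  binds x0..x(n-1); inside e, index i < n
   denotes x(n-1-i) (innermost binder = index 0), index n + j denotes outer j.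
   Expressions:  MBot = bot,  MNum n = n,  MCase h br = case h of (i => br i).
   Heads:  HVar x r a = x a0 .. a(r-1)   (an NSP application),
           HApp P r a = P a0 .. a(r-1)   (meta-application),
           HExp E     = E                (for case-of-case).                    *)
CoInductive mexp : Type :=
| MBot : mexp
| MNum : nat -> mexp
| MCase : mhead -> (nat -> mexp) -> mexp
with mhead : Type :=
| HVar : nat -> nat -> (nat -> mproc) -> mhead
| HApp : mproc -> nat -> (nat -> mproc) -> mhead
| HExp : mexp -> mhead
with mproc : Type :=
| MLam : list ty -> mexp -> mproc.

Definition upren (n : nat) (rho : nat -> nat) (i : nat) : nat :=
  if i <? n then i else rho (i - n) + n.

CoFixpoint ren_e (rho : nat -> nat) (e : mexp) : mexp :=
  match e with
  | MBot => MBot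
  | MNum n => MNum n
  | MCase h br => MCase (ren_h rho h) (fun i => ren_e rho (br i))
  end
with ren_h (rho : nat -> nat) (h : mhead) : mhead :=
  match h with
  | HVar x r a => HVar (rho x) r (fun i => ren_p rho (a i))
  | HApp p r a => HApp (ren_p rho p) r (fun i => ren_p rho (a i))
  | HExp e => HExp (ren_e rho e)
  end
with ren_p (rho : nat -> nat) (p : mproc) : mproc :=
  match p with
  | MLam tys b => MLam tys (ren_e (upren (length tys) rho) b)
  end.

Inductive sitem : Type := SVar : nat -> sitem | STerm : mproc -> sitem.

Definition upsub (n : nat) (sg : nat -> sitem) (i : nat) : sitem :=
  if i <? n then SVar i
  else match sg (i - n) with
       | SVar j => SVar (j + n)
       | STerm p => STerm (ren_p (fun j => j + n) p)
       end.

CoFixpoint sub_e (sg : nat -> sitem) (e : mexp) : mexp :=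
  match e with
  | MBot => MBot
  | MNum n => MNum n
  | MCase h br => MCase (sub_h sg h) (fun i => sub_e sg (br i))
  end
with sub_h (sg : nat -> sitem) (h : mhead) : mhead :=
  match h with
  | HVar x r a =>
      match sg x with
      | SVar j => HVar j r (fun i => sub_p sg (a i))
      | STerm p => HApp p r (fun i => sub_p sg (a i))
      end
  | HApp p r a => HApp (sub_p sg p) r (fun i => sub_p sg (a i))
  | HExp e => HExp (sub_e sg e)
  end
with sub_p (sg : nat -> sitem) (p : mproc) : mproc :=
  match p with
  | MLam tys b => MLam tys (sub_e (upsub (length tys) sg) b)
  end.

Definition beta_sub (n : nat) (a : nat -> mproc) (i : nat) : sitem :=
  if i <? n then STerm (a (n - 1 - i)) else SVar (i - n).

Inductive hstep : mexp -> mexp -> Prop :=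
| hs_bot br : hstep (MCase (HExp MBot) br) MBot
| hs_num n br : hstep (MCase (HExp (MNum n)) br) (br n)
| hs_cc h e br :
    hstep (MCase (HExp (MCase h e)) br) (MCase h (fun i => MCase (HExp (e i)) br))
| hs_beta tys b r a br :
    hstep (MCase (HApp (MLam tys b) r a) br)
          (MCase (HExp (sub_e (beta_sub (length tys) a) b)) br).

Definition hsteps := clos_refl_trans mexp hstep.

Definition is_hnf (e : mexp) : Prop :=
  match e with
  | MBot => True
  | MNum _ => True
  | MCase (HVar _ _ _) _ => True
  | _ => False
  end.

(* the head normal form reached by head reduction, or bot if there is none
   (head reduction is deterministic, so this is well defined) *)
Definition hnf_of (e : mexp) : mexp :=
  match excluded_middle_informative (exists e', hsteps e e' /\ is_hnf e') with
  | left H => proj1_sig (constructive_indefinite_description _ H)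
  | right _ => MBot
  end.

CoFixpoint eval_e (e : mexp) : mexp :=
  match hnf_of e with
  | MNum n => MNum n
  | MCase (HVar x r a) br =>
      MCase (HVar x r (fun i => eval_p (a i))) (fun i => eval_e (br i))
  | _ => MBot
  end
with eval_p (p : mproc) : mproc :=
  match p with MLam tys b => MLam tys (eval_e b) end.

Definition app_sub (n : nat) (q : mproc) (i : nat) : sitem :=
  if i <? n then SVar i
  else if i =? n then STerm (ren_p (fun j => j + n) q)
  else SVar (i - 1).

Definition app (p q : mproc) : mproc :=
  match p with
  | MLam (t0 :: ts) e => MLam ts (eval_e (sub_e (app_sub (length ts) q) e))
  | MLam [] _ => MLam [] MBot
  end.

(* lambda x. (lambda ys. e) = lambda x ys. e  (free with our de Bruijn convention) *)
Definition lam1 (t : ty) (p : mproc) : mproc :=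
  match p with MLam tys b => MLam (t :: tys) b end.

Definition dflt_eta : nat -> mproc := fun _ => MLam [] MBot.

Definition mketa (s : ty) (L : list (nat -> mproc)) (x : nat) : mproc :=
  let n := length (argtys s) in
  MLam (argtys s)
    (MCase (HVar (x + n) n (fun j => nth j L dflt_eta (n - 1 - j))) (fun i => MNum i)).

Fixpoint etaL (s : ty) : list (nat -> mproc) :=
  match s with
  | N => []
  | Arr a b => mketa a (etaL a) :: etaL b
  end.

Definition eta (s : ty) (x : nat) : mproc := mketa s (etaL s) x.

CoInductive wt_e : list ty -> mexp -> Prop :=
| wt_bot G : wt_e G MBot
| wt_num G n : wt_e G (MNum n)
| wt_case G x s r a br :
    nth_error G x = Some s ->
    r = length (argtys s) ->
    (forall i, i < r -> wt_p G (a i) (nth i (argtys s) N)) ->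
    (forall i, wt_e G (br i)) ->
    wt_e G (MCase (HVar x r a) br)
with wt_p : list ty -> mproc -> ty -> Prop :=
| wt_lam G s b : wt_e (rev (argtys s) ++ G) b -> wt_p G (MLam (argtys s) b) s.

Inductive fv_e : nat -> mexp -> Prop :=
| fv_head x r a br : fv_e x (MCase (HVar x r a) br)
| fv_arg j x r a br i : i < r -> fv_p j (a i) -> fv_e j (MCase (HVar x r a) br)
| fv_br j x r a br i : fv_e j (br i) -> fv_e j (MCase (HVar x r a) br)
with fv_p : nat -> mproc -> Prop :=
| fv_lam j tys b : fv_e (j + length tys) b -> fv_p j (MLam tys b).

Definition val (p : mproc) : option nat :=
  match p with MLam _ (MNum n) => Some n | _ => None end.

Definition obs_le (s : ty) (p p' : mproc) : Prop :=
  forall r, wt_p [] r (Arr s N) ->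
  forall n, val (app r p) = Some n -> val (app r p') = Some n.

Inductive pcf : Type :=
| PVar : nat -> pcf
| PNum : nat -> pcf
| PSuc : pcf
| PPre : pcf
| PIfz : pcf
| PC : (nat -> option nat) -> pcf
| PY : ty -> pcf
| PLam : ty -> pcf -> pcf
| PApp : pcf -> pcf -> pcf.

Inductive has_type (k : nat) : list ty -> pcf -> ty -> Prop :=
| T_var G i s : nth_error G i = Some s -> has_type k G (PVar i) s
| T_num G n : has_type k G (PNum n) N
| T_suc G : has_type k G PSuc (Arr N N)
| T_pre G : has_type k G PPre (Arr N N)
| T_ifz G : has_type k G PIfz (Arr N (Arr N (Arr N N)))
| T_C G f : has_type k G (PC f) (Arr N N)
| T_Y G s : lv s <= k -> has_type k G (PY s) (Arr (Arr s s) s)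
| T_lam G s t M : has_type k (s :: G) M t -> has_type k G (PLam s M) (Arr s t)
| T_app G s t M M' :
    has_type k G M (Arr s t) -> has_type k G M' s -> has_type k G (PApp M M') t.

CoFixpoint Ffix (s : ty) (gi : nat) : mproc :=
  let n := length (argtys s) in
  MLam (argtys s)
    (MCase (HVar (gi + n) (S n)
              (fun j => match j with
                        | 0 => Ffix s (gi + n)
                        | S j' => eta (nth j' (argtys s) N) (n - 1 - j')
                        end))
           (fun i => MNum i)).

Definition noargs : nat -> mproc := fun _ => MLam [] MBot.

Fixpoint den (G : list ty) (M : pcf) : mproc :=
  match M with
  | PVar i => eta (nth i G N) i
  | PNum n => MLam [] (MNum n)
  | PSuc => MLam [N] (MCase (HVar 0 0 noargs) (fun i => MNum (S i)))
  | PPre => MLam [N] (MCase (HVar 0 0 noargs) (fun i => MNum (Nat.pred i)))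
  | PIfz => MLam [N; N; N]
      (MCase (HVar 2 0 noargs)
         (fun i => match i with
                   | 0 => MCase (HVar 1 0 noargs) (fun j => MNum j)
                   | S _ => MCase (HVar 0 0 noargs) (fun j => MNum j)
                   end))
  | PC f => MLam [N] (MCase (HVar 0 0 noargs)
                        (fun i => match f i with Some m => MNum m | None => MBot end))
  | PY s => lam1 (Arr s s) (Ffix s 0)
  | PLam s M' => lam1 s (den (s :: G) M')
  | PApp M1 M2 => app (den G M1) (den G M2)
  end.

Definition g_regular (k : nat) (G : list ty) (gi : nat) : Prop :=
  nth_error G gi = Some (Arr (pure (S k)) (pure (S k))) /\
  forall j t, j <> gi -> nth_error G j = Some t -> lv t <= k.

(* e' is a subexpression of e; Om is the local variable environment of the
   context (types of the variables bound on the path, innermost first) *)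
Inductive subexp : mexp -> mexp -> list ty -> Prop :=
| sub_refl e : subexp e e []
| sub_br x r a br i e' Om :
    subexp (br i) e' Om -> subexp (MCase (HVar x r a) br) e' Om
| sub_arg x r a br i tys b e' Om :
    i < r -> a i = MLam tys b -> subexp b e' Om ->
    subexp (MCase (HVar x r a) br) e' (Om ++ rev tys).

(* sg is an x,V-closed substitution covering the free variables of o other
   than x; the target context is [x : pure k] (x becomes index 0) *)
Definition xV_closed (k : nat) (G : list ty) (x : nat) (V : nat -> Prop)
    (o : mproc) (sg : nat -> sitem) : Prop :=
  sg x = SVar 0 /\
  forall w, w <> x -> fv_p w o ->
    exists r t, sg w = STerm r /\ nth_error G w = Some t /\
      wt_p [pure k] r t /\ (fv_p 0 r -> V w /\ lv t < k).

CoInductive head_spinal (k : nat) : list ty -> nat -> mexp -> nat -> (nat -> Prop) -> Prop :=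
| HS G gi e x V a br t body o Om e' sg :
    nth_error G x = Some (pure k) ->
    (forall j, V j -> j < length G) ->
    e = MCase (HVar gi 2 a) br ->
    a 0 = MLam [t] body ->
    a 1 = o ->
    subexp body e' Om ->
    xV_closed k G x V o sg ->
    obs_le (Arr (pure k) (pure k))
      (eval_p (lam1 (pure k) (eta (pure k) 0)))
      (eval_p (lam1 (pure k) (sub_p sg o))) ->
    head_spinal k (Om ++ t :: G) (gi + length Om + 1) e'
      (length Om) (fun j => j < length Om) ->
    head_spinal k G gi e x V.

Definition g_spinal (k : nat) (G : list ty) (gi : nat) (p : mproc) : Prop :=
  match p with
  | MLam tys e => exists Om e' x V,
      subexp e e' Om /\
      head_spinal k (Om ++ rev tys ++ G) (gi + length Om + length tys) e' x V
  end.

(* Main.v *)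
Require Import Defs.
From Stdlib Require Import List Arith Lia Relations ClassicalEpsilon FunctionalExtensionality.
Import ListNotations.

(** Treat the fixed point procedures [DY s] with [lv s <= k] as constants.  By hereditary
    substitution every denotable procedure is then the evaluation of a normal form over these
    constants, and this normal form, unlike the procedure itself, is a well-founded tree.  When
    it is run on an abstract machine, every piece of code ever executed is a subterm of the
    normal form, or the code of a constant, with closures of level at most [k] substituted for
    its variables; the code of a constant never mentions [g], so every node
    [g (\x'. E[e']) o] of the evaluation tree comes from a node of the normal form.
    The body [E[e']] is then the evaluation of code of a strictly smaller shape.  Suppose the
    next node [g (..) o'] of the spine came from code outside that shape.  Such code can use
    the variable [x'] of type [pure k] only through closures of level below [k], so [o']
    dominating [x'] would factor [pure k] through types of lower level; a pure type is not
    even observationally a retract of such types.  Hence the shape decreases along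
    a spine, and an infinite spine is impossible. *)

(** Three obstacles shape the development. Trees built by corecursion are rarely provably equal, so
    equations are replaced by bisimilarity and by the possession of a common evaluation tree.
    Arguments beyond the arity are junk which eta-expansion discards, so the tree of a denotation is
    matched only weakly ([wEv]), and [clean_e] carries observations across the gap. Evaluation mixes
    pieces of code of different origin, so every piece has a colour that fixes what it may call and
    which global variables it may mention. The constants [DY s] stay folded because their unfolding
    is an infinite tree, along which no shape could decrease. The level [k] enters twice:
    [lv s <= k] puts the functional argument of [DY s] at level at most [S k], so whatever is passed
    to that argument has level at most [k]; and a closing substitution may hide the spine variable
    only in procedures of level below [k]. *)

Definition mexp_frob (e : mexp) : mexp :=
  match e with MBot => MBot | MNum n => MNum n | MCase h br => MCase h br end.
Lemma mexp_frobE e : e = mexp_frob e.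
Proof. now destruct e. Qed.

Definition mhead_frob (h : mhead) : mhead :=
  match h with
  | HVar x r a => HVar x r a | HApp p r a => HApp p r a | HExp e => HExp e
  end.
Lemma mhead_frobE h : h = mhead_frob h.
Proof. now destruct h. Qed.

Definition mproc_frob (p : mproc) : mproc := match p with MLam t b => MLam t b end.
Lemma mproc_frobE p : p = mproc_frob p.
Proof. now destruct p. Qed.

Lemma ren_botE rho : ren_e rho MBot = MBot.
Proof. now rewrite (mexp_frobE (ren_e _ _)). Qed.
Lemma ren_numE rho n : ren_e rho (MNum n) = MNum n.
Proof. now rewrite (mexp_frobE (ren_e _ _)). Qed.
Lemma ren_caseE rho h br :
  ren_e rho (MCase h br) = MCase (ren_h rho h) (fun i => ren_e rho (br i)).
Proof. now rewrite (mexp_frobE (ren_e _ _)). Qed.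
Lemma ren_varE rho x r a : ren_h rho (HVar x r a) = HVar (rho x) r (fun i => ren_p rho (a i)).
Proof. now rewrite (mhead_frobE (ren_h _ _)). Qed.
Lemma ren_appE rho p r a :
  ren_h rho (HApp p r a) = HApp (ren_p rho p) r (fun i => ren_p rho (a i)).
Proof. now rewrite (mhead_frobE (ren_h _ _)). Qed.
Lemma ren_expE rho e : ren_h rho (HExp e) = HExp (ren_e rho e).
Proof. now rewrite (mhead_frobE (ren_h _ _)). Qed.
Lemma ren_lamE rho t b : ren_p rho (MLam t b) = MLam t (ren_e (upren (length t) rho) b).
Proof. now rewrite (mproc_frobE (ren_p _ _)). Qed.

Lemma sub_botE sg : sub_e sg MBot = MBot.
Proof. now rewrite (mexp_frobE (sub_e _ _)). Qed.
Lemma sub_numE sg n : sub_e sg (MNum n) = MNum n.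
Proof. now rewrite (mexp_frobE (sub_e _ _)). Qed.
Lemma sub_caseE sg h br :
  sub_e sg (MCase h br) = MCase (sub_h sg h) (fun i => sub_e sg (br i)).
Proof. now rewrite (mexp_frobE (sub_e _ _)). Qed.
Lemma sub_varE sg x r a :
  sub_h sg (HVar x r a) =
  match sg x with
  | SVar j => HVar j r (fun i => sub_p sg (a i))
  | STerm p => HApp p r (fun i => sub_p sg (a i))
  end.
Proof. rewrite (mhead_frobE (sub_h _ _)); simpl. now destruct (sg x). Qed.
Lemma sub_appE sg p r a :
  sub_h sg (HApp p r a) = HApp (sub_p sg p) r (fun i => sub_p sg (a i)).
Proof. now rewrite (mhead_frobE (sub_h _ _)). Qed.
Lemma sub_expE sg e : sub_h sg (HExp e) = HExp (sub_e sg e).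
Proof. now rewrite (mhead_frobE (sub_h _ _)). Qed.
Lemma sub_lamE sg t b : sub_p sg (MLam t b) = MLam t (sub_e (upsub (length t) sg) b).
Proof. now rewrite (mproc_frobE (sub_p _ _)). Qed.

Arguments ren_e : simpl never. Arguments ren_h : simpl never. Arguments ren_p : simpl never.
Arguments sub_e : simpl never. Arguments sub_h : simpl never. Arguments sub_p : simpl never.
Arguments eval_e : simpl never. Arguments eval_p : simpl never.

Create HintDb mterm.
#[export] Hint Rewrite ren_botE ren_numE ren_caseE ren_varE ren_appE ren_expE ren_lamE
  sub_botE sub_numE sub_caseE sub_varE sub_appE sub_expE sub_lamE : mterm.

(** * Bisimilarity *)

Definition lam_rel (X : mexp -> mexp -> Prop) (p p' : mproc) : Prop :=
  match p, p' with MLam t b, MLam t' b' => t = t' /\ X b b' end.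

Arguments lam_rel X !p !p' /.

Definition head_rel (X : mexp -> mexp -> Prop) (h h' : mhead) : Prop :=
  match h, h' with
  | HVar x r a, HVar x' r' a' => x = x' /\ r = r' /\ forall i, lam_rel X (a i) (a' i)
  | HApp p r a, HApp p' r' a' =>
      lam_rel X p p' /\ r = r' /\ forall i, lam_rel X (a i) (a' i)
  | HExp e, HExp e' => X e e'
  | _, _ => False
  end.

(* Indexing by depth replaces coinduction by induction. *)
Fixpoint bisn (n : nat) (e e' : mexp) {struct n} : Prop :=
  match n with
  | 0 => True
  | S n =>
      match e, e' with
      | MBot, MBot => True
      | MNum a, MNum b => a = b
      | MCase h br, MCase h' br' =>
          head_rel (bisn n) h h' /\ forall i, bisn n (br i) (br' i)
      | _, _ => False
      end
  end.

Definition bis (e e' : mexp) : Prop := forall n, bisn n e e'.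
Definition bisp (p p' : mproc) : Prop := forall n, lam_rel (bisn n) p p'.

Definition item_bisn (n : nat) (i i' : sitem) : Prop :=
  match i, i' with
  | SVar a, SVar b => a = b
  | STerm p, STerm p' => lam_rel (bisn n) p p'
  | _, _ => False
  end.
Definition item_bis (i i' : sitem) : Prop := forall n, item_bisn n i i'.

Lemma lam_rel_refl (X : mexp -> mexp -> Prop) : (forall e, X e e) -> forall p, lam_rel X p p.
Proof. intros H [t b]; simpl; auto. Qed.

Lemma bisn_refl n : forall e, bisn n e e.
Proof.
  induction n as [|n IH]; [easy|].
  intros [| m | h br]; simpl; auto. split; auto.
  destruct h as [x r a | p r a | e]; simpl; auto using lam_rel_refl.
Qed.

Lemma bis_refl e : bis e e.
Proof. intro n; apply bisn_refl. Qed.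
Lemma bisp_refl p : bisp p p.
Proof. intro n; apply lam_rel_refl, bisn_refl. Qed.
Lemma item_bis_refl i : item_bis i i.
Proof. intro n; destruct i; simpl; auto. apply bisp_refl. Qed.

Lemma lam_rel_sym (X : mexp -> mexp -> Prop) :
  (forall e e', X e e' -> X e' e) -> forall p p', lam_rel X p p' -> lam_rel X p' p.
Proof. intros H [t b] [t' b']; simpl; intuition. Qed.

Lemma bisn_sym n : forall e e', bisn n e e' -> bisn n e' e.
Proof.
  induction n as [|n IH]; [easy|].
  intros [| m | h br] [| m' | h' br']; simpl; auto. intros [H1 H2]. split; auto.
  destruct h, h'; simpl in *; try easy; intuition; eauto using lam_rel_sym.
Qed.

Lemma bis_sym e e' : bis e e' -> bis e' e.
Proof. intros H n; apply bisn_sym, H. Qed.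
Lemma bisp_sym p p' : bisp p p' -> bisp p' p.
Proof. intros H n; eapply lam_rel_sym; [apply bisn_sym | apply H]. Qed.
Lemma item_bis_sym i i' : item_bis i i' -> item_bis i' i.
Proof.
  intros H n; specialize (H n); destruct i, i'; simpl in *; auto.
  eapply lam_rel_sym; [apply bisn_sym | apply H].
Qed.

Lemma lam_rel_trans (X : mexp -> mexp -> Prop) :
  (forall a b c, X a b -> X b c -> X a c) ->
  forall p q r, lam_rel X p q -> lam_rel X q r -> lam_rel X p r.
Proof.
  intros H [t b] [t' b'] [t2 b2]; simpl. intros [-> H1] [-> H2]; eauto.
Qed.

Lemma bisn_trans n : forall a b c, bisn n a b -> bisn n b c -> bisn n a c.
Proof.
  induction n as [|n IH]; [easy|].
  intros [| m | h br] [| m' | h' br'] [| m2 | h2 br2]; simpl; try easy; [congruence|].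
  intros [H1 H2] [H3 H4]. split; [|eauto].
  destruct h, h', h2; simpl in *; try easy; eauto.
  - destruct H1 as (-> & -> & H1), H3 as (-> & -> & H3); repeat split; auto.
    intro i; eapply lam_rel_trans; eauto.
  - destruct H1 as (H0 & -> & H1), H3 as (H5 & -> & H3); repeat split; auto.
    + eapply lam_rel_trans; eauto.
    + intro i; eapply lam_rel_trans; eauto.
Qed.

Lemma bis_trans a b c : bis a b -> bis b c -> bis a c.
Proof. intros H1 H2 n; eapply bisn_trans; eauto. Qed.
Lemma bisp_trans a b c : bisp a b -> bisp b c -> bisp a c.
Proof. intros H1 H2 n; eapply lam_rel_trans; eauto using bisn_trans. Qed.
Lemma item_bis_trans a b c : item_bis a b -> item_bis b c -> item_bis a c.
Proof.
  intros H1 H2 n; specialize (H1 n); specialize (H2 n).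
  destruct a, b, c; simpl in *; try easy; [congruence|].
  eapply lam_rel_trans; eauto using bisn_trans.
Qed.

Lemma bisp_lam t b t' b' : bisp (MLam t b) (MLam t' b') <-> t = t' /\ bis b b'.
Proof.
  split.
  - intro H; split; [apply (H 0) | intro n; apply (H n)].
  - intros [-> H] n; simpl; auto.
Qed.

Lemma item_bis_term p p' : item_bis (STerm p) (STerm p') <-> bisp p p'.
Proof. reflexivity. Qed.

(** * Renaming and substitution up to bisimilarity *)

Definition iren (rho : nat -> nat) (i : sitem) : sitem :=
  match i with SVar j => SVar (rho j) | STerm p => STerm (ren_p rho p) end.
Definition isub (sg : nat -> sitem) (i : sitem) : sitem :=
  match i with SVar j => sg j | STerm p => STerm (sub_p sg p) end.

Lemma ren_bisn n : forall e e' rho rho', bisn n e e' -> (forall y, rho y = rho' y) ->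
  bisn n (ren_e rho e) (ren_e rho' e').
Proof.
  induction n as [|n IH]; [easy|].
  assert (IHp : forall p p' rho rho', lam_rel (bisn n) p p' -> (forall y, rho y = rho' y) ->
     lam_rel (bisn n) (ren_p rho p) (ren_p rho' p')).
  { intros [t b] [t' b'] rho rho' [-> H] Hr. autorewrite with mterm. split; auto.
    apply IH; auto. intro y; unfold upren. now rewrite Hr. }
  intros [| m | h br] [| m' | h' br'] rho rho' H Hr; autorewrite with mterm; simpl in *; try easy.
  destruct H as [H1 H2]; split; auto.
  destruct h, h'; autorewrite with mterm; simpl in *; try easy; auto.
  - destruct H1 as (-> & -> & H1); repeat split; auto.
  - destruct H1 as (H0 & -> & H1); repeat split; auto.
Qed.

Lemma ren_renn n : forall e rho rho' rho2, (forall y, rho2 y = rho (rho' y)) ->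
  bisn n (ren_e rho (ren_e rho' e)) (ren_e rho2 e).
Proof.
  induction n as [|n IH]; [easy|].
  assert (IHp : forall p rho rho' rho2, (forall y, rho2 y = rho (rho' y)) ->
     lam_rel (bisn n) (ren_p rho (ren_p rho' p)) (ren_p rho2 p)).
  { intros [t b] rho rho' rho2 Hr. autorewrite with mterm. split; auto.
    apply IH; auto. intro y; unfold upren. destruct (Nat.ltb_spec y (length t)).
    - now rewrite (proj2 (Nat.ltb_lt _ _)).
    - rewrite (proj2 (Nat.ltb_ge _ _)) by lia. rewrite Hr. do 2 f_equal. lia. }
  intros [| m | h br] rho rho' rho2 Hr; autorewrite with mterm; simpl in *; auto.
  split; auto.
  destruct h; autorewrite with mterm; simpl; auto.
Qed.

Lemma ren_p_bis p p' rho rho' : bisp p p' -> (forall y, rho y = rho' y) ->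
  bisp (ren_p rho p) (ren_p rho' p').
Proof.
  destruct p as [t b], p' as [t' b']. rewrite bisp_lam. intros [-> H] Hr.
  autorewrite with mterm. apply bisp_lam; split; auto. intro n; apply ren_bisn; auto.
  intro y; unfold upren. now rewrite Hr.
Qed.

Lemma ren_ren_p p rho rho' rho2 : (forall y, rho2 y = rho (rho' y)) ->
  bisp (ren_p rho (ren_p rho' p)) (ren_p rho2 p).
Proof.
  destruct p as [t b]. intros Hr. autorewrite with mterm. apply bisp_lam; split; auto.
  intro n. apply ren_renn.
  intro y; unfold upren. destruct (Nat.ltb_spec y (length t)).
  - now rewrite (proj2 (Nat.ltb_lt _ _)).
  - rewrite (proj2 (Nat.ltb_ge _ _)) by lia. rewrite Hr. do 2 f_equal. lia.
Qed.

Lemma upsub_ge n sg i : n <= i -> upsub n sg i = iren (fun j => j + n) (sg (i - n)).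
Proof. intro H; unfold upsub. now rewrite (proj2 (Nat.ltb_ge _ _)). Qed.
Lemma upsub_lt n sg i : i < n -> upsub n sg i = SVar i.
Proof. intro H; unfold upsub. now rewrite (proj2 (Nat.ltb_lt _ _)). Qed.
Lemma upren_ge n rho i : n <= i -> upren n rho i = rho (i - n) + n.
Proof. intro H; unfold upren. now rewrite (proj2 (Nat.ltb_ge _ _)). Qed.
Lemma upren_lt n rho i : i < n -> upren n rho i = i.
Proof. intro H; unfold upren. now rewrite (proj2 (Nat.ltb_lt _ _)). Qed.

Lemma iren_bis i i' rho rho' : item_bis i i' -> (forall y, rho y = rho' y) ->
  item_bis (iren rho i) (iren rho' i').
Proof.
  intros H Hr; destruct i, i'; simpl; try (now specialize (H 0)).
  - intro m; simpl. rewrite <- Hr. f_equal. apply (H 0).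
  - apply item_bis_term, ren_p_bis; auto.
Qed.

Lemma upsub_bis n sg sg' : (forall y, item_bis (sg y) (sg' y)) ->
  forall y, item_bis (upsub n sg y) (upsub n sg' y).
Proof.
  intros H y. destruct (Nat.lt_ge_cases y n).
  - rewrite !upsub_lt; auto using item_bis_refl.
  - rewrite !upsub_ge; auto using iren_bis.
Qed.

Lemma sub_bisn n : forall e e' sg sg', bisn n e e' -> (forall y, item_bis (sg y) (sg' y)) ->
  bisn n (sub_e sg e) (sub_e sg' e').
Proof.
  induction n as [|n IH]; [easy|].
  assert (IHp : forall p p' sg sg', lam_rel (bisn n) p p' ->
     (forall y, item_bis (sg y) (sg' y)) -> lam_rel (bisn n) (sub_p sg p) (sub_p sg' p')).
  { intros [t b] [t' b'] rho rho' [-> H] Hr. autorewrite with mterm. split; auto.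
    apply IH; auto using upsub_bis. }
  intros [| m | h br] [| m' | h' br'] rho rho' H Hr; autorewrite with mterm; simpl in *; try easy.
  destruct H as [H1 H2]; split; auto.
  destruct h as [x r a| |], h' as [x' r' a'| |]; autorewrite with mterm; simpl in *; try easy; auto.
  - destruct H1 as (-> & -> & H1). specialize (Hr x') as Hx; specialize (Hx n).
    destruct (rho x'), (rho' x'); simpl in *; try easy; repeat split; auto.
  - destruct H1 as (H0 & -> & H1); repeat split; auto.
Qed.

Lemma sub_bis e e' sg sg' : bis e e' -> (forall y, item_bis (sg y) (sg' y)) ->
  bis (sub_e sg e) (sub_e sg' e').
Proof. intros H Hr n; apply sub_bisn; auto. Qed.

Lemma sub_p_bis p p' sg sg' : bisp p p' -> (forall y, item_bis (sg y) (sg' y)) ->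
  bisp (sub_p sg p) (sub_p sg' p').
Proof.
  destruct p as [t b], p' as [t' b']. rewrite bisp_lam. intros [-> H] Hr.
  autorewrite with mterm. apply bisp_lam; split; auto using sub_bis, upsub_bis.
Qed.

Lemma upsub_ren n sg rho tau : (forall y, item_bis (sg (rho y)) (tau y)) ->
  forall y, item_bis (upsub n sg (upren n rho y)) (upsub n tau y).
Proof.
  intros H y. destruct (Nat.lt_ge_cases y n).
  - rewrite upren_lt, !upsub_lt; auto using item_bis_refl.
  - rewrite upren_ge, !upsub_ge by lia. apply iren_bis; auto.
    replace (rho (y - n) + n - n) with (rho (y - n)) by lia. auto.
Qed.

Lemma sub_renn n : forall e sg rho tau, (forall y, item_bis (sg (rho y)) (tau y)) ->
  bisn n (sub_e sg (ren_e rho e)) (sub_e tau e).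
Proof.
  induction n as [|n IH]; [easy|].
  assert (IHp : forall p sg rho tau, (forall y, item_bis (sg (rho y)) (tau y)) ->
     lam_rel (bisn n) (sub_p sg (ren_p rho p)) (sub_p tau p)).
  { intros [t b] rho rho' rho2 Hr. autorewrite with mterm. split; auto.
    apply IH, upsub_ren; auto. }
  intros [| m | h br] sg rho tau Hr; autorewrite with mterm; simpl in *; auto.
  split; auto.
  destruct h; autorewrite with mterm; simpl; auto.
  pose proof (Hr n0 n) as Hx.
  destruct (sg (rho n0)), (tau n0); simpl in *; try easy; repeat split; auto.
Qed.

Lemma sub_ren_p p sg rho tau : (forall y, item_bis (sg (rho y)) (tau y)) ->
  bisp (sub_p sg (ren_p rho p)) (sub_p tau p).
Proof.
  destruct p as [t b]; intro H; autorewrite with mterm; apply bisp_lam; split; auto.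
  intro n; apply sub_renn, upsub_ren; auto.
Qed.

Lemma upren_sub n sg rho tau : (forall y, item_bis (iren rho (sg y)) (tau y)) ->
  forall y, item_bis (iren (upren n rho) (upsub n sg y)) (upsub n tau y).
Proof.
  intros H y. destruct (Nat.lt_ge_cases y n).
  - rewrite !upsub_lt by lia. simpl. rewrite upren_lt; auto using item_bis_refl.
  - rewrite !upsub_ge by lia. eapply item_bis_trans; [|apply iren_bis; [apply H | reflexivity]].
    destruct (sg (y - n)); simpl.
    + rewrite upren_ge by lia. intro m; simpl. do 2 f_equal; lia.
    + apply item_bis_term. eapply bisp_trans; [apply ren_ren_p; reflexivity|].
      apply bisp_sym, ren_ren_p. intro z. rewrite upren_ge by lia. do 2 f_equal; lia.
Qed.

Lemma ren_subn n : forall e sg rho tau, (forall y, item_bis (iren rho (sg y)) (tau y)) ->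
  bisn n (ren_e rho (sub_e sg e)) (sub_e tau e).
Proof.
  induction n as [|n IH]; [easy|].
  assert (IHp : forall p sg rho tau, (forall y, item_bis (iren rho (sg y)) (tau y)) ->
     lam_rel (bisn n) (ren_p rho (sub_p sg p)) (sub_p tau p)).
  { intros [t b] rho rho' rho2 Hr. autorewrite with mterm. split; auto.
    apply IH, upren_sub; auto. }
  intros [| m | h br] sg rho tau Hr; autorewrite with mterm; simpl in *; auto.
  split; auto.
  destruct h; autorewrite with mterm; simpl; auto.
  pose proof (Hr n0 n) as Hx.
  destruct (sg n0), (tau n0); simpl in *; autorewrite with mterm; simpl; try easy;
    repeat split; auto.
Qed.

Lemma ren_sub_p p sg rho tau : (forall y, item_bis (iren rho (sg y)) (tau y)) ->
  bisp (ren_p rho (sub_p sg p)) (sub_p tau p).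
Proof.
  destruct p as [t b]; intro H; autorewrite with mterm; apply bisp_lam; split; auto.
  intro n; apply ren_subn, upren_sub; auto.
Qed.

Lemma upsub_sub n sg tau ups : (forall y, item_bis (isub sg (tau y)) (ups y)) ->
  forall y, item_bis (isub (upsub n sg) (upsub n tau y)) (upsub n ups y).
Proof.
  intros H y. destruct (Nat.lt_ge_cases y n).
  - rewrite (upsub_lt n tau), (upsub_lt n ups) by lia. simpl.
    rewrite upsub_lt; auto using item_bis_refl.
  - rewrite (upsub_ge n tau), (upsub_ge n ups) by lia.
    eapply item_bis_trans; [|apply iren_bis; [apply H | reflexivity]].
    destruct (tau (y - n)); simpl.
    + rewrite upsub_ge by lia. replace (n0 + n - n) with n0 by lia. apply item_bis_refl.
    + apply item_bis_term.
      eapply bisp_trans; [|apply bisp_sym, ren_sub_p; intro; apply item_bis_refl].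
      apply sub_ren_p. intro z. rewrite upsub_ge by lia.
      replace (z + n - n) with z by lia. apply item_bis_refl.
Qed.

Lemma sub_subn n : forall e sg tau ups, (forall y, item_bis (isub sg (tau y)) (ups y)) ->
  bisn n (sub_e sg (sub_e tau e)) (sub_e ups e).
Proof.
  induction n as [|n IH]; [easy|].
  assert (IHp : forall p sg tau ups, (forall y, item_bis (isub sg (tau y)) (ups y)) ->
     lam_rel (bisn n) (sub_p sg (sub_p tau p)) (sub_p ups p)).
  { intros [t b] rho rho' rho2 Hr. autorewrite with mterm. split; auto.
    apply IH, upsub_sub; auto. }
  intros [| m | h br] sg tau ups Hr; autorewrite with mterm; simpl in *; auto.
  split; auto.
  destruct h; autorewrite with mterm; simpl; auto.
  pose proof (Hr n0 n) as Hx. destruct (tau n0); simpl in *; autorewrite with mterm; simpl.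
  - destruct (sg n2), (ups n0); simpl in *; try easy; repeat split; auto.
  - destruct (ups n0); simpl in *; try easy; repeat split; auto.
Qed.

Lemma sub_sub e sg tau ups : (forall y, item_bis (isub sg (tau y)) (ups y)) ->
  bis (sub_e sg (sub_e tau e)) (sub_e ups e).
Proof. intros H n; apply sub_subn; auto. Qed.

Lemma upsub_var n rho sg : (forall y, sg y = SVar (rho y)) ->
  forall y, upsub n sg y = SVar (upren n rho y).
Proof.
  intros H y. destruct (Nat.lt_ge_cases y n).
  - now rewrite upsub_lt, upren_lt.
  - now rewrite upsub_ge, upren_ge, H.
Qed.

Lemma ren_as_subn n : forall e rho sg, (forall y, sg y = SVar (rho y)) ->
  bisn n (ren_e rho e) (sub_e sg e).
Proof.
  induction n as [|n IH]; [easy|].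
  assert (IHp : forall p rho sg, (forall y, sg y = SVar (rho y)) ->
     lam_rel (bisn n) (ren_p rho p) (sub_p sg p)).
  { intros [t b] rho sg Hr. autorewrite with mterm. split; auto.
    apply IH, upsub_var; auto. }
  intros [| m | h br] rho sg Hr; autorewrite with mterm; simpl in *; auto.
  split; auto.
  destruct h; autorewrite with mterm; simpl; auto.
  rewrite Hr; simpl; auto.
Qed.

Lemma sub_idn n : forall e sg, (forall y, sg y = SVar y) -> bisn n (sub_e sg e) e.
Proof.
  induction n as [|n IH]; [easy|].
  assert (IHp : forall p sg, (forall y, sg y = SVar y) -> lam_rel (bisn n) (sub_p sg p) p).
  { intros [t b] sg Hr. autorewrite with mterm. split; auto. apply IH.
    intro y. rewrite (upsub_var _ (fun y => y)) by auto.
    unfold upren. destruct (Nat.ltb_spec y (length t)); f_equal; lia. }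
  intros [| m | h br] sg Hr; autorewrite with mterm; simpl in *; auto.
  split; auto.
  destruct h; autorewrite with mterm; simpl; auto.
  rewrite Hr; simpl; auto.
Qed.

Lemma sub_id e sg : (forall y, sg y = SVar y) -> bis (sub_e sg e) e.
Proof. intros H n; apply sub_idn; auto. Qed.
Lemma ren_as_sub e rho : bis (ren_e rho e) (sub_e (fun y => SVar (rho y)) e).
Proof. intro n; apply ren_as_subn; auto. Qed.

(** * An abstract machine for head reduction *)

(* A state [(e, [k1; ..; km])] stands for [e] inside the nested contexts
   [case (.. case [-] of k1 ..) of km]. *)
Definition state : Type := (mexp * list (nat -> mexp))%type.

Definition mstep (s : state) : option state :=
  match s with
  | (MCase (HExp e) br, K) => Some (e, br :: K)
  | (MCase (HApp (MLam tys b) r a) br, K) => Some (sub_e (beta_sub (length tys) a) b, br :: K)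
  | (MNum n, k :: K) => Some (k n, K)
  | _ => None
  end.

Inductive run : nat -> state -> state -> Prop :=
| run_0 s : run 0 s s
| run_S n s s' s'' : mstep s = Some s' -> run n s' s'' -> run (S n) s s''.

Definition reach (s s' : state) : Prop := exists n, run n s s'.

Lemma run_trans n m a b c : run n a b -> run m b c -> run (n + m) a c.
Proof. induction 1; simpl; auto. intro. econstructor; eauto. Qed.

Lemma reach_trans a b c : reach a b -> reach b c -> reach a c.
Proof. intros [n H] [m H']; exists (n + m); eapply run_trans; eauto. Qed.
Lemma reach_refl a : reach a a.
Proof. exists 0; constructor. Qed.
Lemma reach_step s s' s'' : mstep s = Some s' -> reach s' s'' -> reach s s''.
Proof. intros H [n H']; exists (S n); econstructor; eauto. Qed.

Lemma run_final_split n s f : run n s f -> mstep f = None ->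
  forall m s', run m s s' -> m <= n /\ run (n - m) s' f.
Proof.
  induction 1 as [s | n s s1 f Hs Hr IH]; intros Hf m s' Hm.
  - inversion Hm; subst; [split; auto; constructor | congruence].
  - inversion Hm; subst.
    + split; [lia|]. econstructor; eauto.
    + assert (s'0 = s1) by congruence; subst.
      destruct (IH Hf _ _ H0). split; [lia|]. now simpl.
Qed.

Lemma run_final_eq n s f m f' :
  run n s f -> mstep f = None -> run m s f' -> mstep f' = None -> f = f'.
Proof.
  intros H Hf H' Hf'. destruct (run_final_split _ _ _ H Hf _ _ H') as [_ Hr].
  inversion Hr; subst; auto; congruence.
Qed.

Lemma mstep_app e K e' K' L :
  mstep (e, K) = Some (e', K') -> mstep (e, K ++ L) = Some (e', K' ++ L).
Proof.
  destruct e as [| n | [x r a | [t b] r a | e0] br]; simpl; try discriminate.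
  - destruct K; try discriminate. intro H; inversion H; subst; reflexivity.
  - intro H; inversion H; subst; reflexivity.
  - intro H; inversion H; subst; reflexivity.
Qed.

Lemma run_app n e K e' K' L : run n (e, K) (e', K') -> run n (e, K ++ L) (e', K' ++ L).
Proof.
  revert e K; induction n as [|n IH]; intros e K H; inversion H; subst.
  - constructor.
  - destruct s' as [e1 K1]. econstructor; [apply mstep_app; eassumption|]. eauto.
Qed.

Lemma reach_app e K e' K' L : reach (e, K) (e', K') -> reach (e, K ++ L) (e', K' ++ L).
Proof. intros [n H]; exists n; now apply run_app. Qed.

Lemma mstep_app_none e K L : mstep (e, K) = None -> (forall i, (e, K) <> (MNum i, [])) ->
  mstep (e, K ++ L) = None.
Proof.
  destruct e as [| n | [x r a | [t b] r a | e0] br]; simpl; try discriminate; auto.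
  destruct K; [|discriminate]. intros _ H. now specialize (H n).
Qed.

(** The frames in [L] are touched only after [(e, K)] has delivered a numeral; a run that never
    delivers one carries [L] along unchanged. *)
Lemma run_stack n : forall e K L f, run n (e, K ++ L) f -> mstep f = None ->
  (exists m i, m <= n /\ run m (e, K) (MNum i, []) /\ run (n - m) (MNum i, L) f) \/
  (exists e' K', run n (e, K) (e', K') /\ f = (e', K' ++ L) /\ mstep (e', K') = None /\
     forall i, (e', K') <> (MNum i, [])).
Proof.
  induction n as [|n IH]; intros e K L f H Hf.
  - inversion H; subst.
    destruct (classic (exists i, (e, K) = (MNum i, []))) as [[i Hi]|Hi].
    + left. inversion Hi; subst. exists 0, i. repeat split; auto; constructor.
    + right. exists e, K. repeat split; try constructor; eauto.
      destruct (mstep (e, K)) as [[e1 K1]|] eqn:E; auto.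
      apply (mstep_app _ _ _ _ L) in E. congruence.
  - destruct (classic (exists i, (e, K) = (MNum i, []))) as [[i Hi]|Hi].
    + left. inversion Hi; subst. exists 0, i. repeat split; [lia|constructor|]. apply H.
    + inversion H; subst.
      destruct (mstep (e, K)) as [[e1 K1]|] eqn:E.
      * pose proof (mstep_app _ _ _ _ L E) as E'. rewrite H1 in E'; inversion E'; subst.
        destruct (IH _ _ _ _ H2 Hf) as [(m & i & Hm & H3 & H4)|(e' & K' & H3 & H4 & H5 & H6)].
        -- left. exists (S m), i. repeat split; [lia| |apply H4]. econstructor; eauto.
        -- right. exists e', K'. repeat split; auto. econstructor; eauto.
      * rewrite mstep_app_none in H1; eauto. discriminate.
Qed.

Lemma run_stack_num n e K L z : run n (e, K ++ L) (MNum z, []) ->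
  exists m i, m <= n /\ run m (e, K) (MNum i, []) /\ run (n - m) (MNum i, L) (MNum z, []).
Proof.
  intro H. destruct (run_stack _ _ _ _ _ H eq_refl) as [H1|(e' & K' & _ & H2 & _ & H3)]; auto.
  inversion H2; subst. symmetry in H4; apply app_eq_nil in H4 as [-> ->].
  now specialize (H3 z).
Qed.

(** ** Bisimilar states and substitution *)

Definition bis_st (s t : state) : Prop :=
  bis (fst s) (fst t) /\ Forall2 (fun k k' => forall i, bis (k i) (k' i)) (snd s) (snd t).

Lemma Forall2_same {A} (R : A -> A -> Prop) (l : list A) : (forall x, R x x) -> Forall2 R l l.
Proof. intro; induction l; auto. Qed.

Lemma bis_st_refl s : bis_st s s.
Proof. split; [apply bis_refl|]. apply Forall2_same; intros; apply bis_refl. Qed.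

Lemma bis_st_sym s t : bis_st s t -> bis_st t s.
Proof.
  intros [H1 H2]; split; [now apply bis_sym|].
  induction H2; constructor; auto. intros; now apply bis_sym.
Qed.

Lemma bis_st_trans s t u : bis_st s t -> bis_st t u -> bis_st s u.
Proof.
  intros [H1 H2] [H3 H4]; split; [eapply bis_trans; eauto|].
  destruct s as [e K], t as [e' K'], u as [e2 K2]; simpl in *. clear H1 H3.
  revert K2 H4; induction H2; intros K2 H4; inversion H4; subst; constructor; auto.
  intro i; eapply bis_trans; eauto.
Qed.

Lemma bis_case h br h' br' : bis (MCase h br) (MCase h' br') <->
  (forall n, head_rel (bisn n) h h') /\ forall i, bis (br i) (br' i).
Proof.
  split.
  - intro H; split; [intro n; apply (H (S n))|]. intros i n; apply (H (S n)).
  - intros [H1 H2] [|n]; simpl; auto. split; auto. intro; apply H2.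
Qed.

Lemma bis_num_inv n e : bis (MNum n) e -> e = MNum n.
Proof. intro H; specialize (H 1); destruct e; simpl in H; try easy. now subst. Qed.
Lemma bis_bot_inv e : bis MBot e -> e = MBot.
Proof. intro H; specialize (H 1); destruct e; simpl in H; easy. Qed.

Lemma bis_case_inv h br e : bis (MCase h br) e ->
  exists h' br', e = MCase h' br' /\ (forall n, head_rel (bisn n) h h') /\
    forall i, bis (br i) (br' i).
Proof.
  intro H. destruct e as [| m | h' br']; try (now specialize (H 1)).
  exists h', br'. split; auto. now apply bis_case.
Qed.

Lemma head_bis_var_inv x r a h : (forall n, head_rel (bisn n) (HVar x r a) h) ->
  exists a', h = HVar x r a' /\ forall i, bisp (a i) (a' i).
Proof.
  intro H. destruct h as [x' r' a' | |]; try (now specialize (H 0)).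
  exists a'. destruct (H 0) as (<- & <- & _). split; auto. intros i n; apply (H n).
Qed.
Lemma head_bis_app_inv p r a h : (forall n, head_rel (bisn n) (HApp p r a) h) ->
  exists p' a', h = HApp p' r a' /\ bisp p p' /\ forall i, bisp (a i) (a' i).
Proof.
  intro H. destruct h as [| p' r' a' |]; try (now specialize (H 0)).
  exists p', a'. destruct (H 0) as (_ & <- & _). split; auto. split; [intro n | intros i n]; apply (H n).
Qed.
Lemma head_bis_exp_inv e h : (forall n, head_rel (bisn n) (HExp e) h) ->
  exists e', h = HExp e' /\ bis e e'.
Proof.
  intro H. destruct h as [| | e']; try (now specialize (H 0)). now exists e'.
Qed.

Lemma beta_sub_lt n a i : i < n -> beta_sub n a i = STerm (a (n - 1 - i)).
Proof. intro; unfold beta_sub; now rewrite (proj2 (Nat.ltb_lt _ _)). Qed.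
Lemma beta_sub_ge n a i : n <= i -> beta_sub n a i = SVar (i - n).
Proof. intro; unfold beta_sub; now rewrite (proj2 (Nat.ltb_ge _ _)). Qed.

Lemma beta_sub_bis n a a' : (forall i, bisp (a i) (a' i)) ->
  forall y, item_bis (beta_sub n a y) (beta_sub n a' y).
Proof.
  intros H y. destruct (Nat.lt_ge_cases y n).
  - rewrite !beta_sub_lt by lia. apply item_bis_term, H.
  - rewrite !beta_sub_ge by lia. apply item_bis_refl.
Qed.

Lemma mstep_bis s t s1 : mstep s = Some s1 -> bis_st s t ->
  exists t1, mstep t = Some t1 /\ bis_st s1 t1.
Proof.
  destruct s as [e K], t as [e' K']. intros H [H1 H2]; simpl in *.
  destruct e as [| n | [x r a | [ty b] r a | e0] br]; try discriminate.
  - destruct K as [|k K]; try discriminate. inversion H; subst. inversion H2; subst.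
    apply bis_num_inv in H1; subst. eexists; split; [reflexivity|]. split; simpl; auto.
  - inversion H; subst.
    apply bis_case_inv in H1 as (h' & br' & -> & Hh & Hb).
    apply head_bis_app_inv in Hh as ([ty' b'] & a' & -> & Hp & Ha).
    apply bisp_lam in Hp as [<- Hp].
    eexists; split; [reflexivity|]. split; simpl; auto.
    apply sub_bis; auto using beta_sub_bis.
  - inversion H; subst.
    apply bis_case_inv in H1 as (h' & br' & -> & Hh & Hb).
    apply head_bis_exp_inv in Hh as (e'' & -> & He).
    eexists; split; [reflexivity|]. split; simpl; auto.
Qed.

Lemma run_bis n s s1 : run n s s1 -> forall t, bis_st s t ->
  exists t1, run n t t1 /\ bis_st s1 t1.
Proof.
  induction 1 as [s | n s s' s'' Hs Hr IH]; intros t Ht.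
  - exists t; split; auto; constructor.
  - destruct (mstep_bis _ _ _ Hs Ht) as (t' & H1 & H2).
    destruct (IH _ H2) as (t1 & H3 & H4). exists t1; split; auto. econstructor; eauto.
Qed.

Definition sub_st (sg : nat -> sitem) (s : state) : state :=
  (sub_e sg (fst s), map (fun k i => sub_e sg (k i)) (snd s)).

(** Beyond the bound indices, the shift made by [upsub] is cancelled by [beta_sub], and only an
    identity substitution remains. *)
Lemma beta_sub_upsub n sg a y :
  item_bis (isub (beta_sub n (fun i => sub_p sg (a i))) (upsub n sg y))
           (isub sg (beta_sub n a y)).
Proof.
  destruct (Nat.lt_ge_cases y n).
  - rewrite upsub_lt by lia. simpl. rewrite !beta_sub_lt by lia. apply item_bis_refl.
  - rewrite upsub_ge, (beta_sub_ge n a) by lia. simpl.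
    destruct (sg (y - n)) as [j | p]; simpl.
    + rewrite beta_sub_ge by lia. intro m; simpl; lia.
    + apply item_bis_term. destruct p as [t b]. autorewrite with mterm.
      apply bisp_lam; split; auto.
      eapply bis_trans; [intro m; apply sub_renn; intro; apply item_bis_refl|].
      apply sub_id. intro z. destruct (Nat.lt_ge_cases z (length t)).
      * rewrite upren_lt, upsub_lt; auto.
      * rewrite upren_ge, upsub_ge by lia. rewrite beta_sub_ge by lia. simpl. f_equal; lia.
Qed.

Lemma sub_beta n sg a b :
  bis (sub_e (beta_sub n (fun i => sub_p sg (a i))) (sub_e (upsub n sg) b))
      (sub_e sg (sub_e (beta_sub n a) b)).
Proof.
  eapply bis_trans; [apply sub_sub, beta_sub_upsub|].
  apply bis_sym, sub_sub. intro; apply item_bis_refl.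
Qed.

(** A substitution alters only variable heads, and there the machine has already stopped. The steps
    agree up to bisimilarity because substitutions compose only up to bisimilarity ([sub_beta]). *)
Lemma mstep_sub sg s s1 : mstep s = Some s1 ->
  exists t1, mstep (sub_st sg s) = Some t1 /\ bis_st t1 (sub_st sg s1).
Proof.
  destruct s as [e K]. intro H.
  destruct e as [| n | [x r a | [ty b] r a | e0] br]; try discriminate.
  - destruct K as [|k K]; try discriminate. inversion H; subst.
    eexists; split; [unfold sub_st; simpl; autorewrite with mterm; reflexivity|].
    apply bis_st_refl.
  - inversion H; subst. unfold sub_st; simpl; autorewrite with mterm.
    eexists; split; [reflexivity|]. split; simpl.
    + apply sub_beta.
    + constructor; [intro; apply bis_refl|]. apply Forall2_same; intros; apply bis_refl.
  - inversion H; subst. unfold sub_st; simpl; autorewrite with mterm.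
    eexists; split; [reflexivity|]. apply bis_st_refl.
Qed.

Lemma run_sub n s s1 sg : run n s s1 -> forall t, bis_st t (sub_st sg s) ->
  exists t1, run n t t1 /\ bis_st t1 (sub_st sg s1).
Proof.
  induction 1 as [s | n s s' s'' Hs Hr IH]; intros t Ht.
  - exists t; split; auto; constructor.
  - destruct (mstep_sub sg _ _ Hs) as (u & H1 & H2).
    destruct (mstep_bis _ _ _ H1 (bis_st_sym _ _ Ht)) as (t' & H3 & H4).
    destruct (IH t') as (t1 & H5 & H6).
    { eapply bis_st_trans; [apply bis_st_sym, H4 | apply H2]. }
    exists t1; split; auto. econstructor; eauto.
Qed.

(** ** Productive states *)

Definition num_of (s : state) (n : nat) : Prop := reach s (MNum n, []).
Definition var_of (s : state) x r a br K : Prop := reach s (MCase (HVar x r a) br, K).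
(** This covers divergence as well as a run that ends in [MBot]; both evaluate to [MBot]. *)
Definition stuck (s : state) : Prop :=
  (forall n, ~ num_of s n) /\ forall x r a br K, ~ var_of s x r a br K.

Lemma reach_final_eq s f f' : reach s f -> mstep f = None -> reach s f' -> mstep f' = None -> f = f'.
Proof. intros [n H] Hf [m H'] Hf'. eapply run_final_eq; eauto. Qed.

Lemma var_of_inj s x r a br K x' r' a' br' K' :
  var_of s x r a br K -> var_of s x' r' a' br' K' ->
  x' = x /\ r' = r /\ a' = a /\ br' = br /\ K' = K.
Proof.
  intros H H'. pose proof (reach_final_eq _ _ _ H eq_refl H' eq_refl) as E.
  inversion E; subst; auto.
Qed.
Lemma num_of_inj s n m : num_of s n -> num_of s m -> n = m.
Proof. intros H H'. pose proof (reach_final_eq _ _ _ H eq_refl H' eq_refl) as E. congruence. Qed.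
Lemma num_var_absurd s n x r a br K : num_of s n -> var_of s x r a br K -> False.
Proof. intros H H'. pose proof (reach_final_eq _ _ _ H eq_refl H' eq_refl) as E. discriminate. Qed.

Lemma reach_num_back s s' n : reach s s' -> num_of s n -> num_of s' n.
Proof.
  intros [m H] [m' H']. destruct (run_final_split _ _ _ H' eq_refl _ _ H) as [_ Hr].
  eexists; eauto.
Qed.
Lemma reach_var_back s s' x r a br K : reach s s' -> var_of s x r a br K -> var_of s' x r a br K.
Proof.
  intros [m H] [m' H']. destruct (run_final_split _ _ _ H' eq_refl _ _ H) as [_ Hr].
  eexists; eauto.
Qed.
Lemma reach_stuck s s' : reach s s' -> stuck s <-> stuck s'.
Proof.
  intro H; split; intros [H1 H2]; split; intros.
  - intro H3; eapply H1, reach_trans; eauto.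
  - intro H3; eapply H2, reach_trans; eauto.
  - intro H3; eapply H1, reach_num_back; eauto.
  - intro H3; eapply H2, reach_var_back; eauto.
Qed.

Lemma stuck_app e K L : stuck (e, K) -> stuck (e, K ++ L).
Proof.
  intros [H1 H2]; split.
  - intros n [m H]. apply run_stack_num in H as (m' & i & _ & H & _). eapply H1; eexists; eauto.
  - intros x r a br K' [m H]. pose proof (run_stack _ _ _ _ _ H eq_refl)
      as [(m' & i & _ & H' & _)|(e' & K2 & H' & E & _)].
    + eapply H1; eexists; eauto.
    + inversion E; subst. eapply H2; eexists; eauto.
Qed.

Lemma num_of_bis s t n : bis_st s t -> num_of s n -> num_of t n.
Proof.
  intros H [m Hm]. destruct (run_bis _ _ _ Hm _ H) as ([e K] & H1 & H2 & H3); simpl in *.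
  apply bis_num_inv in H2; subst. inversion H3; subst. eexists; eauto.
Qed.

Lemma var_of_bis s t x r a br K : bis_st s t -> var_of s x r a br K ->
  exists a' br' K', var_of t x r a' br' K' /\ (forall i, bisp (a i) (a' i)) /\
    forall i, bis_st (br i, K) (br' i, K').
Proof.
  intros H [m Hm]. destruct (run_bis _ _ _ Hm _ H) as ([e K'] & H1 & H2 & H3); simpl in *.
  apply bis_case_inv in H2 as (h' & br' & -> & Hh & Hb).
  apply head_bis_var_inv in Hh as (a' & -> & Ha).
  exists a', br', K'. split; [eexists; eauto|]. split; auto. intro i; split; simpl; auto.
Qed.

Lemma stuck_bis s t : bis_st s t -> stuck s -> stuck t.
Proof.
  intros H [H1 H2]; apply bis_st_sym in H; split.
  - intros n Hn. eapply H1, num_of_bis; eauto.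
  - intros x r a br K Hv. destruct (var_of_bis _ _ _ _ _ _ _ H Hv) as (a' & br' & K' & Hv' & _).
    eapply H2; eauto.
Qed.

Lemma run_prefix_or_final n s : (exists s', run n s s') \/
  exists m f, m < n /\ run m s f /\ mstep f = None.
Proof.
  revert s; induction n as [|n IH]; intro s.
  - left; eexists; constructor.
  - destruct (mstep s) as [s'|] eqn:E.
    + destruct (IH s') as [[s1 H]|(m & f & H1 & H2 & H3)].
      * left; exists s1; econstructor; eauto.
      * right; exists (S m), f; repeat split; auto; [lia|]. econstructor; eauto.
    + right; exists 0, s; repeat split; auto; [lia | constructor].
Qed.

Lemma final_cases f : mstep f = None ->
  (exists n, f = (MNum n, [])) \/ (exists K, f = (MBot, K)) \/
  exists x r a br K, f = (MCase (HVar x r a) br, K).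
Proof.
  destruct f as [[| n | [x r a | [ty b] r a | e0] br] K]; simpl; try discriminate; eauto.
  - destruct K; try discriminate. eauto.
  - right; right; eauto 8.
Qed.

(** Steps of [s] are copied by [t]. If [t] had an outcome after [n] steps, [s] could not run longer
    than that, so it would halt; being stuck, it halts in [MBot], and then [t] does so too. *)
Lemma stuck_sub sg s t : bis_st t (sub_st sg s) -> stuck s -> stuck t.
Proof.
  intros Hb Hs.
  assert (Hf : forall n f, run n t f -> mstep f = None ->
     (exists m, f = (MNum m, [])) \/ (exists x r a br K, f = (MCase (HVar x r a) br, K)) -> False).
  { intros n f H Hf Hp.
    destruct (run_prefix_or_final (S n) s) as [[s' H1]|(m & g & Hm & H1 & Hg)].
    - destruct (run_sub _ _ _ _ H1 _ Hb) as (t1 & H2 & _).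
      destruct (run_final_split _ _ _ H Hf _ _ H2). lia.
    - destruct (run_sub _ _ _ _ H1 _ Hb) as (t1 & H2 & H3).
      destruct (final_cases _ Hg) as [[z ->]|[[K ->]|(x & r & a & br & K & ->)]].
      + apply (proj1 Hs z). eexists; eauto.
      + destruct t1 as [e1 K1], H3 as [H3 H4]; simpl in *. autorewrite with mterm in H3.
        apply bis_sym, bis_bot_inv in H3; subst.
        destruct (run_final_split _ _ _ H Hf _ _ H2) as [_ H5].
        inversion H5; subst; [|discriminate].
        destruct Hp as [[? E]|(? & ? & ? & ? & ? & E)]; discriminate.
      + apply (proj2 Hs x r a br K). eexists; eauto. }
  split.
  - intros n [m H]. eapply Hf; eauto.
  - intros x r a br K [m H]. eapply Hf; eauto. right; eauto 8.
Qed.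

(** ** Head normal forms *)

(** The outer frames sit inside the branches and not around the scrutinee: this is the nesting that
    case-of-case produces, and it lets each machine step match at most two head steps. *)
Fixpoint comp_stack (k : nat -> mexp) (K : list (nat -> mexp)) : nat -> mexp :=
  match K with
  | [] => k
  | k' :: K' => fun i => MCase (HExp (k i)) (comp_stack k' K')
  end.

Definition unload (s : state) : mexp :=
  match s with
  | (e, []) => e
  | (e, k :: K) => MCase (HExp e) (comp_stack k K)
  end.

Lemma hstep_det e a b : hstep e a -> hstep e b -> a = b.
Proof. intros H; inversion H; subst; intro H'; inversion H'; subst; auto. Qed.
Lemma hnf_no_step e a : is_hnf e -> ~ hstep e a.
Proof. intros H H'; inversion H'; subst; easy. Qed.

Lemma unload_step s s' : mstep s = Some s' ->
  unload s = unload s' /\ snd s = [] /\ snd s' <> [] \/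
  hstep (unload s) (unload s') \/
  exists e, hstep (unload s) e /\ hstep e (unload s').
Proof.
  destruct s as [e K]; intro H.
  destruct e as [| n | [x r a | [ty b] r a | e0] br]; try discriminate.
  - destruct K as [|k K]; inversion H; subst. right; left.
    destruct K; simpl; constructor.
  - inversion H; subst. right. destruct K as [|k K]; simpl.
    + left; constructor.
    + right. eexists; split; constructor.
  - inversion H; subst. destruct K as [|k K]; simpl.
    + left; repeat split; auto; discriminate.
    + right; left. apply hs_cc.
Qed.

Lemma run_unload n s s' : run n s s' -> hsteps (unload s) (unload s').
Proof.
  induction 1 as [s | n s s1 s' Hs Hr IH]; [apply rt_refl|].
  eapply rt_trans; [|exact IH].
  destruct (unload_step _ _ Hs) as [(-> & _)|[H|(e & H1 & H2)]].
  - apply rt_refl.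
  - now apply rt_step.
  - eapply rt_trans; apply rt_step; eassumption.
Qed.

Inductive hstepsn : nat -> mexp -> mexp -> Prop :=
| hn_0 e : hstepsn 0 e e
| hn_S n e e' e'' : hstep e e' -> hstepsn n e' e'' -> hstepsn (S n) e e''.

Lemma hsteps_count e e' : hsteps e e' -> exists n, hstepsn n e e'.
Proof.
  intro H; apply clos_rt_rt1n_iff in H. induction H as [|e e1 e2 H1 _ [n IH]].
  - exists 0; constructor.
  - exists (S n); econstructor; eauto.
Qed.

Lemma hstepsn_hnf_split n e w : hstepsn n e w -> is_hnf w -> forall e', hstep e e' ->
  exists m, n = S m /\ hstepsn m e' w.
Proof.
  intros H Hw e' He. inversion H; subst.
  - now apply hnf_no_step in He.
  - assert (e'0 = e') by eauto using hstep_det. subst. eauto.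
Qed.

(** A machine step without a head step only pushes a frame onto an empty stack. Doubling [n] and
    adding 1 for an empty stack therefore gives a measure that decreases at every step. *)
Lemma hnf_machine_halts N : forall n s w,
  2 * n + (match snd s with [] => 1 | _ => 0 end) < N ->
  hstepsn n (unload s) w -> is_hnf w -> exists f, reach s f /\ mstep f = None.
Proof.
  induction N as [|N IH]; [lia|]. intros n s w Hn H Hw.
  destruct (mstep s) as [s'|] eqn:E; [|exists s; split; auto using reach_refl].
  assert (HH : exists f, reach s' f /\ mstep f = None).
  { destruct (unload_step _ _ E) as [(E1 & E2 & E3)|[E1|(e & E1 & E2)]].
    - rewrite E1 in H. apply (IH n s' w); auto. rewrite E2 in Hn.
      destruct (snd s'); [easy | lia].
    - destruct (hstepsn_hnf_split _ _ _ H Hw _ E1) as (m & -> & H1).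
      apply (IH m s' w); auto. destruct (snd s'), (snd s); lia.
    - destruct (hstepsn_hnf_split _ _ _ H Hw _ E1) as (m & -> & H1).
      destruct (hstepsn_hnf_split _ _ _ H1 Hw _ E2) as (m' & -> & H2).
      apply (IH m' s' w); auto. destruct (snd s'), (snd s); lia. }
  destruct HH as (f & H1 & H2). exists f; split; auto. eapply reach_step; eauto.
Qed.

Lemma hsteps_hnf_eq e a b : hsteps e a -> is_hnf a -> hsteps e b -> is_hnf b -> a = b.
Proof.
  intros H Ha H' Hb. apply hsteps_count in H as [n H]. apply hsteps_count in H' as [m H'].
  revert m H'; induction H as [e | n e e1 a He H IH]; intros m H'.
  - inversion H'; subst; auto. now apply hnf_no_step in H.
  - destruct (hstepsn_hnf_split _ _ _ H' Hb _ He) as (m' & -> & H1). eauto.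
Qed.

Lemma hnf_of_eq e w : hsteps e w -> is_hnf w -> hnf_of e = w.
Proof.
  intros H Hw. unfold hnf_of. destruct excluded_middle_informative as [E|E].
  - destruct (constructive_indefinite_description _ E) as [e' [H1 H2]]; simpl.
    eapply hsteps_hnf_eq; eauto.
  - exfalso; eauto.
Qed.

Lemma eval_eE e : eval_e e =
  match hnf_of e with
  | MNum n => MNum n
  | MCase (HVar x r a) br =>
      MCase (HVar x r (fun i => eval_p (a i))) (fun i => eval_e (br i))
  | _ => MBot
  end.
Proof.
  rewrite (mexp_frobE (eval_e e)); simpl. unfold eval_e at 1; fold eval_e.
  destruct (hnf_of e) as [| n | [x r a | p r a | e0] br]; reflexivity.
Qed.

Lemma eval_lamE t b : eval_p (MLam t b) = MLam t (eval_e b).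
Proof. now rewrite (mproc_frobE (eval_p _)). Qed.

Lemma eval_num s n : num_of s n -> eval_e (unload s) = MNum n.
Proof.
  intros [m H]. apply run_unload in H. rewrite eval_eE.
  now rewrite (hnf_of_eq _ _ H I).
Qed.

Lemma eval_var s x r a br K : var_of s x r a br K ->
  eval_e (unload s) =
  MCase (HVar x r (fun i => eval_p (a i))) (fun i => eval_e (unload (br i, K))).
Proof.
  intros [m H]. apply run_unload in H. rewrite eval_eE.
  destruct K as [|k K]; simpl in H.
  - now rewrite (hnf_of_eq _ _ H I).
  (* With a non-empty stack, one more case-of-case brings the variable to the head. *)
  - assert (H' : hsteps (unload s)
      (MCase (HVar x r a) (fun i => MCase (HExp (br i)) (comp_stack k K)))).
    { eapply rt_trans; [exact H|]. apply rt_step, hs_cc. }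
    now rewrite (hnf_of_eq _ _ H' I).
Qed.

Lemma eval_stuck s : stuck s -> eval_e (unload s) = MBot.
Proof.
  intros [H1 H2]. rewrite eval_eE. unfold hnf_of.
  destruct excluded_middle_informative as [E|E]; auto.
  destruct (constructive_indefinite_description _ E) as [e' [H3 H4]]; simpl.
  destruct (hsteps_count _ _ H3) as [n Hn].
  destruct (hnf_machine_halts _ n s e' (Nat.lt_succ_diag_r _) Hn H4) as (f & Hf & Hf').
  destruct (final_cases _ Hf') as [[z ->]|[[K ->]|(x & r & a & br & K & ->)]].
  - exfalso; eapply H1; eauto.
  - assert (Hb : hsteps (unload s) MBot).
    { destruct Hf as [m Hf]. apply run_unload in Hf. destruct K; simpl in Hf; auto.
      eapply rt_trans; [exact Hf|]. apply rt_step, hs_bot. }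
    now rewrite (hsteps_hnf_eq _ _ _ H3 H4 Hb I).
  - exfalso; eapply H2; eauto.
Qed.

(** * Evaluation trees and partial evaluation *)

Definition lam_st (X : state -> mexp -> Prop) (p p' : mproc) : Prop :=
  match p, p' with MLam t b, MLam t' b' => t = t' /\ X (b, []) b' end.
Arguments lam_st X !p !p' /.

Lemma lam_st_mono (X Y : state -> mexp -> Prop) p p' :
  (forall s t, X s t -> Y s t) -> lam_st X p p' -> lam_st Y p p'.
Proof. destruct p, p'; simpl; intuition. Qed.

Definition evF (X : state -> mexp -> Prop) (s : state) (t : mexp) : Prop :=
  (t = MBot /\ stuck s) \/ (exists n, t = MNum n /\ num_of s n) \/
  exists x r a br K a' br', t = MCase (HVar x r a') br' /\ var_of s x r a br K /\
    (forall i, lam_st X (a i) (a' i)) /\ forall i, X (br i, K) (br' i).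

(* Greatest fixed points are taken as unions of post-fixed points throughout. *)
Definition Ev (s : state) (t : mexp) : Prop :=
  exists X : state -> mexp -> Prop, (forall s t, X s t -> evF X s t) /\ X s t.

Lemma evF_mono (X Y : state -> mexp -> Prop) s t :
  (forall s t, X s t -> Y s t) -> evF X s t -> evF Y s t.
Proof.
  intros H [H1|[H1|(x & r & a & br & K & a' & br' & E & H1 & H2 & H3)]];
    [now left | right; now left | right; right].
  exists x, r, a, br, K, a', br'. repeat split; auto. intro; eapply lam_st_mono; eauto.
Qed.

Lemma Ev_unfold s t : Ev s t -> evF Ev s t.
Proof.
  intros (X & HX & H). eapply evF_mono; [|apply HX, H]. intros; exists X; auto.
Qed.

Lemma Ev_eval s : Ev s (eval_e (unload s)).
Proof.
  exists (fun s t => t = eval_e (unload s)). split; auto. clear s; intros s t ->.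
  destruct (classic (exists n, num_of s n)) as [[n Hn]|Hn].
  { right; left. exists n; split; auto. now apply eval_num. }
  destruct (classic (exists x r a br K, var_of s x r a br K)) as [(x & r & a & br & K & Hv)|Hv].
  - right; right. do 7 eexists. split; [apply eval_var; eauto|]. repeat split; eauto.
    intro i; simpl. destruct (a i) as [t b]. rewrite eval_lamE. split; auto.
  - left. assert (Hs : stuck s) by (split; intros; intro; eauto 8). split; auto.
    now apply eval_stuck.
Qed.

Definition rhead (X : state -> mexp -> Prop) (h h' : mhead) : Prop :=
  match h, h' with
  | HVar x r a, HVar x' r' a' => x = x' /\ r = r' /\ forall i, lam_st X (a i) (a' i)
  | HApp p r a, HApp p' r' a' =>
      lam_st X p p' /\ r = r' /\ forall i, lam_st X (a i) (a' i)
  | HExp e, HExp e' => X (e, []) e'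
  | _, _ => False
  end.

Definition pevF (X : state -> mexp -> Prop) (s : state) (t : mexp) : Prop :=
  (t = MBot /\ stuck s) \/ (exists n, t = MNum n /\ num_of s n) \/
  exists h h' br br' K, t = MCase h' br' /\ reach s (MCase h br, K) /\
    rhead X h h' /\ forall i, X (br i, K) (br' i).

(* [Pev s t]: the meta-term [t] arises from [s] by evaluating some of its subterms. *)
Definition Pev (s : state) (t : mexp) : Prop :=
  exists X : state -> mexp -> Prop, (forall s t, X s t -> pevF X s t) /\ X s t.

Lemma rhead_mono (X Y : state -> mexp -> Prop) h h' :
  (forall s t, X s t -> Y s t) -> rhead X h h' -> rhead Y h h'.
Proof.
  intro H; destruct h, h'; simpl; intuition; eapply lam_st_mono; eauto.
Qed.

Lemma pevF_mono (X Y : state -> mexp -> Prop) s t :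
  (forall s t, X s t -> Y s t) -> pevF X s t -> pevF Y s t.
Proof.
  intros H [H1|[H1|(h & h' & br & br' & K & E & H1 & H2 & H3)]];
    [now left | right; now left | right; right].
  exists h, h', br, br', K. repeat split; auto. eapply rhead_mono; eauto.
Qed.

Lemma Pev_unfold s t : Pev s t -> pevF Pev s t.
Proof.
  intros (X & HX & H). eapply pevF_mono; [|apply HX, H]. intros; exists X; auto.
Qed.

Lemma Pev_coind (X : state -> mexp -> Prop) :
  (forall s t, X s t -> pevF (fun s t => X s t \/ Pev s t) s t) -> forall s t, X s t -> Pev s t.
Proof.
  intros H s t Hs. exists (fun s t => X s t \/ Pev s t). split; auto.
  intros s' t' [H1|H1]; auto. eapply pevF_mono; [|apply Pev_unfold, H1]. auto.
Qed.

Lemma Ev_coind (X : state -> mexp -> Prop) :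
  (forall s t, X s t -> evF (fun s t => X s t \/ Ev s t) s t) -> forall s t, X s t -> Ev s t.
Proof.
  intros H s t Hs. exists (fun s t => X s t \/ Ev s t). split; auto.
  intros s' t' [H1|H1]; auto. eapply evF_mono; [|apply Ev_unfold, H1]. auto.
Qed.

Lemma Ev_Pev s t : Ev s t -> Pev s t.
Proof.
  intro H; exists Ev; split; auto. clear; intros s t H.
  destruct (Ev_unfold _ _ H) as [H1|[H1|(x & r & a & br & K & a' & br' & E & H1 & H2 & H3)]];
    [now left | right; now left | right; right].
  exists (HVar x r a), (HVar x r a'), br, br', K. repeat split; auto.
Qed.

Lemma lam_st_bis (X : state -> mexp -> Prop) p q q' p' :
  bisp p q -> lam_st X q q' -> bisp q' p' ->
  lam_st (fun s e => exists s' e', bis_st s s' /\ X s' e' /\ bis e' e) p p'.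
Proof.
  destruct p as [t b], q as [t1 b1], q' as [t2 b2], p' as [t3 b3]. rewrite !bisp_lam.
  intros [-> H1] [-> H2] [-> H3]; simpl. split; auto. exists (b1, []), b2.
  repeat split; simpl; auto.
Qed.

Lemma reach_bis s s1 t : reach s s1 -> bis_st s t -> exists t1, reach t t1 /\ bis_st s1 t1.
Proof.
  intros [n H] Hb. destruct (run_bis _ _ _ H _ Hb) as (t1 & H1 & H2).
  exists t1; split; auto. eexists; eauto.
Qed.

Lemma Pev_bis t s e e' : bis_st t s -> Pev s e -> bis e e' -> Pev t e'.
Proof.
  intros H1 H2 H3.
  exists (fun t e' => exists s e, bis_st t s /\ Pev s e /\ bis e e'). split; [|eauto].
  clear; intros t e' (s & e & H1 & H2 & H3).
  destruct (Pev_unfold _ _ H2) as [[-> H]|[(n & -> & H)|(h & h' & br & br' & K & -> & H & Hh & Hb)]].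
  - left. split; [now apply bis_bot_inv|]. eapply stuck_bis; [apply bis_st_sym|]; eauto.
  - right; left; exists n. split; [now apply bis_num_inv|].
    eapply num_of_bis; [apply bis_st_sym|]; eauto.
  - right; right. destruct (reach_bis _ _ _ H (bis_st_sym _ _ H1)) as ([e1 K1] & Hr & Hbs & HK).
    simpl in *. apply bis_case_inv in Hbs as (h1 & br1 & -> & Hh1 & Hbr1).
    apply bis_case_inv in H3 as (h2 & br2 & -> & Hh2 & Hbr2).
    exists h1, h2, br1, br2, K1. split; auto. split; auto. split.
    + destruct h as [x r a | p r a | f].
      * apply head_bis_var_inv in Hh1 as (a1 & -> & Ha1).
        destruct h' as [x' r' a' | |]; try easy. destruct Hh as (<- & <- & Ha).
        apply head_bis_var_inv in Hh2 as (a2 & -> & Ha2).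
        repeat split; auto. intro i. eapply lam_st_bis; eauto using bisp_sym.
      * apply head_bis_app_inv in Hh1 as (p1 & a1 & -> & Hp1 & Ha1).
        destruct h' as [| p' r' a' |]; try easy. destruct Hh as (Hp & <- & Ha).
        apply head_bis_app_inv in Hh2 as (p2 & a2 & -> & Hp2 & Ha2).
        repeat split; auto; [|intro i]; eapply lam_st_bis; eauto using bisp_sym.
      * apply head_bis_exp_inv in Hh1 as (f1 & -> & Hf1).
        destruct h' as [| | f']; try easy.
        apply head_bis_exp_inv in Hh2 as (f2 & -> & Hf2).
        simpl in *. exists (f, []), f'. repeat split; auto. now apply bis_sym.
    + intro i. exists (br i, K), (br' i). repeat split; auto; simpl; auto.
      * now apply bis_sym.
      * clear - HK. induction HK; constructor; auto. intros; now apply bis_sym.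
Qed.

(** ** Partial evaluation is compatible with substitution *)

Definition item_st (X : state -> mexp -> Prop) (i i' : sitem) : Prop :=
  match i, i' with
  | SVar a, SVar b => a = b
  | STerm p, STerm p' => lam_st X p p'
  | _, _ => False
  end.

Lemma bis_st_nil e e' : bis e e' -> bis_st (e, []) (e', []).
Proof. intro; split; simpl; auto. Qed.

(** Abstracting over the admissible pairs of substitutions allows two uses: first renamings, which
    gives [Pev_ren], then arbitrary pairs, whose lifting under a binder needs [Pev_ren]. *)
Lemma Pev_sub_gen (Sub : (nat -> sitem) -> (nat -> sitem) -> Prop) :
  (forall sg sg' n, Sub sg sg' -> Sub (upsub n sg) (upsub n sg')) ->
  (forall sg sg' y, Sub sg sg' -> item_st Pev (sg y) (sg' y)) ->
  forall s e sg sg', Pev s e -> Sub sg sg' -> Pev (sub_st sg s) (sub_e sg' e).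
Proof.
  intros Hup Hit s e sg sg' Hs Hsg.
  apply (Pev_coind (fun t E => exists s e sg sg', bis_st t (sub_st sg s) /\
     bis (sub_e sg' e) E /\ Pev s e /\ Sub sg sg'));
    [|exists s, e, sg, sg'; auto using bis_st_refl, bis_refl].
  clear s e sg sg' Hs Hsg. intros t E (s & e & sg & sg' & H1 & H2 & H3 & H4).
  set (X := fun t E => (exists s e sg sg', bis_st t (sub_st sg s) /\
     bis (sub_e sg' e) E /\ Pev s e /\ Sub sg sg') \/ Pev t E).
  assert (HX : forall a1 a a' a2, bisp (sub_p sg a) a1 -> lam_st Pev a a' ->
            bisp (sub_p sg' a') a2 -> lam_st X a1 a2).
  { intros [t1 b1] [t2 b2] [t3 b3] [t4 b4]; autorewrite with mterm; rewrite !bisp_lam.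
    intros [<- E1] [<- E2] [<- E3]; simpl; split; auto. left.
    exists (b2, []), b3, (upsub (length t2) sg), (upsub (length t2) sg').
    repeat split; simpl; auto. now apply bis_sym. }
  destruct (Pev_unfold _ _ H3) as [[-> H]|[(n & -> & H)|(h & h' & br & br' & K & -> & H & Hh & Hb)]].
  - left. autorewrite with mterm in H2. split; [now apply bis_bot_inv|].
    eapply stuck_sub; eauto.
  - right; left; exists n. autorewrite with mterm in H2. split; [now apply bis_num_inv|].
    destruct H as [m H]. destruct (run_sub _ _ _ _ H _ H1) as ([e1 K1] & Hr & Hb & HK).
    simpl in *. autorewrite with mterm in Hb. apply bis_sym, bis_num_inv in Hb; subst.
    inversion HK; subst. eexists; eauto.
  - right; right. destruct H as [m H].
    destruct (run_sub _ _ _ _ H _ H1) as ([e1 K1] & Hr & Hbs & HK).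
    simpl in *. autorewrite with mterm in H2, Hbs.
    apply bis_sym, bis_case_inv in Hbs as (h1 & br1 & -> & Hh1 & Hbr1).
    apply bis_case_inv in H2 as (h2 & br2 & -> & Hh2 & Hbr2).
    exists h1, h2, br1, br2, K1. split; auto. split; [eexists; eauto|]. split.
    + destruct h as [x r a | p r a | f].
      * destruct h' as [x' r' a' | |]; try easy. destruct Hh as (<- & <- & Ha).
        autorewrite with mterm in Hh1, Hh2. pose proof (Hit _ _ x H4) as Hx.
        destruct (sg x) as [j | p], (sg' x) as [j' | p']; simpl in Hx; try easy.
        -- subst j'. apply head_bis_var_inv in Hh1 as (a1 & -> & Ha1).
           apply head_bis_var_inv in Hh2 as (a2 & -> & Ha2).
           repeat split; auto. intro i. eapply HX; eauto.
        -- apply head_bis_app_inv in Hh1 as (p1 & a1 & -> & Hp1 & Ha1).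
           apply head_bis_app_inv in Hh2 as (p2 & a2 & -> & Hp2 & Ha2).
           repeat split; auto; [|intro i; eapply HX; eauto].
           eapply lam_st_mono; [|eapply lam_st_bis; eauto using bisp_sym].
           intros s0 t0 (s1 & t1 & E1 & E2 & E3). right. eapply Pev_bis; eauto.
      * destruct h' as [| p' r' a' |]; try easy. destruct Hh as (Hp & <- & Ha).
        autorewrite with mterm in Hh1, Hh2.
        apply head_bis_app_inv in Hh1 as (p1 & a1 & -> & Hp1 & Ha1).
        apply head_bis_app_inv in Hh2 as (p2 & a2 & -> & Hp2 & Ha2).
        repeat split; auto; [|intro i]; eapply HX; eauto.
      * destruct h' as [| | f']; try easy. autorewrite with mterm in Hh1, Hh2.
        apply head_bis_exp_inv in Hh1 as (f1 & -> & Hf1).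
        apply head_bis_exp_inv in Hh2 as (f2 & -> & Hf2).
        simpl in *. left. exists (f, []), f', sg, sg'. repeat split; simpl; auto.
        now apply bis_sym.
    + intro i. left. exists (br i, K), (br' i), sg, sg'. repeat split; auto; simpl.
      now apply bis_sym.
Qed.

Lemma Pev_ren p p' rho : lam_st Pev p p' -> lam_st Pev (ren_p rho p) (ren_p rho p').
Proof.
  destruct p as [t b], p' as [t' b']. intros [<- H]. autorewrite with mterm. split; auto.
  set (rho' := upren (length t) rho).
  pose proof (Pev_sub_gen
    (fun sg sg' => exists rho, (forall y, sg y = SVar (rho y)) /\ forall y, sg' y = SVar (rho y)))
    as HG.
  eapply Pev_bis; [| apply HG with (sg := fun y => SVar (rho' y)) (sg' := fun y => SVar (rho' y));
                     [| | exact H |] |].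
  - apply bis_st_nil, ren_as_sub.
  - intros sg sg' n (r & H1 & H2). exists (upren n r). split; intro; now apply upsub_var.
  - intros sg sg' y (r & H1 & H2). rewrite H1, H2. reflexivity.
  - exists rho'; auto.
  - apply bis_sym, ren_as_sub.
Qed.

Lemma Pev_sub s e sg sg' : Pev s e -> (forall y, item_st Pev (sg y) (sg' y)) ->
  Pev (sub_st sg s) (sub_e sg' e).
Proof.
  intros H Hi.
  apply Pev_sub_gen with (Sub := fun sg sg' => forall y, item_st Pev (sg y) (sg' y)); auto.
  intros sg1 sg2 n H1 y. destruct (Nat.lt_ge_cases y n).
  - rewrite !upsub_lt; auto; reflexivity.
  - rewrite !upsub_ge by auto. specialize (H1 (y - n)).
    destruct (sg1 (y - n)), (sg2 (y - n)); simpl in *; try easy; [congruence|].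
    now apply Pev_ren.
Qed.

Lemma Pev_beta b b' n a a' : Pev (b, []) b' -> (forall i, lam_st Pev (a i) (a' i)) ->
  Pev (sub_e (beta_sub n a) b, []) (sub_e (beta_sub n a') b').
Proof.
  intros H Ha. apply (Pev_sub _ _ (beta_sub n a) (beta_sub n a')) in H; auto.
  intro y. destruct (Nat.lt_ge_cases y n).
  - rewrite !beta_sub_lt by auto. apply Ha.
  - rewrite !beta_sub_ge by auto. reflexivity.
Qed.

(** ** Partial evaluation preserves the evaluation tree *)

(* One frame on the right may stand for a whole segment of the stack on the left. *)
Inductive stack_rel : list (nat -> mexp) -> list (nat -> mexp) -> Prop :=
| sr_nil : stack_rel [] []
| sr_cons br J L k L' : (forall i, Pev (br i, J) (k i)) -> stack_rel L L' ->
    stack_rel (br :: J ++ L) (k :: L').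

Inductive pev_st : state -> state -> Prop :=
| ps_intro e J L e' L' : Pev (e, J) e' -> stack_rel L L' -> pev_st (e, J ++ L) (e', L').

(** Induction on the run of [t]. Unfolding [Pev] says how far [s] must run to expose the head that
    [t] shows already; from there both sides make the same step. *)
Lemma pev_st_back n : forall s t z, run n t z -> mstep z = None -> pev_st s t ->
  (forall m, z = (MNum m, []) -> num_of s m) /\
  (forall x r a' br' K', z = (MCase (HVar x r a') br', K') ->
     exists a br K, var_of s x r a br K /\ (forall i, lam_st Pev (a i) (a' i)) /\
       forall i, pev_st (br i, K) (br' i, K')).
Proof.
  induction n as [n IH] using lt_wf_ind. intros s t z Hz Hf H. destruct H as [e J L e' L' HP HS].
  destruct (Pev_unfold _ _ HP)
    as [[-> H]|[(n0 & -> & H)|(h & h' & br & br' & K & -> & H & Hh & Hb)]].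
  - inversion Hz; subst; [|discriminate]. split; [discriminate|]. discriminate.
  - apply (reach_app _ _ _ _ L) in H. simpl in H. destruct HS as [|br J' L k L' Hk HS].
    + inversion Hz; subst; [|discriminate]. split; [|discriminate].
      intros m E; inversion E; subst; auto.
    + inversion Hz; subst; [discriminate|]. simpl in H0; inversion H0; subst.
      destruct (IH n1 ltac:(lia) (br n0, J' ++ L) (k n0, L') z) as [IH1 IH2]; auto.
      { now constructor. }
      assert (Hr : reach (e, J ++ br :: J' ++ L) (br n0, J' ++ L)).
      { eapply reach_trans; [exact H|]. eapply reach_step; [reflexivity|]. apply reach_refl. }
      split.
      * intros m E. eapply reach_trans; eauto. now apply IH1.
      * intros x r a' br' K' E. destruct (IH2 _ _ _ _ _ E) as (a & br0 & K & H4 & H5).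
        exists a, br0, K. split; auto. eapply reach_trans; eauto.
  - apply (reach_app _ _ _ _ L) in H.
    assert (HS' : stack_rel (br :: K ++ L) (br' :: L')) by now constructor.
    destruct h as [x r a | [ty b] r a | f], h' as [x' r' a' | [ty' b'] r' a' | f']; try easy.
    + destruct Hh as (<- & <- & Ha). inversion Hz; subst; [|discriminate].
      split; [discriminate|]. intros x0 r0 a0 br0 K0 E; inversion E; subst.
      exists a, br, (K ++ L). split; [exact H|]. split; auto. intro i; now constructor.
    + destruct Hh as ([<- Hp] & <- & Ha). inversion Hz; subst; [discriminate|].
      simpl in H0; inversion H0; subst.
      destruct (IH n0 ltac:(lia) (sub_e (beta_sub (length ty) a) b, br :: K ++ L)
        (sub_e (beta_sub (length ty) a') b', br' :: L') z) as [IH1 IH2]; auto.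
      { apply (ps_intro _ [] (br :: K ++ L)); auto. now apply Pev_beta. }
      assert (Hr : reach (e, J ++ L) (sub_e (beta_sub (length ty) a) b, br :: K ++ L)).
      { eapply reach_trans; [exact H|]. eapply reach_step; [reflexivity|]. apply reach_refl. }
      split.
      * intros m E. eapply reach_trans; eauto. now apply IH1.
      * intros x1 r1 a1 br1 K1 E. destruct (IH2 _ _ _ _ _ E) as (a2 & br2 & K2 & H4 & H5).
        exists a2, br2, K2. split; auto. eapply reach_trans; eauto.
    + simpl in Hh. inversion Hz; subst; [discriminate|].
      simpl in H0; inversion H0; subst.
      destruct (IH n0 ltac:(lia) (f, br :: K ++ L) (f', br' :: L') z) as [IH1 IH2]; auto.
      { apply (ps_intro _ [] (br :: K ++ L)); auto. }
      assert (Hr : reach (e, J ++ L) (f, br :: K ++ L)).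
      { eapply reach_trans; [exact H|]. eapply reach_step; [reflexivity|]. apply reach_refl. }
      split.
      * intros m E. eapply reach_trans; eauto. now apply IH1.
      * intros x1 r1 a1 br1 K1 E. destruct (IH2 _ _ _ _ _ E) as (a2 & br2 & K2 & H4 & H5).
        exists a2, br2, K2. split; auto. eapply reach_trans; eauto.
Qed.

(** Only the existence of an outcome is claimed, which is what transfers [stuck]; that outcomes
    agree is [pev_st_back]. Here the induction is on the run of [s]. *)
Lemma pev_st_forth n : forall s t z, run n s z -> mstep z = None -> pev_st s t ->
  (forall m, z = (MNum m, []) -> exists m, num_of t m) /\
  (forall x r a br K, z = (MCase (HVar x r a) br, K) ->
     exists x r a br K, var_of t x r a br K).
Proof.
  induction n as [n IH] using lt_wf_ind. intros s t z Hz Hf H. destruct H as [e J L e' L' HP HS].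
  destruct (Pev_unfold _ _ HP)
    as [[-> H]|[(n0 & -> & H)|(h & h' & br & br' & K & -> & H & Hh & Hb)]].
  - apply (stuck_app _ _ L) in H. split.
    + intros m ->. exfalso; eapply (proj1 H); eexists; eauto.
    + intros x r a br K ->. exfalso; eapply (proj2 H); eexists; eauto.
  - apply (reach_app _ _ _ _ L) in H. simpl in H. destruct H as [m H].
    destruct (run_final_split _ _ _ Hz Hf _ _ H) as [Hm Hr].
    destruct HS as [|br J' L k L' Hk HS].
    + inversion Hr; subst; [|discriminate]. split; [|discriminate].
      intros; eexists; apply reach_refl.
    + inversion Hr; subst; [discriminate|]. simpl in H1; inversion H1; subst.
      destruct (IH n1 ltac:(lia) (br n0, J' ++ L) (k n0, L') z) as [IH1 IH2]; auto.
      { now constructor. }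
      split.
      * intros m' E. destruct (IH1 _ E) as [m2 Hm2]. exists m2.
        eapply reach_step; [reflexivity | exact Hm2].
      * intros x r a br0 K E. destruct (IH2 _ _ _ _ _ E) as (x1 & r1 & a1 & br1 & K1 & Hv).
        exists x1, r1, a1, br1, K1. eapply reach_step; [reflexivity | exact Hv].
  - apply (reach_app _ _ _ _ L) in H. destruct H as [m H].
    destruct (run_final_split _ _ _ Hz Hf _ _ H) as [Hm Hr].
    assert (HS' : stack_rel (br :: K ++ L) (br' :: L')) by now constructor.
    destruct h as [x r a | [ty b] r a | f], h' as [x' r' a' | [ty' b'] r' a' | f']; try easy.
    + destruct Hh as (<- & <- & Ha). inversion Hr; subst; [|discriminate].
      split; [discriminate|]. intros. do 5 eexists. apply reach_refl.
    + destruct Hh as ([<- Hp] & <- & Ha). inversion Hr; subst; [discriminate|].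
      simpl in H1; inversion H1; subst.
      destruct (IH n0 ltac:(lia) (sub_e (beta_sub (length ty) a) b, br :: K ++ L)
        (sub_e (beta_sub (length ty) a') b', br' :: L') z) as [IH1 IH2]; auto.
      { apply (ps_intro _ [] (br :: K ++ L)); auto. now apply Pev_beta. }
      split.
      * intros m' E. destruct (IH1 _ E) as [m2 Hm2]. exists m2.
        eapply reach_step; [reflexivity | exact Hm2].
      * intros x1 r1 a1 br0 K1 E. destruct (IH2 _ _ _ _ _ E) as (x2 & r2 & a2 & br2 & K2 & Hv).
        exists x2, r2, a2, br2, K2. eapply reach_step; [reflexivity | exact Hv].
    + simpl in Hh. inversion Hr; subst; [discriminate|].
      simpl in H1; inversion H1; subst.
      destruct (IH n0 ltac:(lia) (f, br :: K ++ L) (f', br' :: L') z) as [IH1 IH2]; auto.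
      { apply (ps_intro _ [] (br :: K ++ L)); auto. }
      split.
      * intros m' E. destruct (IH1 _ E) as [m2 Hm2]. exists m2.
        eapply reach_step; [reflexivity | exact Hm2].
      * intros x1 r1 a1 br0 K1 E. destruct (IH2 _ _ _ _ _ E) as (x2 & r2 & a2 & br2 & K2 & Hv).
        exists x2, r2, a2, br2, K2. eapply reach_step; [reflexivity | exact Hv].
Qed.

Lemma pev_st_num s t m : pev_st s t -> num_of t m -> num_of s m.
Proof. intros H [n Hn]. now apply (pev_st_back _ _ _ _ Hn eq_refl H). Qed.
Lemma pev_st_var s t x r a' br' K' : pev_st s t -> var_of t x r a' br' K' ->
  exists a br K, var_of s x r a br K /\ (forall i, lam_st Pev (a i) (a' i)) /\
    forall i, pev_st (br i, K) (br' i, K').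
Proof. intros H [n Hn]. now apply (pev_st_back _ _ _ _ Hn eq_refl H). Qed.
Lemma pev_st_stuck s t : pev_st s t -> stuck t -> stuck s.
Proof.
  intros H [H1 H2]; split.
  - intros m [n Hn]. destruct (pev_st_forth _ _ _ _ Hn eq_refl H) as [E _].
    destruct (E _ eq_refl) as [m' Hm']. eapply H1; eauto.
  - intros x r a br K [n Hn]. destruct (pev_st_forth _ _ _ _ Hn eq_refl H) as [_ E].
    destruct (E _ _ _ _ _ eq_refl) as (x' & r' & a' & br' & K' & Hv). eapply H2; eauto.
Qed.

Lemma pev_st_of_Pev e e' : Pev (e, []) e' -> pev_st (e, []) (e', []).
Proof. intro H. apply (ps_intro e [] []); auto. constructor. Qed.

Lemma pev_st_Ev s t u : pev_st s t -> Ev t u -> Ev s u.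
Proof.
  intros H1 H2. exists (fun s u => exists t, pev_st s t /\ Ev t u). split; [|eauto].
  clear; intros s u (t & H1 & H2).
  destruct (Ev_unfold _ _ H2) as [[-> H]|[(n & -> & H)|(x & r & a & br & K & a' & br' & -> & H & Ha & Hb)]].
  - left; split; auto. eapply pev_st_stuck; eauto.
  - right; left; exists n; split; auto. eapply pev_st_num; eauto.
  - right; right. destruct (pev_st_var _ _ _ _ _ _ _ H1 H) as (a1 & br1 & K1 & Hv & Ha1 & Hb1).
    exists x, r, a1, br1, K1, a', br'. repeat split; eauto.
    intro i. specialize (Ha i); specialize (Ha1 i).
    destruct (a1 i), (a i), (a' i); simpl in *. destruct Ha as [<- Ha], Ha1 as [<- Ha1].
    split; auto. eexists; split; eauto. now apply pev_st_of_Pev.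
Qed.

(** ** Equality of evaluation trees *)

(** A common tree is asked for, and not an equation between values of [eval_e], since two evaluation
    trees of the same state need not be provably equal. *)
Definition sameval (s t : state) : Prop := exists u, Ev s u /\ Ev t u.

Lemma sameval_refl s : sameval s s.
Proof. eexists; split; apply Ev_eval. Qed.
Lemma sameval_sym s t : sameval s t -> sameval t s.
Proof. intros (u & H1 & H2); exists u; auto. Qed.

Lemma sameval_Ev s t u : sameval s t -> Ev s u -> Ev t u.
Proof.
  intros (v & H1 & H2) H3.
  exists (fun t u => exists s v, Ev s v /\ Ev t v /\ Ev s u). split; [|eauto 6].
  clear; intros t u (s & v & H1 & H2 & H3).
  destruct (Ev_unfold _ _ H3) as [[-> H]|[(n & -> & H)|(x & r & a & br & K & a' & br' & -> & H & Ha & Hb)]];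
  destruct (Ev_unfold _ _ H1) as [[-> E]|[(m & -> & E)|(x1 & r1 & a1 & br1 & K1 & a1' & br1' & -> & E & Ea & Eb)]];
  destruct (Ev_unfold _ _ H2) as [[F0 F]|[(m' & F0 & F)|(x2 & r2 & a2 & br2 & K2 & a2' & br2' & F0 & F & Fa & Fb)]];
  try discriminate; try (exfalso; eapply (proj1 H); eassumption);
  try (exfalso; eapply (proj2 H); eassumption);
  try (exfalso; eapply (proj1 E); eassumption);
  try (exfalso; eapply (proj2 E); eassumption);
  try (exfalso; eauto using num_var_absurd; fail).
  - now left.
  - inversion F0; subst. right; left. exists n; split; auto.
    now rewrite (num_of_inj _ _ _ H E).
  - inversion F0; subst. destruct (var_of_inj _ _ _ _ _ _ _ _ _ _ _ H E) as (-> & -> & -> & -> & ->).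
    right; right. exists x, r, a2, br2, K2, a', br'. repeat split; eauto 6.
    intro i. specialize (Ha i); specialize (Ea i); specialize (Fa i).
    destruct (a i), (a' i), (a2' i), (a2 i); simpl in *.
    destruct Ha as [<- Ha], Ea as [<- Ea], Fa as [<- Fa]. split; eauto 6.
Qed.

Lemma sameval_trans a b c : sameval a b -> sameval b c -> sameval a c.
Proof.
  intros (u & H1 & H2) H3. exists u; split; auto. eapply sameval_Ev; eauto.
Qed.

Lemma Pev_sameval e e' : Pev (e, []) e' -> sameval (e, []) (e', []).
Proof.
  intro H. exists (eval_e (unload (e', []))). split; [|apply Ev_eval].
  apply pev_st_Ev with (e', []); [now apply pev_st_of_Pev | apply Ev_eval].
Qed.

Lemma bis_st_sameval s t : bis_st s t -> sameval s t.
Proof.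
  intro H. exists (eval_e (unload t)); split; [|apply Ev_eval].
  pose proof (Ev_eval t) as Ht. revert H Ht. generalize (eval_e (unload t)) as u. intros u H Hu.
  exists (fun s u => exists t, bis_st s t /\ Ev t u). split; [|eauto].
  clear; intros s u (t & H1 & H2).
  destruct (Ev_unfold _ _ H2) as [[-> H]|[(n & -> & H)|(x & r & a & br & K & a' & br' & -> & H & Ha & Hb)]].
  - left; split; auto. eapply stuck_bis; [apply bis_st_sym|]; eauto.
  - right; left; exists n; split; auto. eapply num_of_bis; [apply bis_st_sym|]; eauto.
  - right; right. destruct (var_of_bis _ _ _ _ _ _ _ (bis_st_sym _ _ H1) H) as (a1 & br1 & K1 & Hv & Ha1 & Hb1).
    exists x, r, a1, br1, K1, a', br'. repeat split; eauto.
    + intro i. specialize (Ha i); specialize (Ha1 i).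
      destruct (a1 i), (a i), (a' i); simpl in *. destruct Ha as [<- Ha].
      apply bisp_lam in Ha1 as [<- Ha1]. split; auto. eexists; split; eauto.
      apply bis_st_nil, bis_sym; auto.
    + intro i. eexists; split; [apply bis_st_sym, Hb1 | apply Hb].
Qed.

Lemma reach_sameval s t : reach s t -> sameval s t.
Proof.
  intro H. exists (eval_e (unload t)). split; [|apply Ev_eval].
  pose proof (Ev_eval t) as Ht. revert Ht. generalize (eval_e (unload t)) as u. intros u Hu.
  apply (Ev_coind (fun s u => exists t, reach s t /\ Ev t u)); [|eauto].
  clear; intros s u (t & H1 & H2).
  destruct (Ev_unfold _ _ H2) as [[-> H]|[(n & -> & H)|(x & r & a & br & K & a' & br' & -> & H & Ha & Hb)]].
  - left; split; auto. eapply reach_stuck; eauto.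
  - right; left; exists n; split; auto. eapply reach_trans; eauto.
  - right; right. exists x, r, a, br, K, a', br'. repeat split; auto.
    + eapply reach_trans; eauto.
    + intro i; eapply lam_st_mono; [|apply Ha]; auto.
Qed.

Lemma sameval_num s t n : sameval s t -> num_of s n -> num_of t n.
Proof.
  intros (u & H1 & H2) H.
  destruct (Ev_unfold _ _ H1) as [[-> E]|[(m & -> & E)|(x1 & r1 & a1 & br1 & K1 & a1' & br1' & -> & E & Ea & Eb)]].
  - now apply (proj1 E) in H.
  - rewrite (num_of_inj _ _ _ H E).
    destruct (Ev_unfold _ _ H2) as [[F0 F]|[(m' & F0 & F)|(x2 & r2 & a2 & br2 & K2 & a2' & br2' & F0 & F & Fa & Fb)]];
      try discriminate. now inversion F0; subst.
  - exfalso; eapply num_var_absurd; eauto.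
Qed.

Definition samep (p q : mproc) : Prop := exists u, lam_st Ev p u /\ lam_st Ev q u.

Lemma samep_lam t b t' b' :
  samep (MLam t b) (MLam t' b') <-> t = t' /\ sameval (b, []) (b', []).
Proof.
  split.
  - intros ([t2 u] & [-> H1] & [-> H2]). split; auto. exists u; auto.
  - intros [<- (u & H1 & H2)]. exists (MLam t u). simpl; auto.
Qed.
Lemma samep_refl p : samep p p.
Proof. destruct p; apply samep_lam; split; auto using sameval_refl. Qed.
Lemma Pev_samep p q : lam_st Pev p q -> samep p q.
Proof. destruct p, q; intros [<- H]. apply samep_lam; split; auto. now apply Pev_sameval. Qed.

Lemma lam_Ev_Pev p u : lam_st Ev p u -> lam_st Pev p u.
Proof. apply lam_st_mono, Ev_Pev. Qed.

Definition item_same (i i' : sitem) : Prop :=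
  match i, i' with
  | SVar a, SVar b => a = b
  | STerm p, STerm p' => samep p p'
  | _, _ => False
  end.

(** Both sides partially evaluate to one term: the common tree [u], with common trees of the items,
    chosen as [sgu], substituted into it. *)
Lemma sameval_sub e e' sg sg' : sameval (e, []) (e', []) ->
  (forall y, item_same (sg y) (sg' y)) -> sameval (sub_e sg e, []) (sub_e sg' e', []).
Proof.
  intros (u & H1 & H2) Hi.
  assert (HC : exists sgu : nat -> sitem, forall y,
     item_st Pev (sg y) (sgu y) /\ item_st Pev (sg' y) (sgu y)).
  { assert (HH : forall y, exists i, item_st Pev (sg y) i /\ item_st Pev (sg' y) i).
    { intro y; specialize (Hi y). destruct (sg y), (sg' y); simpl in Hi; try easy.
      - subst; eexists (SVar _); split; reflexivity.
      - destruct Hi as (v & E1 & E2). exists (STerm v). split; now apply lam_Ev_Pev. }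
    exists (fun y => proj1_sig (constructive_indefinite_description _ (HH y))).
    intro y. now destruct (constructive_indefinite_description _ (HH y)). }
  destruct HC as [sgu HC].
  apply sameval_trans with (sub_e sgu u, []).
  - apply Pev_sameval. apply (Pev_sub (e, [])); [now apply Ev_Pev | apply HC].
  - apply sameval_sym, Pev_sameval. apply (Pev_sub (e', [])); [now apply Ev_Pev | apply HC].
Qed.

(** * Eta-expansions and the fixed point procedures *)

Fixpoint tsize (s : ty) : nat := match s with N => 0 | Arr a b => S (tsize a + tsize b) end.

Lemma tsize_argtys s t : In t (argtys s) -> tsize t < tsize s.
Proof. induction s; simpl; [easy|]. intros [<-|H]; [lia|]. apply IHs2 in H; lia. Qed.

Lemma lv_argtys s t : In t (argtys s) -> lv t < lv s.
Proof. induction s; simpl; [easy|]. intros [<-|H]; [lia|]. apply IHs2 in H; lia. Qed.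

Lemma tsize_nth s i : i < length (argtys s) -> tsize (nth i (argtys s) N) < tsize s.
Proof. intro H. now apply tsize_argtys, nth_In. Qed.
Lemma lv_nth s i : i < length (argtys s) -> lv (nth i (argtys s) N) < lv s.
Proof. intro H. now apply lv_argtys, nth_In. Qed.

Lemma etaL_nth s j y : nth j (etaL s) dflt_eta y =
  if j <? length (argtys s) then eta (nth j (argtys s) N) y else MLam [] MBot.
Proof.
  revert j; induction s as [|a _ b IH]; intros [|j]; simpl; auto.
Qed.

Lemma etaE s x : eta s x = let n := length (argtys s) in
  MLam (argtys s) (MCase (HVar (x + n) n (fun j => if j <? n then eta (nth j (argtys s) N) (n - 1 - j)
                                                   else MLam [] MBot)) (fun i => MNum i)).
Proof.
  unfold eta at 1, mketa. simpl. do 2 f_equal. f_equal. extensionality j. apply etaL_nth.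
Qed.

Lemma sub_eta s : forall x z sg, sg x = SVar z -> sub_p sg (eta s x) = eta s z.
Proof.
  remember (tsize s) as n eqn:E. revert s E.
  induction n as [n IH] using lt_wf_ind. intros s -> x z sg Hx.
  rewrite !etaE. cbv zeta. autorewrite with mterm.
  rewrite upsub_ge by lia. replace (x + _ - _) with x by lia. rewrite Hx. simpl.
  do 2 f_equal; [f_equal|].
  - extensionality j. destruct (Nat.ltb_spec j (length (argtys s))).
    + eapply IH; eauto using tsize_nth. apply upsub_lt; lia.
    + now autorewrite with mterm.
  - extensionality i. now autorewrite with mterm.
Qed.

Lemma FfixE s g : Ffix s g =
  let n := length (argtys s) in
  MLam (argtys s)
    (MCase (HVar (g + n) (S n)
              (fun j => match j with
                        | 0 => Ffix s (g + n)
                        | S j' => eta (nth j' (argtys s) N) (n - 1 - j')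
                        end))
           (fun i => MNum i)).
Proof. now rewrite (mproc_frobE (Ffix s g)) at 1. Qed.

(* Without arguments, the irrelevant arguments of [Ffix] mention index 0. *)
Lemma sub_Ffixn s n : forall g z sg, sg g = SVar z ->
  (length (argtys s) = 0 -> g = 0 /\ z = 0) ->
  lam_rel (bisn n) (sub_p sg (Ffix s g)) (Ffix s z).
Proof.
  induction n as [|n IH]; intros g z sg Hg H0.
  - rewrite !(FfixE s). simpl. autorewrite with mterm. now simpl.
  - rewrite !(FfixE s). cbv zeta. autorewrite with mterm.
    rewrite upsub_ge by lia. replace (g + _ - _) with g by lia. rewrite Hg. simpl.
    repeat split; [|intro i; autorewrite with mterm; apply bisn_refl].
    intros [|j].
    + apply IH; [|lia]. rewrite upsub_ge by lia. replace (g + _ - _) with g by lia. now rewrite Hg.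
    + rewrite (sub_eta _ _ (length (argtys s) - 1 - j)); [apply lam_rel_refl, bisn_refl|].
      destruct (Nat.eq_dec (length (argtys s)) 0) as [E|E].
      * rewrite E; destruct (H0 E) as [-> ->]. rewrite upsub_ge by lia. simpl. now rewrite Hg.
      * apply upsub_lt; lia.
Qed.

Definition DY (s : ty) : mproc := lam1 (Arr s s) (Ffix s 0).

Lemma DYE s : DY s =
  let n := length (argtys s) in
  MLam (Arr s s :: argtys s)
    (MCase (HVar n (S n)
              (fun j => match j with
                        | 0 => Ffix s n
                        | S j' => eta (nth j' (argtys s) N) (n - 1 - j')
                        end))
           (fun i => MNum i)).
Proof. unfold DY. now rewrite FfixE. Qed.

Lemma sub_DY sg s : bisp (sub_p sg (DY s)) (DY s).
Proof.
  rewrite DYE. cbv zeta. autorewrite with mterm. apply bisp_lam; split; auto.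
  autorewrite with mterm. rewrite upsub_lt by (simpl; lia).
  apply bis_case; split; [|intro; autorewrite with mterm; apply bis_refl].
  intro n; repeat split; auto. intros [|j].
  - apply sub_Ffixn; [|lia]. apply upsub_lt; simpl; lia.
  - rewrite (sub_eta _ _ (length (argtys s) - 1 - j)); [apply lam_rel_refl, bisn_refl|].
    apply upsub_lt; simpl; lia.
Qed.

Lemma ren_DY rho s : bisp (ren_p rho (DY s)) (DY s).
Proof.
  eapply bisp_trans; [|apply (sub_DY (fun y => SVar (rho y)))].
  rewrite DYE. cbv zeta. autorewrite with mterm. apply bisp_lam; split; auto.
  intro n. rewrite <- ren_varE, <- sub_varE. rewrite <- ren_caseE, <- sub_caseE.
  apply ren_as_subn, upsub_var; auto.
Qed.

(** * Coloured codes *)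

(* A code is a meta-term without [HExp] whose heads are variables, closures (procedures that
   mention no local variable of the surrounding code) or the constants [DY s].  Every closure
   is run with its own colour; [kind] says which class of code a colour belongs to, and
   [callk] which closures, at which types, a class of code may call. *)
Record sys : Type := Sys {
  col : Type;
  knd : Type;
  kind : col -> knd;
  okc : col -> Prop;
  carg : col -> nat -> col;
  cbr : col -> nat -> col;
  callk : knd -> col -> ty -> Prop;
  constok : col -> Prop;
  slv : nat;
  kind_carg : forall c i, kind (carg c i) = kind c;
  kind_cbr : forall c i, kind (cbr c i) = kind c
}.
Arguments kind {s}. Arguments okc {s}. Arguments carg {s}. Arguments cbr {s}.
Arguments callk {s}. Arguments constok {s}.

Definition updel (tys : list ty) (D : nat -> ty) (i : nat) : ty :=
  if i <? length tys then nth (length tys - 1 - i) tys N else D (i - length tys).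
Definition uperm {A} (n : nat) (P : A -> nat -> Prop) (c : A) (i : nat) : Prop :=
  n <= i /\ P c (i - n).
Definition uploc (n : nat) (L : nat -> Prop) (i : nat) : Prop := i < n \/ L (i - n).
Definition noloc : nat -> Prop := fun _ => False.

Definition code_pred (S : sys) : Type :=
  (nat -> ty) -> (knd S -> nat -> Prop) -> (nat -> Prop) -> col S -> mexp -> Prop.

Definition cprocF {S : sys} (X : code_pred S) D P L (c : col S) (p : mproc) (t : ty) : Prop :=
  exists b, p = MLam (argtys t) b /\
    X (updel (argtys t) D) (uperm (length (argtys t)) P) (uploc (length (argtys t)) L) c b.

Definition cargsF {S : sys} (X : code_pred S) D P L (c : col S) r (a : nat -> mproc) (t : ty) : Prop :=
  r = length (argtys t) /\
  forall i, i < r -> cprocF X D P L (carg c i) (a i) (nth i (argtys t) N).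

Definition cheadF {S : sys} (X : code_pred S) D P L (c : col S) (h : mhead) : Prop :=
  (exists y r a, h = HVar y r a /\ (L y \/ P (kind c) y) /\ cargsF X D P L c r a (D y)) \/
  (exists p r a d t, h = HApp p r a /\ callk (kind c) d t /\ cprocF X D P noloc d p t /\
     cargsF X D P L c r a t) \/
  (exists p r a s, h = HApp p r a /\ constok c /\ lv s <= slv S /\ bisp p (DY s) /\
     cargsF X D P L c r a (Arr (Arr s s) s)).

Definition codeF {S : sys} (X : code_pred S) D P L (c : col S) (e : mexp) : Prop :=
  e = MBot \/ (exists n, e = MNum n) \/
  exists h br, e = MCase h br /\ okc c /\ cheadF X D P L c h /\
    forall i, X D P L (cbr c i) (br i).

(* [D] types the variables, [P] says which global variables each class of code may use, and
   [L] is the set of local variables, which closures may not use. *)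
Definition code {S : sys} : code_pred S := fun D P L c e =>
  exists X : code_pred S, (forall D P L c e, X D P L c e -> codeF X D P L c e) /\ X D P L c e.
Definition cproc {S : sys} D P L (c : col S) p t : Prop := cprocF (@code S) D P L c p t.
Definition cargs {S : sys} D P L (c : col S) r a t : Prop := cargsF (@code S) D P L c r a t.

Lemma cprocF_mono {S : sys} (X Y : code_pred S) D P L c p t :
  (forall D P L c e, X D P L c e -> Y D P L c e) ->
  cprocF X D P L c p t -> cprocF Y D P L c p t.
Proof. intros H (b & -> & Hb). exists b; auto. Qed.

Lemma cargsF_mono {S : sys} (X Y : code_pred S) D P L c r a t :
  (forall D P L c e, X D P L c e -> Y D P L c e) ->
  cargsF X D P L c r a t -> cargsF Y D P L c r a t.
Proof. intros H (-> & Ha). split; auto. intros; eapply cprocF_mono; eauto. Qed.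

Lemma codeF_mono {S : sys} (X Y : code_pred S) D P L c e :
  (forall D P L c e, X D P L c e -> Y D P L c e) ->
  codeF X D P L c e -> codeF Y D P L c e.
Proof.
  intros H [H1|[H1|(h & br & -> & Hc & Hh & Hb)]]; [now left | right; now left | right; right].
  exists h, br. repeat split; auto. clear Hc Hb.
  destruct Hh as [(y & r & a & -> & Hy & Ha)|[(p & r & a & d & t & -> & Hd & Hp & Ha)|
    (p & r & a & s & -> & Hk & Hs & Hp & Ha)]].
  - left. exists y, r, a. repeat split; auto; eapply cargsF_mono; eauto.
  - right; left. exists p, r, a, d, t. split; [|split; [|split]]; auto;
      [eapply cprocF_mono | eapply cargsF_mono]; eauto.
  - right; right. exists p, r, a, s. repeat split; auto; eapply cargsF_mono; eauto.
Qed.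

Lemma code_unfold {S : sys} D P L (c : col S) e : code D P L c e -> codeF code D P L c e.
Proof.
  intros (X & HX & H). eapply codeF_mono; [|apply HX, H]. intros; exists X; auto.
Qed.

Lemma code_coind {S : sys} (X : code_pred S) :
  (forall D P L c e, X D P L c e -> codeF (fun D P L c e => X D P L c e \/ code D P L c e) D P L c e) ->
  forall D P L c e, X D P L c e -> code D P L c e.
Proof.
  intros H D P L c e Hs. exists (fun D P L c e => X D P L c e \/ code D P L c e). split; auto.
  intros D' P' L' c' e' [H1|H1]; auto. eapply codeF_mono; [|apply code_unfold, H1]. auto.
Qed.

Lemma code_fold {S : sys} D P L (c : col S) e : codeF code D P L c e -> code D P L c e.
Proof.
  intro H. apply (code_coind (codeF code)); auto. clear. intros D P L c e H.
  eapply codeF_mono; [|exact H]. auto.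
Qed.

Lemma code_bot {S : sys} D P L (c : col S) : code D P L c MBot.
Proof. apply code_fold. now left. Qed.
Lemma code_num {S : sys} D P L (c : col S) n : code D P L c (MNum n).
Proof. apply code_fold. right; left; eauto. Qed.

Lemma code_bis {S : sys} D P L (c : col S) e e' : code D P L c e -> bis e e' -> code D P L c e'.
Proof.
  intros H Hb. apply (code_coind (fun D P L c e' => exists e, code D P L c e /\ bis e e'));
    [|eauto]. clear. intros D P L c e' (e & H & Hb).
  set (X := fun D P L c e' => (exists e, code D P L c e /\ bis e e') \/ @code S D P L c e').
  assert (HX : forall D P L c p p' t, cproc D P L c p t -> bisp p p' ->
            cprocF (S := S) X D P L c p' t).
  { intros D0 P0 L0 c0 p [t' b'] t (b & -> & H1). rewrite bisp_lam. intros [<- H2].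
    exists b'; split; auto. left; eauto. }
  destruct (code_unfold _ _ _ _ _ H) as [->|[(n & ->)|(h & br & -> & Hc & Hh & Hbr)]].
  - left. now apply bis_bot_inv.
  - right; left. exists n. now apply bis_num_inv.
  - right; right. apply bis_case_inv in Hb as (h' & br' & -> & Hh' & Hbr').
    exists h', br'. repeat split; auto; [|intro i; left; eauto].
    destruct Hh as [(y & r & a & -> & Hy & Hr & Ha)|[(p & r & a & d & t & -> & Hd & Hp & Hr & Ha)|
      (p & r & a & s & -> & Hk & Hs & Hp & Hr & Ha)]].
    + apply head_bis_var_inv in Hh' as (a' & -> & Ha'). left.
      exists y, r, a'. repeat split; auto. intros; eapply HX; eauto. now apply Ha.
    + apply head_bis_app_inv in Hh' as (p' & a' & -> & Hp' & Ha'). right; left.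
      exists p', r, a', d, t. repeat split; auto; [eapply HX; eauto|].
      intros; eapply HX; eauto. now apply Ha.
    + apply head_bis_app_inv in Hh' as (p' & a' & -> & Hp' & Ha'). right; right.
      exists p', r, a', s. repeat split; auto.
      * eapply bisp_trans; [apply bisp_sym, Hp' | exact Hp].
      * intros; eapply HX; eauto. now apply Ha.
Qed.

(** ** Change of colours *)

(** A simulation of colours. It is required only where [okc] holds, because code of any other colour
    is [MBot] or a numeral. *)
Definition recolouring (S1 S2 : sys) (m : col S1 -> col S2 -> Prop) : Prop :=
  slv S1 <= slv S2 /\
  forall c c', m c c' -> okc c ->
    okc c' /\ (constok c -> constok c') /\
    (forall i, m (carg c i) (carg c' i)) /\ (forall i, m (cbr c i) (cbr c' i)) /\
    (forall d t, callk (kind c) d t -> exists d', m d d' /\ callk (kind c') d' t).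

Definition perm_incl {S1 S2 : sys} (m : col S1 -> col S2 -> Prop)
    (P : knd S1 -> nat -> Prop) (P' : knd S2 -> nat -> Prop) : Prop :=
  forall c c' y, m c c' -> P (kind c) y -> P' (kind c') y.

(** A local variable may become global, but not conversely: closures inside the code may use the
    permitted global variables and must not use local ones. *)
Lemma code_recolour (S1 S2 : sys) m D P P' L L' (c : col S1) (c' : col S2) e :
  recolouring S1 S2 m -> m c c' -> perm_incl m P P' ->
  (forall y, L y -> L' y \/ P' (kind c') y) ->
  code D P L c e -> code D P' L' c' e.
Proof.
  intros [Hlv Hm] Hc HP HL H.
  apply (code_coind (fun D P' L' c' e => exists P L c, m c c' /\ perm_incl m P P' /\
    (forall y, L y -> L' y \/ P' (kind c') y) /\ code D P L c e)); [|exists P, L, c; auto].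
  clear D P P' L L' c c' e HP HL H Hc. intros D P' L' c' e (P & L & c & Hc & HP & HL & H).
  set (X := fun D P' L' c' e => (exists P L c, m c c' /\ perm_incl m P P' /\
    (forall y, L y -> L' y \/ P' (kind c') y) /\ code D P L c e) \/ @code S2 D P' L' c' e).
  assert (HX : forall L L' c c' p t, m c c' -> (forall y, L y -> L' y \/ P' (kind c') y) ->
            cproc D P L c p t -> cprocF (S := S2) X D P' L' c' p t).
  { intros L0 L0' c0 c0' p t E1 E2 (b & -> & H1). exists b; split; auto. left.
    do 3 eexists. split; [exact E1|]. split; [|split; [|exact H1]].
    - intros d d' y Hd [H2 H3]. split; auto. eapply HP; eauto.
    - intros y [H2|H2]; [left; now left|]. destruct (E2 _ H2); [left; now right|].
      destruct (Nat.lt_ge_cases y (length (argtys t))); [left; now left | right; now split]. }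
  destruct (code_unfold _ _ _ _ _ H) as [->|[(n & ->)|(h & br & -> & Hok & Hh & Hbr)]].
  - now left.
  - right; left; eauto.
  - right; right. destruct (Hm _ _ Hc Hok) as (Hok' & Hk' & Hca & Hcb & Hcall).
    exists h, br. repeat split; auto.
    2:{ intro i. left. exists P, L, (cbr c i). repeat split; auto. now rewrite kind_cbr. }
    assert (HA : forall r a t, cargs D P L c r a t -> cargsF X D P' L' c' r a t).
    { intros r a t [-> Ha]. split; auto. intros i Hi. eapply HX; [apply Hca| |apply Ha; auto].
      now rewrite kind_carg. }
    destruct Hh as [(y & r & a & -> & Hy & Ha)|[(p & r & a & d & t & -> & Hd & Hp & Ha)|
      (p & r & a & s & -> & Hk & Hs & Hp & Ha)]].
    + left. exists y, r, a. split; auto. split; [|apply HA, Ha].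
      destruct Hy as [Hy|Hy]; auto. right. eapply HP; eauto.
    + right; left. destruct (Hcall _ _ Hd) as (d' & Hd' & Hcd).
      exists p, r, a, d', t. split; auto. split; auto. split; [|apply HA, Ha].
      apply (HX noloc noloc d d'); [exact Hd' | intros y [] | exact Hp].
    + right; right. exists p, r, a, s. split; auto. split; auto. split; [lia|].
      split; [exact Hp | apply HA, Ha].
Qed.

Lemma cproc_recolour (S1 S2 : sys) m D P P' L L' (c : col S1) (c' : col S2) p t :
  recolouring S1 S2 m -> m c c' -> perm_incl m P P' ->
  (forall y, L y -> L' y \/ P' (kind c') y) ->
  cproc D P L c p t -> cproc D P' L' c' p t.
Proof.
  intros Hm Hc HP HL (b & -> & H). exists b; split; auto.
  eapply code_recolour; [exact Hm | exact Hc | | | exact H].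
  - intros d d' y Hd [H2 H3]. split; auto. eapply HP; eauto.
  - intros y [H2|H2]; [left; now left|]. destruct (HL _ H2); [left; now right|].
    destruct (Nat.lt_ge_cases y (length (argtys t))); [left; now left | right; now split].
Qed.

Lemma recolouring_eq (S : sys) : recolouring S S eq.
Proof. split; auto. intros c c' <- Hc. repeat split; auto. intros d t; exists d; auto. Qed.

Lemma code_perm {S : sys} D (P P' : knd S -> nat -> Prop) L L' c e :
  (forall k y, P k y -> P' k y) -> (forall y, L y -> L' y \/ P' (kind c) y) ->
  code D P L c e -> code D P' L' c e.
Proof.
  intros HP HL. apply (code_recolour S S eq); auto using recolouring_eq.
  intros d d' y <-; auto.
Qed.

(** ** Renaming and substitution *)

Lemma updel_lt tys D i : i < length tys -> updel tys D i = nth (length tys - 1 - i) tys N.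
Proof. intro; unfold updel; now rewrite (proj2 (Nat.ltb_lt _ _)). Qed.
Lemma updel_ge tys D i : length tys <= i -> updel tys D i = D (i - length tys).
Proof. intro; unfold updel; now rewrite (proj2 (Nat.ltb_ge _ _)). Qed.

Lemma code_ren {S : sys} D D' P P' L L' (c : col S) e rho :
  (forall k y, P k y -> P' k (rho y) /\ D' (rho y) = D y) ->
  (forall y, L y -> L' (rho y) /\ D' (rho y) = D y) ->
  code D P L c e -> code D' P' L' c (ren_e rho e).
Proof.
  intros HP HL H.
  apply (code_coind (fun D' P' L' c E => exists D P L e rho,
    (forall k y, P k y -> P' k (rho y) /\ D' (rho y) = D y) /\
    (forall y, L y -> L' (rho y) /\ D' (rho y) = D y) /\
    code D P L c e /\ E = ren_e rho e)); [|exists D, P, L, e, rho; auto].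
  clear D D' P P' L L' c e rho HP HL H.
  intros D' P' L' c E (D & P & L & e & rho & HP & HL & H & ->).
  set (X := fun D' P' L' c E => (exists D P L e rho,
    (forall k y, P k y -> P' k (rho y) /\ D' (rho y) = D y) /\
    (forall y, L y -> L' (rho y) /\ D' (rho y) = D y) /\
    code D P L c e /\ E = ren_e rho e) \/ @code S D' P' L' c E).
  assert (HX : forall L L' c p t, (forall y, L y -> L' (rho y) /\ D' (rho y) = D y) ->
            cproc D P L c p t -> cprocF (S := S) X D' P' L' c (ren_p rho p) t).
  { intros L0 L0' c0 p t E1 (b & -> & H1). autorewrite with mterm.
    eexists; split; [reflexivity|]. left.
    do 5 eexists. split; [|split; [|split; [exact H1 | reflexivity]]].
    - intros k y [H2 H3]. destruct (HP _ _ H3) as [H4 H5].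
      rewrite upren_ge, !updel_ge by lia. unfold uperm.
      replace (rho (y - length (argtys t)) + length (argtys t) - length (argtys t))
        with (rho (y - length (argtys t))) by lia. repeat split; auto; lia.
    - intros y Hy. destruct (Nat.lt_ge_cases y (length (argtys t))).
      + rewrite upren_lt, !updel_lt by lia. split; auto. now left.
      + destruct Hy as [Hy|Hy]; [lia|]. destruct (E1 _ Hy).
        rewrite upren_ge, !updel_ge by lia. unfold uploc.
        replace (rho (y - length (argtys t)) + length (argtys t) - length (argtys t))
          with (rho (y - length (argtys t))) by lia. auto. }
  destruct (code_unfold _ _ _ _ _ H) as [->|[(n & ->)|(h & br & -> & Hok & Hh & Hbr)]];
    autorewrite with mterm.
  - now left.
  - right; left; eauto.
  - right; right. do 2 eexists; split; [reflexivity|]. split; auto. split.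
    2:{ intro i. left. exists D, P, L, (br i), rho. auto. }
    assert (HA : forall r a t, cargs D P L c r a t ->
              cargsF X D' P' L' c r (fun i => ren_p rho (a i)) t).
    { intros r a t [-> Ha]. split; auto. intros i Hi. eapply HX; eauto. now apply Ha. }
    destruct Hh as [(y & r & a & -> & Hy & Ha)|[(p & r & a & d & t & -> & Hd & Hp & Ha)|
      (p & r & a & s & -> & Hk & Hs & Hp & Ha)]]; autorewrite with mterm.
    + left. do 3 eexists; split; [reflexivity|].
      assert (HD : D' (rho y) = D y /\ (L' (rho y) \/ P' (kind c) (rho y))).
      { destruct Hy as [Hy|Hy]; [destruct (HL _ Hy) | destruct (HP _ _ Hy)]; auto. }
      destruct HD as [-> HD]. split; [exact HD | now apply HA].
    + right; left. do 5 eexists; split; [reflexivity|]. split; [exact Hd|].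
      split; [|now apply HA]. eapply HX; [|exact Hp]; intros y [].
    + right; right. do 4 eexists; split; [reflexivity|]. split; auto. split; eauto.
      split; [|now apply HA].
      eapply bisp_trans; [apply ren_p_bis; [exact Hp | reflexivity] | apply ren_DY].
Qed.

Lemma cproc_shift {S : sys} D P (c : col S) p t tys :
  cproc D P noloc c p t ->
  cproc (updel tys D) (uperm (length tys) P) noloc c (ren_p (fun j => j + length tys) p) t.
Proof.
  intros (b & -> & H). autorewrite with mterm. eexists; split; [reflexivity|].
  eapply code_ren; [| |exact H].
  - intros k y [H1 H2]. rewrite upren_ge, !updel_ge by lia. unfold uperm.
    replace (y - length (argtys t) + length tys + length (argtys t) - length (argtys t) - length tys)
      with (y - length (argtys t)) by lia.
    repeat split; auto; lia.
  - intros y [H1|[]]. rewrite upren_lt, !updel_lt by lia. split; auto. now left.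
Qed.

Definition okitem {S : sys} (D' : nat -> ty) P' (L' : nat -> Prop) (k : knd S) (t : ty) (i : sitem) : Prop :=
  (exists z, i = SVar z /\ D' z = t /\ (L' z \/ P' k z)) \/
  (exists p d, i = STerm p /\ callk k d t /\ @cproc S D' P' noloc d p t).

Lemma okitem_up {S : sys} D' P' L' (k : knd S) t i tys : okitem D' P' L' k t i ->
  okitem (updel tys D') (uperm (length tys) P') (uploc (length tys) L') k t
    (iren (fun j => j + length tys) i).
Proof.
  intros [(z & -> & HD & Hz)|(p & d & -> & Hd & Hp)]; simpl.
  - left. exists (z + length tys). rewrite updel_ge by lia. unfold uperm, uploc.
    replace (z + length tys - length tys) with z by lia. repeat split; auto.
    destruct Hz; auto. right; split; auto; lia.
  - right. do 2 eexists; split; [reflexivity|]. split; [exact Hd|]. now apply cproc_shift.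
Qed.

Lemma okitem_noloc {S : sys} D' P' L' (k : knd S) t i :
  okitem D' P' noloc k t i -> okitem D' P' L' k t i.
Proof. intros [(z & -> & HD & [[]|Hz])|H]; [left; eauto | now right]. Qed.

Lemma code_sub {S : sys} D D' P P' L L' (c : col S) e sg :
  (forall k y, P k y -> okitem D' P' noloc k (D y) (sg y)) ->
  (forall y, L y -> okitem D' P' L' (kind c) (D y) (sg y)) ->
  code D P L c e -> code D' P' L' c (sub_e sg e).
Proof.
  intros HP HL H.
  apply (code_coind (fun D' P' L' c E => exists D P L e sg,
    (forall k y, P k y -> okitem D' P' noloc k (D y) (sg y)) /\
    (forall y, L y -> okitem D' P' L' (kind c) (D y) (sg y)) /\
    code D P L c e /\ E = sub_e sg e)); [|exists D, P, L, e, sg; auto].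
  clear D D' P P' L L' c e sg HP HL H.
  intros D' P' L' c E (D & P & L & e & sg & HP & HL & H & ->).
  set (X := fun D' P' L' c E => (exists D P L e sg,
    (forall k y, P k y -> okitem D' P' noloc k (D y) (sg y)) /\
    (forall y, L y -> okitem D' P' L' (kind c) (D y) (sg y)) /\
    code D P L c e /\ E = sub_e sg e) \/ @code S D' P' L' c E).
  assert (HX : forall L L' c p t, (forall y, L y -> okitem D' P' L' (kind c) (D y) (sg y)) ->
            cproc D P L c p t -> cprocF (S := S) X D' P' L' c (sub_p sg p) t).
  { intros L0 L0' c0 p t E1 (b & -> & H1). autorewrite with mterm.
    eexists; split; [reflexivity|]. left.
    do 5 eexists. split; [|split; [|split; [exact H1 | reflexivity]]].
    - intros k y [H2 H3]. specialize (HP _ _ H3). rewrite upsub_ge, !updel_ge by lia.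
      apply (okitem_up _ _ _ _ _ _ (argtys t)) in HP.
      destruct HP as [(z & E2 & HD & [[Hz|[]]|Hz])|HP]; [| |now right].
      (* An item shifted past the binder cannot be one of the bound variables. *)
      + exfalso. destruct (sg (y - length (argtys t))); simpl in E2; inversion E2; lia.
      + left; eauto.
    - intros y Hy. destruct (Nat.lt_ge_cases y (length (argtys t))).
      + rewrite upsub_lt by lia. left. exists y. rewrite !updel_lt by lia.
        repeat split; auto. left; now left.
      + destruct Hy as [Hy|Hy]; [lia|]. specialize (E1 _ Hy).
        rewrite upsub_ge, updel_ge by lia. now apply okitem_up. }
  destruct (code_unfold _ _ _ _ _ H) as [->|[(n & ->)|(h & br & -> & Hok & Hh & Hbr)]];
    autorewrite with mterm.
  - now left.
  - right; left; eauto.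
  - right; right. do 2 eexists; split; [reflexivity|]. split; auto. split.
    2:{ intro i. left. exists D, P, L, (br i), sg. repeat split; auto. now rewrite kind_cbr. }
    assert (HA : forall r a t, cargs D P L c r a t ->
              cargsF X D' P' L' c r (fun i => sub_p sg (a i)) t).
    { intros r a t [-> Ha]. split; auto. intros i Hi. eapply HX; [|now apply Ha].
      now rewrite kind_carg. }
    destruct Hh as [(y & r & a & -> & Hy & Ha)|[(p & r & a & d & t & -> & Hd & Hp & Ha)|
      (p & r & a & s & -> & Hk & Hs & Hp & Ha)]]; autorewrite with mterm.
    + assert (Hi : okitem D' P' L' (kind c) (D y) (sg y)).
      { destruct Hy; auto. now apply okitem_noloc, HP. }
      destruct Hi as [(z & -> & HD & Hz)|(p & d & -> & Hd & Hp)].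
      * left. do 3 eexists; split; [reflexivity|]. rewrite HD. split; [exact Hz | now apply HA].
      * right; left. do 5 eexists; split; [reflexivity|]. split; [exact Hd|].
        split; [|now apply HA]. eapply cprocF_mono; [|exact Hp]. intros; now right.
    + right; left. do 5 eexists; split; [reflexivity|]. split; [exact Hd|].
      split; [|now apply HA]. eapply HX; [|exact Hp]; intros y [].
    + right; right. do 4 eexists; split; [reflexivity|]. split; auto. split; eauto.
      split; [|now apply HA].
      eapply bisp_trans; [apply sub_p_bis; [exact Hp | intro; apply item_bis_refl] | apply sub_DY].
Qed.

Lemma cproc_sub {S : sys} D D' P P' L L' (c : col S) p t sg :
  (forall k y, P k y -> okitem D' P' noloc k (D y) (sg y)) ->
  (forall y, L y -> okitem D' P' L' (kind c) (D y) (sg y)) ->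
  cproc D P L c p t -> cproc D' P' L' c (sub_p sg p) t.
Proof.
  intros HP HL (b & -> & H). autorewrite with mterm. eexists; split; [reflexivity|].
  eapply code_sub; [| |exact H].
  - intros k y [H2 H3]. specialize (HP _ _ H3). rewrite upsub_ge, !updel_ge by lia.
    apply (okitem_up _ _ _ _ _ _ (argtys t)) in HP.
    destruct HP as [(z & E2 & HD & [[Hz|[]]|Hz])|HP]; [| |now right].
    + exfalso. destruct (sg (y - length (argtys t))); simpl in E2; inversion E2; lia.
    + left; eauto.
  - intros y Hy. destruct (Nat.lt_ge_cases y (length (argtys t))).
    + rewrite upsub_lt by lia. left. exists y. rewrite !updel_lt by lia.
      repeat split; auto. left; now left.
    + destruct Hy as [Hy|Hy]; [lia|]. specialize (HL _ Hy).
      rewrite upsub_ge, updel_ge by lia. now apply okitem_up.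
Qed.

(** The bound variables are the only local variables of the body, and they become closures; this is
    why machine states never contain local variables. *)
Lemma code_beta {S : sys} D P (d : col S) t b (a : nat -> mproc) (ca : nat -> col S) :
  code (updel (argtys t) D) (uperm (length (argtys t)) P) (uploc (length (argtys t)) noloc) d b ->
  (forall i, i < length (argtys t) -> callk (kind d) (ca i) (nth i (argtys t) N) /\
     cproc D P noloc (ca i) (a i) (nth i (argtys t) N)) ->
  code D P noloc d (sub_e (beta_sub (length (argtys t)) a) b).
Proof.
  intros H Ha. eapply code_sub; [| |exact H].
  - intros k y [H1 H2]. rewrite beta_sub_ge, updel_ge by lia. left; eauto.
  - intros y [H1|[]]. rewrite beta_sub_lt, updel_lt by lia. right.
    destruct (Ha (length (argtys t) - 1 - y)) as [H2 H3]; [lia|]. eauto.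
Qed.

(** ** Uniformly coloured codes *)

(** Such a colour can be given to a whole procedure at once; this is how eta-expansions, [DY s] and
    arbitrary well-typed procedures become code. *)
Definition uniform {S : sys} (d : col S) : Prop :=
  okc d /\ (forall i, carg d i = d) /\ forall i, cbr d i = d.

Lemma cproc_eta {S : sys} (d : col S) (Hd : uniform d) s : forall D P L x,
  D x = s -> (L x \/ P (kind d) x) -> cproc D P L d (eta s x) s.
Proof.
  destruct Hd as (Hd1 & Hd2 & Hd3).
  remember (tsize s) as n eqn:E. revert s E.
  induction n as [n IH] using lt_wf_ind. intros s -> D P L x HD Hx.
  rewrite etaE. cbv zeta. eexists; split; [reflexivity|].
  apply code_fold. right; right. do 2 eexists; split; [reflexivity|]. split; auto.
  split; [|intro; apply code_num].
  left. do 3 eexists; split; [reflexivity|]. rewrite updel_ge by lia.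
  replace (x + length (argtys s) - length (argtys s)) with x by lia. rewrite HD. split.
  - unfold uploc, uperm. replace (x + length (argtys s) - length (argtys s)) with x by lia.
    destruct Hx; auto. right; split; auto; lia.
  - split; auto. intros i Hi. rewrite (proj2 (Nat.ltb_lt _ _)) by auto. rewrite Hd2.
    apply (IH _ (tsize_nth _ _ Hi)); auto.
    + rewrite updel_lt by lia. f_equal; lia.
    + left; left; lia.
Qed.

Lemma cproc_Ffix {S : sys} (d : col S) (Hd : uniform d) s D P L g :
  D g = Arr s s -> L g -> cproc D P L d (Ffix s g) s.
Proof.
  intros HD Hg.
  (* The coinductive invariant describes the body under its binder, since each unfolding shifts the
     index [g] by the arity. *)
  assert (HB : forall D P L c e, (c = d /\ exists g, g >= length (argtys s) /\ D g = Arr s s /\ L g /\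
     (forall j, j < length (argtys s) -> D (length (argtys s) - 1 - j) = nth j (argtys s) N /\
        L (length (argtys s) - 1 - j)) /\
     e = MCase (HVar g (1 + length (argtys s))
              (fun j => match j with
                        | 0 => Ffix s g
                        | S j' => eta (nth j' (argtys s) N) (length (argtys s) - 1 - j')
                        end))
           (fun i => MNum i)) -> @code S D P L c e).
  2:{ rewrite FfixE. cbv zeta. eexists; split; [reflexivity|]. apply HB. split; auto.
      exists (g + length (argtys s)). rewrite updel_ge by lia. unfold uploc.
      replace (g + length (argtys s) - length (argtys s)) with g by lia.
      repeat split; auto; try lia. rewrite updel_lt by lia. f_equal; lia. }
  clear D P L g HD Hg. apply code_coind.
  intros D P L c e (-> & g & Hgn & HD & Hg & Hx & ->).
  destruct Hd as (Hd1 & Hd2 & Hd3).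
  right; right. do 2 eexists; split; [reflexivity|]. split; auto.
  split; [|intro; right; apply code_num].
  left. do 3 eexists; split; [reflexivity|]. split; auto. rewrite HD. split; auto.
  intros [|j] Hj; rewrite Hd2.
  - change (nth 0 (argtys (Arr s s)) N) with s.
    rewrite FfixE. cbv zeta. eexists; split; [reflexivity|]. left. split; auto.
    exists (g + length (argtys s)). rewrite updel_ge by lia. unfold uploc.
    replace (g + length (argtys s) - length (argtys s)) with g by lia.
    repeat split; auto; try lia. rewrite updel_lt by lia. f_equal; lia.
  - change (nth (Datatypes.S j) (argtys (Arr s s)) N) with (nth j (argtys s) N).
    destruct (Hx j) as [H1 H2]; [lia|].
    eapply cprocF_mono; [|apply cproc_eta; auto; now repeat split]. intros; now right.
Qed.

Lemma cproc_DY {S : sys} (d : col S) (Hd : uniform d) s p D P L :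
  bisp p (DY s) -> cproc D P L d p (Arr (Arr s s) s).
Proof.
  intro H. destruct p as [t b]. rewrite DYE in H. cbv zeta in H.
  apply bisp_lam in H as [-> H]. eexists; split; [reflexivity|].
  eapply code_bis; [|apply bis_sym, H]. destruct Hd as (Hd1 & Hd2 & Hd3).
  apply code_fold. right; right. do 2 eexists; split; [reflexivity|]. split; auto.
  split; [|intro; apply code_num].
  assert (Hn : updel (argtys (Arr (Arr s s) s)) D (length (argtys s)) = Arr s s).
  { simpl argtys. rewrite updel_lt by (simpl; lia).
    replace (length (Arr s s :: argtys s) - 1 - length (argtys s)) with 0 by (simpl; lia).
    reflexivity. }
  left. do 3 eexists; split; [reflexivity|]. split; [left; left; simpl; lia|].
  rewrite Hn. split; auto. intros [|j] Hj; rewrite Hd2.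
  - change (nth 0 (argtys (Arr s s)) N) with s.
    apply cproc_Ffix; auto; [now repeat split|]. left; simpl; lia.
  - change (nth (Datatypes.S j) (argtys (Arr s s)) N) with (nth j (argtys s) N).
    apply cproc_eta; [now repeat split| |left; left; simpl; lia].
    simpl argtys. rewrite updel_lt by (simpl; lia).
    replace (length (Arr s s :: argtys s) - 1 - (length (argtys s) - 1 - j)) with (Datatypes.S j)
      by (simpl in *; lia). reflexivity.
Qed.

(** ** Coloured states *)

Definition cstate {S : sys} D (P : knd S -> nat -> Prop) (s : state) : Prop :=
  (exists c, code D P noloc c (fst s)) /\
  Forall (fun k => forall i : nat, exists c, code D P noloc c (k i)) (snd s).

(** What a machine step needs in order to preserve coloured code: the arguments keep the colours
    they had in the caller, so the callee, or the code of a constant run with colour [constc c],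
    must be allowed to call them. *)
Definition sys_laws (S : sys) (constc : col S -> col S) : Prop :=
  (forall (c d : col S) t i, okc c -> callk (kind c) d t -> i < length (argtys t) ->
     callk (kind d) (carg c i) (nth i (argtys t) N)) /\
  (forall c s, okc c -> constok c -> lv s <= slv S -> uniform (constc c) /\
     forall i, i < length (argtys (Arr (Arr s s) s)) ->
       callk (kind (constc c)) (carg c i) (nth i (argtys (Arr (Arr s s) s)) N)).

Lemma cstate_step {S : sys} constc (HS : sys_laws S constc) D P s s' :
  mstep s = Some s' -> @cstate S D P s -> cstate D P s'.
Proof.
  destruct HS as [Hcall Hconst]. destruct s as [e K]. intros Hm [[c Hc] HK]. simpl in *.
  destruct (code_unfold _ _ _ _ _ Hc) as [->|[(n & ->)|(h & br & -> & Hok & Hh & Hbr)]].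
  - discriminate.
  - destruct K as [|k K]; inversion Hm; subst. inversion HK; subst. split; simpl; auto.
  - assert (HK' : Forall (fun k => forall i, exists c, code D P noloc c (k i)) (br :: K)).
    { constructor; eauto. }
    destruct Hh as [(y & r & a & -> & Hy & Ha)|[(p & r & a & d & t & -> & Hd & Hp & Hr & Ha)|
      (p & r & a & s & -> & Hk & Hs & Hp & Hr & Ha)]]; [discriminate| |].
    + destruct Hp as (b & -> & Hb). inversion Hm; subst. split; simpl; auto.
      exists d. eapply code_beta with (ca := fun i => carg c i); [exact Hb|].
      intros i Hi; split; [now eapply Hcall | now apply Ha].
    + destruct (Hconst _ _ Hok Hk Hs) as [Hu Hcc].
      destruct (cproc_DY (constc c) Hu s p D P noloc Hp) as (b & -> & Hb).
      inversion Hm; subst. split; simpl; auto.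
      exists (constc c). eapply (code_beta D P _ (Arr (Arr s s) s)); [exact Hb|]. intros i Hi.
      split; [now apply Hcc | now apply Ha].
Qed.

Lemma cstate_reach {S : sys} constc (HS : sys_laws S constc) D P s s' :
  reach s s' -> @cstate S D P s -> cstate D P s'.
Proof.
  intros [n H]. induction H; auto. intro. apply IHrun. eapply cstate_step; eauto.
Qed.

(** * Pure types are not pseudo-retracts of types of lower level *)

(* The argument [U] is irrelevant for [j = 0]. *)
Definition apptest (j : nat) (U : mproc) (n : nat) : mproc :=
  MLam [pure j] (MCase (HVar 0 (length (argtys (pure j))) (fun _ => U))
                       (fun i => if i =? n then MNum 0 else MBot)).

(** Closed procedures just rich enough to refute a domination: constants exclude a fixed answer,
    undefined arguments exclude a look at the argument first, and [apptest] extracts what the target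
    is applied to. *)
Inductive test : nat -> mproc -> Prop :=
| t_num n : test 0 (MLam [] (MNum n))
| t_bot k : test k (MLam (argtys (pure k)) MBot)
| t_const k c : test (S k) (MLam [pure k] (MNum c))
| t_app j U n : test (Nat.pred j) U -> test (S j) (apptest j U n).

Lemma test_sub k X : test k X -> forall sg, sub_p sg X = X.
Proof.
  induction 1; intro sg; autorewrite with mterm; auto.
  unfold apptest. autorewrite with mterm. rewrite upsub_lt by (simpl; lia).
  do 2 f_equal; [f_equal; extensionality i; auto|].
  extensionality i. destruct (i =? n); now autorewrite with mterm.
Qed.

Lemma test_ren k X : test k X -> forall rho, ren_p rho X = X.
Proof.
  induction 1; intro sg; autorewrite with mterm; auto.
  unfold apptest. autorewrite with mterm. rewrite upren_lt by (simpl; lia).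
  do 2 f_equal; [f_equal; extensionality i; auto|].
  extensionality i. destruct (i =? n); now autorewrite with mterm.
Qed.

Lemma run_first m s s' f : run m s f -> mstep s = Some s' -> mstep f = None ->
  exists m', m = S m' /\ run m' s' f.
Proof.
  intros H Hs Hf. inversion H; subst; [congruence|]. exists n. split; auto. congruence.
Qed.

(** The call returns only if its argument answers [n] on [U], and what it returns is then 0. The
    bound on [m'] feeds an induction on run lengths. *)
Lemma apptest_call j U n r A m tys b br K z : (forall sg, sub_p sg U = U) ->
  A 0 = MLam tys b ->
  run m (MCase (HApp (apptest j U n) r A) br, K) (MNum z, []) ->
  num_of (sub_e (beta_sub (length tys) (fun _ => U)) b, []) n /\
  exists m', m' < m /\ run m' (br 0, K) (MNum z, []).
Proof.
  intros HU HA H. destruct (run_first _ _ _ _ H eq_refl eq_refl) as (m1 & -> & H'); clear H; rename H' into H; simpl in H.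
  autorewrite with mterm in H. rewrite beta_sub_lt in H by lia. simpl in H. rewrite HA in H.
  destruct (run_first _ _ _ _ H eq_refl eq_refl) as (m2 & -> & H'); clear H; rename H' into H; simpl in H.
  replace (fun _ : nat => sub_p _ U) with (fun _ : nat => U) in H
    by (extensionality i; now rewrite HU).
  apply (run_stack_num _ _ []) in H as (m3 & i & Hm3 & H3 & H4).
  destruct (run_first _ _ _ _ H4 eq_refl eq_refl) as (m4 & Hm4 & H4'); clear H4; rename H4' into H4; simpl in H4.
  destruct (Nat.eqb_spec i n) as [->|Hi]; autorewrite with mterm in H4.
  - destruct (run_first _ _ _ _ H4 eq_refl eq_refl) as (m5 & -> & H4'); clear H4; rename H4' into H4; simpl in H4.
    split; [eexists; eauto|]. exists m5. split; [lia | exact H4].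
  - inversion H4; subst. discriminate.
Qed.

Lemma num_of_sub s s1 sg z : reach s s1 -> num_of (sub_st sg s) z <-> num_of (sub_st sg s1) z.
Proof.
  intros [n H]. destruct (run_sub _ _ _ sg H _ (bis_st_refl _)) as (t1 & H1 & H2). split.
  - intro H3. eapply num_of_bis; [exact H2|]. eapply reach_num_back; [eexists; eauto | exact H3].
  - intro H3. eapply reach_trans; [eexists; eauto|].
    eapply num_of_bis; [apply bis_st_sym; exact H2 | exact H3].
Qed.

(* [apptest j U n] is below the constant function 0. *)
Lemma apptest_mono j U n z : (forall sg, sub_p sg U = U) -> forall m s,
  run m (sub_st (beta_sub 1 (fun _ => apptest j U n)) s) (MNum z, []) ->
  num_of (sub_st (beta_sub 1 (fun _ => MLam [pure j] (MNum 0))) s) z.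
Proof.
  intro HU. set (sX := beta_sub 1 (fun _ => apptest j U n)).
  set (sC := beta_sub 1 (fun _ => MLam [pure j] (MNum 0))).
  induction m as [m IH] using lt_wf_ind. intros s H.
  destruct (mstep s) as [s'|] eqn:E.
  - destruct (mstep_sub sX _ _ E) as (t1 & H1 & H2).
    destruct (run_first _ _ _ _ H H1 eq_refl) as (m' & -> & H3).
    destruct (run_bis _ _ _ H3 _ H2) as ([e1 K1] & H5 & H6 & H7); simpl in *.
    apply bis_num_inv in H6; subst. inversion H7; subst.
    apply (num_of_sub s s'); [eapply reach_step; [exact E | apply reach_refl]|].
    eapply IH; [|exact H5]; lia.
  - destruct (final_cases _ E) as [[y ->]|[[K ->]|(x & r & a & br & K & ->)]].
    + unfold sub_st in *; simpl in *. autorewrite with mterm in *.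
      inversion H; subst; [apply reach_refl | discriminate].
    + unfold sub_st in *; simpl in *. autorewrite with mterm in *.
      inversion H; subst; discriminate.
    + unfold sub_st in *; simpl in *. autorewrite with mterm in *.
      destruct x as [|x].
      (* Only a call of the substituted variable separates the two sides. The [apptest] returned,
         hence with 0, and the constant returns 0 as well. *)
      * unfold sX, sC in *. rewrite beta_sub_lt in * by lia.
        destruct (sub_p (beta_sub 1 (fun _ => apptest j U n)) (a 0)) as [tys b] eqn:Ea.
        destruct (apptest_call _ _ _ _ _ _ _ _ _ _ _ HU Ea H) as (_ & m' & Hm' & H').
        eapply reach_step; [reflexivity|]. autorewrite with mterm.
        eapply reach_step; [reflexivity|]. apply (IH m' Hm' (br 0, K)). exact H'.
      * unfold sX in H. rewrite beta_sub_ge in H by lia. inversion H; subst; discriminate.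
Qed.

(* Colour [true] must not use the target variable directly and may call [false] at level
   below [k] only; then [false], which may not use the argument variable directly, receives
   arguments of level below [k - 1] only. *)
Definition retract_sys (K k : nat) : sys.
Proof.
  refine (Sys bool bool (fun c => c) (fun _ => True) (fun c _ => c) (fun c _ => c)
    (fun c d t => c = d \/ (c = true /\ d = false /\ lv t < k) \/
                  (c = false /\ d = true /\ S (lv t) < k))
    (fun _ => True) K _ _); reflexivity.
Defined.

Lemma retract_sys_laws K k : sys_laws (retract_sys K k) (fun c => c).
Proof.
  split; simpl.
  - intros c d t i _ H Hi. pose proof (lv_nth _ _ Hi).
    destruct H as [<-|[(-> & -> & H)|(-> & -> & H)]]; auto.
    + right; right; repeat split; lia.
    + right; left; repeat split; lia.
  - intros c s _ _ _. split; [now repeat split|]. auto.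
Qed.

(** Going one level down exchanges the colours: what [false] may call of colour [true] has level
    below [k], which is the bound imposed in the smaller system on what [true] may call of colour
    [false]. *)
Lemma retract_sys_next K k : recolouring (retract_sys K (S k)) (retract_sys K k)
  (fun c c' => c' = false \/ (c = false /\ c' = true)).
Proof.
  split; auto. intros c c' Hc _. simpl in *. repeat split; auto.
  intros d t H. destruct Hc as [->|[-> ->]].
  - exists false; auto.
  - destruct d.
    + exists false. split; auto. right; left.
      destruct H as [H|[(H & _)|(_ & _ & H)]]; try discriminate. repeat split; lia.
    + exists true. auto.
Qed.

Lemma sub_eta_term s x p sg : sg x = STerm p -> sub_p sg (eta s x) =
  let n := length (argtys s) in
  MLam (argtys s) (MCase (HApp (ren_p (fun j => j + n) p) n
     (fun j => if j <? n then eta (nth j (argtys s) N) (n - 1 - j) else MLam [] MBot))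
     (fun i => MNum i)).
Proof.
  intro H. rewrite etaE. cbv zeta. autorewrite with mterm.
  rewrite upsub_ge by lia. replace (x + _ - _) with x by lia. rewrite H. simpl.
  do 2 f_equal; [f_equal|].
  - extensionality j. destruct (Nat.ltb_spec j (length (argtys s))).
    + apply sub_eta, upsub_lt; lia.
    + now autorewrite with mterm.
  - extensionality i. now autorewrite with mterm.
Qed.

Definition two (X V : mproc) (i : nat) : mproc := match i with 0 => X | S _ => V end.

Definition eta_body (j : nat) : mexp :=
  MCase (HVar 1 1 (fun i => if i <? 1 then eta (pure j) 0 else MLam [] MBot)) (fun i => MNum i).

(* [b] stands for a procedure of type [pure k] with free variable the target (the outermost
   index); it is at least the eta-expansion of the target on all tests. *)
Definition dominates (k : nat) (b : mexp) : Prop :=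
  match k with
  | 0 => forall n, num_of (sub_e (beta_sub 1 (fun _ => MLam [] (MNum n))) b, []) n
  | S j => forall X V n, test (S j) X -> test j V ->
      num_of (sub_e (beta_sub 2 (two X V)) (eta_body j), []) n ->
      num_of (sub_e (beta_sub 2 (two X V)) b, []) n
  end.

(** For positive [k], index 0 is the argument and index 1 the target; at [k = 0] there is no
    argument and index 0 is the target. *)
Definition perm3 (k : nat) (c : bool) (y : nat) : Prop :=
  match k with
  | 0 => c = false
  | S _ => (c = true /\ y = 0) \/ (c = false /\ y = 1)
  end.

Definition types3 (k : nat) (D : nat -> ty) : Prop :=
  match k with 0 => D 0 = N | S j => D 0 = pure j /\ D 1 = pure (S j) end.

Lemma updel_nil D : updel [] D = D.
Proof. extensionality i. rewrite updel_ge by (simpl; lia). f_equal; simpl; lia. Qed.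

(** At level 0 the colour [true] can call only itself and may mention no variable. The machine then
    never stops at a variable, so the code is constant and cannot follow the target through all
    numerals. *)
Lemma not_dominates_0 K D b : @code (retract_sys K 0) D (perm3 0) noloc true b -> ~ dominates 0 b.
Proof.
  intros H Hd. simpl in Hd.
  assert (H' : @code (retract_sys K 0) D (fun _ _ => False) noloc true b).
  { eapply (code_recolour (retract_sys K 0) (retract_sys K 0) (fun c c' => c = true /\ c' = true));
      [| | | |exact H]; auto.
    - split; auto. intros c c' [-> ->] _. simpl. repeat split; auto.
      intros d t [<-|[(_ & _ & H1)|(H1 & _)]]; [eauto | lia | discriminate].
    - intros c c' y [-> ->] Hp. simpl in Hp. discriminate. }
  assert (Hc : cstate (S := retract_sys K 0) D (fun _ _ => False) (b, [])).
  { split; simpl; eauto. }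
  assert (Hv : forall x r a br J, ~ var_of (b, []) x r a br J).
  { intros x r a br J Hr. destruct (cstate_reach _ (retract_sys_laws K 0) _ _ _ _ Hr Hc) as [[c E] _].
    simpl in E. destruct (code_unfold _ _ _ _ _ E) as [F|[(n & F)|(h & br' & F & _ & Hh & _)]];
      inversion F; subst.
    destruct Hh as [(y & r' & a' & F' & Hy & _)|[(p & r' & a' & d & t & F' & _)|
      (p & r' & a' & s & F' & _)]]; inversion F'; subst.
    destruct Hy as [[]|[]]. }
  destruct (classic (exists n, num_of (b, []) n)) as [[n Hn]|Hn].
  - specialize (Hd (S n)). apply (num_of_sub (b, []) (MNum n, [])) in Hd; auto.
    unfold sub_st in Hd; simpl in Hd; autorewrite with mterm in Hd.
    apply (num_of_inj _ n) in Hd; [lia | apply reach_refl].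
  - assert (Hs : stuck (b, [])) by (split; eauto).
    eapply (stuck_sub _ _ _ (bis_st_refl _)) in Hs. eapply (proj1 Hs). apply (Hd 0).
Qed.
Lemma num_of_push s s' n : mstep s = Some s' -> num_of s' n -> num_of s n.
Proof. intros H; now apply reach_step. Qed.
Lemma num_of_pull s s' n : mstep s = Some s' -> num_of s n -> num_of s' n.
Proof.
  intro H. apply reach_num_back. eapply reach_step; [exact H | apply reach_refl].
Qed.

Lemma const_eta_body j c V :
  num_of (sub_e (beta_sub 2 (two (MLam [pure j] (MNum c)) V)) (eta_body j), []) c.
Proof.
  unfold eta_body. autorewrite with mterm. rewrite beta_sub_lt by lia. simpl two.
  eapply num_of_push; [reflexivity|]; cbv beta. autorewrite with mterm.
  eapply num_of_push; [reflexivity|]; cbv beta. autorewrite with mterm. apply reach_refl.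
Qed.

Lemma apptest_eta_body j U V n : test (Nat.pred j) U -> test j V ->
  match j with
  | 0 => V = MLam [] (MNum n)
  | S i => num_of (sub_e (beta_sub 2 (two V U)) (eta_body i), []) n
  end ->
  num_of (sub_e (beta_sub 2 (two (apptest j U n) V)) (eta_body j), []) 0.
Proof.
  intros HU HV H. unfold eta_body at 1. autorewrite with mterm.
  rewrite beta_sub_lt by lia. simpl two.
  eapply num_of_push; [reflexivity|]; cbv beta. simpl length. autorewrite with mterm.
  rewrite beta_sub_lt by lia. simpl (1 - 1 - 0). rewrite (proj2 (Nat.ltb_lt 0 1)) by lia.
  rewrite (sub_eta_term _ _ V); [|now rewrite beta_sub_lt by lia]. cbv zeta.
  rewrite (test_ren _ _ HV).
  eapply num_of_push; [reflexivity|]; cbv beta. autorewrite with mterm.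
  rewrite (test_sub _ _ HV).
  match goal with |- num_of (MCase (HApp V ?r ?a) ?k, ?k1 :: ?k2 :: nil) 0 =>
    set (st := MCase (HApp V r a) k); set (kk := k1 :: k2 :: nil) end.
  assert (Hn : num_of (st, []) n).
  { unfold st. destruct j as [|i].
    - subst V. eapply num_of_push; [reflexivity|]; cbv beta. autorewrite with mterm.
      eapply num_of_push; [reflexivity|]; cbv beta. autorewrite with mterm. apply reach_refl.
    - unfold eta_body in H. autorewrite with mterm in H. rewrite beta_sub_lt in H by lia.
      simpl two in H. simpl length. match type of H with
        num_of (MCase (HApp _ _ ?a) ?k, _) _ => match goal with |- num_of (MCase (HApp _ _ ?a') ?k', _) _ =>
          replace a' with a; [replace k' with k; [exact H|] |] end end.
      { extensionality j0. now autorewrite with mterm. }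
      extensionality j0. destruct j0 as [|j0]; simpl; [|now autorewrite with mterm].
      rewrite !(sub_eta_term _ 0 U); auto.
      rewrite beta_sub_lt by lia. simpl. now rewrite (test_sub _ _ HU). }
  eapply reach_trans; [apply (reach_app _ _ _ _ kk Hn)|]. simpl. unfold kk.
  eapply num_of_push; [reflexivity|]; cbv beta. rewrite Nat.eqb_refl. autorewrite with mterm.
  eapply num_of_push; [reflexivity|]; cbv beta. autorewrite with mterm. apply reach_refl.
Qed.

(** By the head normal form of [b]. A numeral, or no result, cannot match all constant functions in
    place of the target, and a leading argument variable fails on an undefined argument. If [b]
    first calls the target, what it passes there dominates the argument variable, one level down and
    with colours exchanged, against the induction hypothesis. *)
Lemma not_dominates K k : forall D b, types3 k D ->
  @code (retract_sys K k) D (perm3 k) noloc true b -> ~ dominates k b.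
Proof.
  induction k as [|j IH]; intros D b HD H; [now apply (not_dominates_0 K D)|].
  destruct HD as [HD0 HD1]. intro Hd.
  set (bot := MLam (argtys (pure j)) MBot). set (cst := fun c => MLam [pure j] (MNum c)).
  assert (Hcst : forall c, num_of (sub_e (beta_sub 2 (two (cst c) bot)) b, []) c).
  { intro c. apply Hd; [constructor | constructor | apply const_eta_body]. }
  destruct (classic (exists n, num_of (b, []) n)) as [[n Hn]|Hn].
  { specialize (Hcst (S n)). apply (num_of_sub (b, []) (MNum n, [])) in Hcst; auto.
    unfold sub_st in Hcst; simpl in Hcst; autorewrite with mterm in Hcst.
    apply (num_of_inj _ n) in Hcst; [lia | apply reach_refl]. }
  destruct (classic (exists x r a br J, var_of (b, []) x r a br J)) as [(x & r & a & br & J & Hv)|Hv].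
  2:{ assert (Hs : stuck (b, [])) by (split; intros; intro; eauto 8).
      eapply (stuck_sub _ _ _ (bis_st_refl _)) in Hs. eapply (proj1 Hs). apply (Hcst 0). }
  assert (Hc : cstate (S := retract_sys K (S j)) D (perm3 (S j)) (b, [])) by (split; simpl; eauto).
  destruct (cstate_reach _ (retract_sys_laws K (S j)) _ _ _ _ Hv Hc) as [[c E] _]. simpl in E.
  destruct (code_unfold _ _ _ _ _ E) as [F|[(n & F)|(h & br' & F & _ & Hh & _)]];
    inversion F; subst br' h; clear F.
  destruct Hh as [(y & r' & a' & F' & Hy & Ha)|[(p & r' & a' & d & t & F' & _)|
    (p & r' & a' & s & F' & _)]]; inversion F'; subst y r' a'; clear F'.
  destruct Hy as [[]|[[Hc1 ->]|[Hc1 ->]]]; simpl in Hc1; subst c.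
  (* The argument variable is at the head: with [bot] in its place nothing is returned. *)
  - specialize (Hcst 0). apply (num_of_sub (b, []) _ _ _ Hv) in Hcst.
    unfold sub_st in Hcst; simpl in Hcst; autorewrite with mterm in Hcst.
    rewrite beta_sub_lt in Hcst by lia. simpl two in Hcst.
    eapply num_of_pull in Hcst; [|reflexivity]. autorewrite with mterm in Hcst.
    destruct Hcst as [m Hm]; inversion Hm; subst; discriminate.
  - rewrite HD1 in Ha. destruct Ha as [Hr Ha]. specialize (Ha 0 ltac:(simpl in Hr; lia)).
    simpl in Hr, Ha. change (cproc (S := retract_sys K (S j)) D (perm3 (S j)) noloc false (a 0) (pure j)) in Ha.
    (* What is passed to the target may mention the target again. There it is replaced by the
       constant 0, which by [apptest_mono] loses no answer obtained with an [apptest] in that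
       place. *)
    set (C0 := MLam [pure j] (MNum 0)).
    set (tau := fun y => match y with 0 => SVar 0 | 1 => STerm C0 | S (S z) => SVar (S z) end).
    assert (HT : cproc (S := retract_sys K (S j)) D (fun c y => c = true /\ y = 0) noloc false
                   (sub_p tau (a 0)) (pure j)).
    { eapply cproc_sub; [| |exact Ha]; [|intros y []].
      intros c y [[-> ->]|[-> ->]].
      - left. exists 0. repeat split; auto.
      - right. exists C0, false. split; auto. split; [now left|]. rewrite HD1.
        eexists; split; [reflexivity|]. apply code_num. }
    (* The exchange of colours makes this code of colour [true] at [j], with the former argument
       variable as its new target. *)
    apply (cproc_recolour (retract_sys K (S j)) (retract_sys K j) _ _ _ (fun (c : bool) y => c = false /\ y = 0)
             _ noloc _ true _ _ (retract_sys_next K j)) in HT; auto.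
    2:{ intros c c' y Hcc [Hc1 ->]. simpl in Hc1. subst c. destruct Hcc as [->|[]]; [auto|discriminate]. }
    destruct Ha as (bT & EaT & _). destruct HT as (b' & Eb' & HT).
    rewrite EaT in Eb'. autorewrite with mterm in Eb'. inversion Eb'; subst b'; clear Eb'.
    set (m := length (argtys (pure j))) in *.
    apply (@code_perm (retract_sys K j) _ _ (perm3 j) _ noloc) in HT.
    2:{ intros c y [H1 [H2 H3]]. destruct j; simpl; auto. simpl in m. unfold m in *. right. split; auto; lia. }
    2:{ intros y [Hy|[]]. destruct j; simpl in m; unfold m in *; [lia|].
        right. left. split; auto; lia. }
    refine (IH _ _ _ HT _).
    { destruct j; simpl; [now rewrite updel_nil|]. split; [reflexivity|].
      rewrite updel_ge by (simpl; lia). exact HD0. }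
    (* If [V] answers [n] on [U], then [apptest j U n] returns 0 on [V], so [b] returns 0 too. Since
       [b] calls the target first, what it passes must also answer [n] on [U]. *)
    assert (Key : forall U V n bt, test (Nat.pred j) U -> test j V ->
       num_of (sub_e (beta_sub 2 (two (apptest j U n) V)) (eta_body j), []) 0 ->
       (forall y, y < m -> bt y = STerm U) -> bt m = STerm V ->
       (forall y, m < y -> bt y = SVar (y - m - 1)) ->
       num_of (sub_e bt (sub_e (upsub m tau) bT), []) n).
    { intros U V n bt HU HV Hp B1 B2 B3.
      apply Hd in Hp; [|now constructor|exact HV].
      pose proof (test_sub _ _ HU) as SU. pose proof (test_sub _ _ HV) as SV.
      pose proof (test_ren _ _ HU) as RU. pose proof (test_ren _ _ HV) as RV.
      assert (HX : test (S j) (apptest j U n)) by now constructor.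
      pose proof (test_sub _ _ HX) as SX. pose proof (test_ren _ _ HX) as RX.
      apply (num_of_sub (b, []) _ _ _ Hv) in Hp.
      unfold sub_st in Hp; simpl in Hp; autorewrite with mterm in Hp.
      rewrite beta_sub_lt in Hp by lia. simpl two in Hp. destruct Hp as [N1 Hp].
      set (th := beta_sub 2 (two (apptest j U n) V)) in *.
      assert (E2 : sub_p th (a 0) = MLam (argtys (pure j)) (sub_e (upsub m th) bT)).
      { rewrite EaT. now autorewrite with mterm. }
      destruct (apptest_call _ _ _ _ (fun i => sub_p th (a i)) _ _ _ _ _ _ SU E2 Hp) as [Hn1 _].
      fold m in Hn1.
      (* [rho] inserts [U] and [V] but keeps the target as variable 0, so that [apptest_mono] can
         compare the two substitutions for it. *)
      set (rho := fun y => if y <? m then STerm U else if y =? m then STerm V else SVar (y - m - 1)).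
      assert (Hn2 : num_of (sub_st (beta_sub 1 (fun _ => apptest j U n)) (sub_e rho bT, [])) n).
      { eapply num_of_bis; [|exact Hn1]. apply bis_st_nil.
        eapply bis_trans; [apply sub_sub; intro; apply item_bis_refl|].
        apply bis_sym, sub_sub. intro y.
        match goal with |- item_bis ?A ?B => replace A with B; [apply item_bis_refl|] end.
        unfold rho. destruct (Nat.ltb_spec y m).
        - rewrite upsub_lt by lia. simpl. rewrite beta_sub_lt by lia. now rewrite SU.
        - rewrite upsub_ge by lia. unfold th. destruct (Nat.eqb_spec y m) as [->|Hy].
          + rewrite Nat.sub_diag. rewrite beta_sub_lt by lia. simpl. now rewrite RV, !SV.
          + destruct (Nat.eq_dec y (S m)) as [->|Hy'].
            * replace (S m - m) with 1 by lia. rewrite beta_sub_lt by lia.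
              unfold two, iren, isub. replace (2 - 1 - 1) with 0 by lia.
              rewrite RX, SX. replace (1 - 1) with 0 by lia. now rewrite beta_sub_lt by lia.
            * rewrite beta_sub_ge by lia. simpl. rewrite !beta_sub_ge by lia. f_equal; lia. }
      destruct Hn2 as [N2 Hn2]. apply apptest_mono in Hn2; auto.
      eapply num_of_bis; [|exact Hn2]. apply bis_st_nil.
      eapply bis_trans; [apply sub_sub; intro; apply item_bis_refl|].
      apply bis_sym, sub_sub. intro y.
      match goal with |- item_bis ?A ?B => replace A with B; [apply item_bis_refl|] end.
      unfold rho. destruct (Nat.ltb_spec y m).
      - rewrite upsub_lt by lia. simpl. now rewrite B1, SU by lia.
      - rewrite upsub_ge by lia. unfold tau. destruct (Nat.eqb_spec y m) as [->|Hy].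
        + rewrite Nat.sub_diag. simpl. now rewrite B2, SV.
        + destruct (Nat.eq_dec y (S m)) as [->|Hy'].
          * replace (S m - m) with 1 by lia. replace (1 - 1) with 0 by lia.
            unfold iren, isub, C0. rewrite beta_sub_lt by lia. now autorewrite with mterm.
          * destruct (y - m) as [|[|z]] eqn:Ez; [lia|lia|]. simpl. rewrite B3 by lia.
            rewrite beta_sub_ge by lia. f_equal; lia. }
    destruct j as [|i]; simpl in m; simpl dominates.
    + intro n. eapply (Key bot (MLam [] (MNum n)) n); unfold m; try constructor; try lia.
      * apply (apptest_eta_body 0); [constructor | constructor | reflexivity].
      * intros y Hy. rewrite beta_sub_ge by lia. f_equal; lia.
    + intros V U n HV HU Hp. apply (Key U V n); auto; unfold m.
      * now apply (apptest_eta_body (S i)).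
      * intros y Hy. assert (y = 0) by lia; subst. reflexivity.
      * intros y Hy. rewrite beta_sub_ge by lia. f_equal; lia.
Qed.

(** * Arguments beyond the arity *)

(* The arguments [a i] of [HVar x r a] and [HApp p r a] with [i >= r] are meaningless, and
   free variables are not counted there; [clean_e] erases them. *)
CoFixpoint clean_e (e : mexp) : mexp :=
  match e with
  | MBot => MBot
  | MNum n => MNum n
  | MCase h br => MCase (clean_h h) (fun i => clean_e (br i))
  end
with clean_h (h : mhead) : mhead :=
  match h with
  | HVar x r a => HVar x r (fun i => if i <? r then clean_p (a i) else MLam [] MBot)
  | HApp p r a => HApp (clean_p p) r (fun i => if i <? r then clean_p (a i) else MLam [] MBot)
  | HExp e => HExp (clean_e e)
  end
with clean_p (p : mproc) : mproc :=
  match p with MLam tys b => MLam tys (clean_e b) end.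
Arguments clean_e : simpl never. Arguments clean_h : simpl never. Arguments clean_p : simpl never.

Definition clean_args (r : nat) (a : nat -> mproc) (i : nat) : mproc :=
  if i <? r then clean_p (a i) else MLam [] MBot.

Arguments clean_args : simpl never.

Lemma clean_botE : clean_e MBot = MBot.
Proof. now rewrite (mexp_frobE (clean_e _)). Qed.
Lemma clean_numE n : clean_e (MNum n) = MNum n.
Proof. now rewrite (mexp_frobE (clean_e _)). Qed.
Lemma clean_caseE h br : clean_e (MCase h br) = MCase (clean_h h) (fun i => clean_e (br i)).
Proof. now rewrite (mexp_frobE (clean_e _)). Qed.
Lemma clean_varE x r a : clean_h (HVar x r a) = HVar x r (clean_args r a).
Proof. now rewrite (mhead_frobE (clean_h _)). Qed.
Lemma clean_appE p r a : clean_h (HApp p r a) = HApp (clean_p p) r (clean_args r a).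
Proof. now rewrite (mhead_frobE (clean_h _)). Qed.
Lemma clean_expE e : clean_h (HExp e) = HExp (clean_e e).
Proof. now rewrite (mhead_frobE (clean_h _)). Qed.
Lemma clean_lamE t b : clean_p (MLam t b) = MLam t (clean_e b).
Proof. now rewrite (mproc_frobE (clean_p _)). Qed.
#[export] Hint Rewrite clean_botE clean_numE clean_caseE clean_varE clean_appE clean_expE clean_lamE
  : mterm.

Lemma clean_renn n : forall e rho, bisn n (clean_e (ren_e rho e)) (ren_e rho (clean_e e)).
Proof.
  induction n as [|n IH]; [easy|].
  assert (IHp : forall p rho, lam_rel (bisn n) (clean_p (ren_p rho p)) (ren_p rho (clean_p p))).
  { intros [t b] rho. autorewrite with mterm. split; auto. }
  assert (IHa : forall r a rho i, lam_rel (bisn n)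
    (clean_args r (fun i => ren_p rho (a i)) i) (ren_p rho (clean_args r a i))).
  { intros r a rho i. unfold clean_args. destruct (i <? r); auto.
    autorewrite with mterm. split; auto using bisn_refl. }
  intros [| m | h br] rho; autorewrite with mterm; simpl; auto. split; auto.
  destruct h; autorewrite with mterm; repeat split; auto; intro; apply IHa.
Qed.

Definition clean_item (i : sitem) : sitem :=
  match i with SVar j => SVar j | STerm p => STerm (clean_p p) end.

Lemma clean_iren rho i : item_bis (clean_item (iren rho i)) (iren rho (clean_item i)).
Proof.
  destruct i as [j | [t b]]; simpl; [apply item_bis_refl|]. apply item_bis_term.
  autorewrite with mterm. apply bisp_lam; split; auto. intro; apply clean_renn.
Qed.

Lemma clean_upsub n sg tau : (forall y, item_bis (clean_item (sg y)) (tau y)) ->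
  forall y, item_bis (clean_item (upsub n sg y)) (upsub n tau y).
Proof.
  intros H y. destruct (Nat.lt_ge_cases y n).
  - rewrite !upsub_lt by lia. apply item_bis_refl.
  - rewrite !upsub_ge by lia. eapply item_bis_trans; [apply clean_iren|]. apply iren_bis; auto.
Qed.

Lemma clean_subn n : forall e sg tau, (forall y, item_bis (clean_item (sg y)) (tau y)) ->
  bisn n (clean_e (sub_e sg e)) (sub_e tau (clean_e e)).
Proof.
  induction n as [|n IH]; [easy|].
  assert (IHp : forall p sg tau, (forall y, item_bis (clean_item (sg y)) (tau y)) ->
    lam_rel (bisn n) (clean_p (sub_p sg p)) (sub_p tau (clean_p p))).
  { intros [t b] sg tau H. autorewrite with mterm. split; auto. apply IH, clean_upsub; auto. }
  assert (IHa : forall r a sg tau, (forall y, item_bis (clean_item (sg y)) (tau y)) ->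
    forall i, lam_rel (bisn n)
    (clean_args r (fun i => sub_p sg (a i)) i) (sub_p tau (clean_args r a i))).
  { intros r a sg tau H i. unfold clean_args. destruct (i <? r); auto.
    autorewrite with mterm. split; auto using bisn_refl. }
  intros [| m | h br] sg tau H; autorewrite with mterm; simpl; auto. split; auto.
  destruct h as [x r a | |]; autorewrite with mterm; [|repeat split; auto; intro; now apply IHa | now apply IH].
  pose proof (H x n) as Hx. destruct (sg x), (tau x); simpl in Hx; try easy;
    autorewrite with mterm; repeat split; auto; intro; now apply IHa.
Qed.

Definition clean_st (s : state) : state :=
  (clean_e (fst s), map (fun k i => clean_e (k i)) (snd s)).

(** With one colour and every call allowed, being code means being well typed. What this secures is
    that the number of arguments always matches the arity. *)
Definition typing_sys (K : nat) : sys.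
Proof.
  refine (Sys unit unit (fun c => c) (fun _ => True) (fun c _ => c) (fun c _ => c)
    (fun _ _ _ => True) (fun _ => True) K _ _); reflexivity.
Defined.

Lemma typing_sys_laws K : sys_laws (typing_sys K) (fun c => c).
Proof. repeat split; auto. Qed.

Lemma typing_sys_forget (S : sys) : recolouring S (typing_sys (slv S)) (fun _ _ => True).
Proof.
  split; auto. intros c c' _ _. simpl. repeat split; auto.
Qed.

(** A typed call supplies exactly as many arguments as the callee binds, so [beta_sub] never picks
    up an erased one. *)
Lemma clean_step K D P s s' : @cstate (typing_sys K) D P s -> mstep s = Some s' ->
  exists t', mstep (clean_st s) = Some t' /\ bis_st t' (clean_st s').
Proof.
  destruct s as [e J]. intros [[c Hc] _] Hm. simpl in Hc.
  destruct (code_unfold _ _ _ _ _ Hc) as [->|[(n & ->)|(h & br & -> & _ & Hh & _)]].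
  - discriminate.
  - destruct J as [|k J]; inversion Hm; subst. unfold clean_st; simpl. autorewrite with mterm.
    eexists; split; [reflexivity | apply bis_st_refl].
  - assert (Hb : exists tys b a, h = HApp (MLam tys b) (length tys) a).
    { destruct Hh as [(y & r & a & -> & _)|[(p & r & a & d & t & -> & _ & Hp & -> & _)|
        (p & r & a & t & -> & _ & _ & Hp & -> & _)]]; [discriminate| |].
      - destruct Hp as (b & -> & _). eauto.
      - destruct p as [tys b]. rewrite DYE in Hp. apply bisp_lam in Hp as [-> _].
        simpl. eexists (_ :: _), b, a. reflexivity. }
    destruct Hb as (tys & b & a & ->). inversion Hm; subst.
    unfold clean_st; simpl. autorewrite with mterm.
    eexists; split; [reflexivity|]. split; simpl.
    + apply bis_sym. intro n; apply clean_subn. intro y.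
      destruct (Nat.lt_ge_cases y (length tys)).
      * rewrite !beta_sub_lt by lia. simpl. unfold clean_args.
        rewrite (proj2 (Nat.ltb_lt _ _)) by lia. apply item_bis_refl.
      * rewrite !beta_sub_ge by lia. apply item_bis_refl.
    + constructor; [intro; apply bis_refl|]. apply Forall2_same; intros; apply bis_refl.
Qed.

Lemma clean_run K D P n s f : run n s f -> @cstate (typing_sys K) D P s ->
  forall t, bis_st t (clean_st s) -> exists t', run n t t' /\ bis_st t' (clean_st f).
Proof.
  induction 1 as [s | n s s' f Hs Hr IH]; intros Hc t Ht.
  - exists t; split; auto; constructor.
  - destruct (clean_step _ _ _ _ _ Hc Hs) as (u & H1 & H2).
    destruct (mstep_bis _ _ _ H1 (bis_st_sym _ _ Ht)) as (t1 & H3 & H4).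
    destruct (IH (cstate_step _ (typing_sys_laws K) _ _ _ _ Hs Hc) t1) as (t' & H5 & H6).
    { eapply bis_st_trans; [apply bis_st_sym, H4 | apply H2]. }
    exists t'; split; auto. econstructor; eauto.
Qed.

Lemma clean_num K D P s n : @cstate (typing_sys K) D P s -> num_of s n <-> num_of (clean_st s) n.
Proof.
  intro Hc. split.
  - intros [m H]. destruct (clean_run _ _ _ _ _ _ H Hc _ (bis_st_refl _)) as ([e J] & H1 & H2 & H3).
    simpl in *. autorewrite with mterm in H2. apply bis_sym, bis_num_inv in H2; subst.
    inversion H3; subst. eexists; eauto.
  (* A run of [s] with more than [m] steps would be copied by the cleaned state, which halts after
     [m]. *)
  - intros [m H]. destruct (run_prefix_or_final (S m) s) as [[s' H1]|(m' & f & _ & H1 & Hf)].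
    + destruct (clean_run _ _ _ _ _ _ H1 Hc _ (bis_st_refl _)) as (t & H2 & _).
      destruct (run_final_split _ _ _ H eq_refl _ _ H2). lia.
    + destruct (clean_run _ _ _ _ _ _ H1 Hc _ (bis_st_refl _)) as ([e J] & H2 & H3 & H4).
      destruct (run_final_split _ _ _ H eq_refl _ _ H2) as [_ H5].
      destruct (final_cases _ Hf) as [[z ->]|[[K' ->]|(x & r & a & br & K' & ->)]];
        simpl in *; autorewrite with mterm in H3; apply bis_sym in H3.
      * apply bis_num_inv in H3; subst. inversion H4; subst. inversion H5; subst; [|discriminate].
        eexists; eauto.
      * apply bis_bot_inv in H3; subst. inversion H5; subst; discriminate.
      * apply bis_case_inv in H3 as (h' & br' & -> & Hh & _).
        apply head_bis_var_inv in Hh as (a' & -> & _). inversion H5; subst; discriminate.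
Qed.

(** ** Weak evaluation *)

(* [wEv] is [Ev] without any condition on the meaningless arguments. *)
Definition wevF (X : state -> mexp -> Prop) (s : state) (t : mexp) : Prop :=
  (t = MBot /\ stuck s) \/ (exists n, t = MNum n /\ num_of s n) \/
  exists x r a br K a' br', t = MCase (HVar x r a') br' /\ var_of s x r a br K /\
    (forall i, i < r -> lam_st X (a i) (a' i)) /\ forall i, X (br i, K) (br' i).

Definition wEv (s : state) (t : mexp) : Prop :=
  exists X : state -> mexp -> Prop, (forall s t, X s t -> wevF X s t) /\ X s t.

Lemma wevF_mono (X Y : state -> mexp -> Prop) s t :
  (forall s t, X s t -> Y s t) -> wevF X s t -> wevF Y s t.
Proof.
  intros H [H1|[H1|(x & r & a & br & K & a' & br' & E & H1 & H2 & H3)]];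
    [now left | right; now left | right; right].
  exists x, r, a, br, K, a', br'. repeat split; auto. intros; eapply lam_st_mono; eauto.
Qed.

Lemma wEv_unfold s t : wEv s t -> wevF wEv s t.
Proof.
  intros (X & HX & H). eapply wevF_mono; [|apply HX, H]. intros; exists X; auto.
Qed.

Lemma Ev_wEv s t : Ev s t -> wEv s t.
Proof.
  intro H. exists Ev; split; auto. clear; intros s t H.
  destruct (Ev_unfold _ _ H) as [H1|[H1|(x & r & a & br & K & a' & br' & E & H1 & H2 & H3)]];
    [now left | right; now left | right; right].
  exists x, r, a, br, K, a', br'. repeat split; auto.
Qed.

(** The machine is deterministic, so the trees agree wherever [wEv] constrains them; [clean_e]
    erases the rest. *)
Lemma Ev_wEv_cleann n : forall s u t, Ev s u -> wEv s t -> bisn n (clean_e u) (clean_e t).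
Proof.
  induction n as [|n IH]; [easy|]. intros s u t Hu Ht.
  destruct (Ev_unfold _ _ Hu) as [[-> H]|[(m & -> & H)|(x & r & a & br & K & a' & br' & -> & H & Ha & Hb)]];
  destruct (wEv_unfold _ _ Ht) as [[-> E]|[(m1 & -> & E)|(x1 & r1 & a1 & br1 & K1 & a1' & br1' & -> & E & Ea & Eb)]];
  try (exfalso; eapply (proj1 H); eassumption);
  try (exfalso; eapply (proj2 H); eassumption);
  try (exfalso; eapply (proj1 E); eassumption);
  try (exfalso; eapply (proj2 E); eassumption);
  try (exfalso; eauto using num_var_absurd; fail); autorewrite with mterm; simpl; auto.
  - eapply num_of_inj; eauto.
  - destruct (var_of_inj _ _ _ _ _ _ _ _ _ _ _ H E) as (-> & -> & -> & -> & ->).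
    split; [|eauto]. repeat split; auto. intro i. unfold clean_args.
    destruct (Nat.ltb_spec i r) as [Hi|Hi]; [|split; auto using bisn_refl].
    specialize (Ha i); specialize (Ea i Hi).
    destruct (a i), (a' i), (a1' i); simpl in Ha, Ea. destruct Ha as [<- Ha], Ea as [<- Ea].
    autorewrite with mterm. split; eauto.
Qed.

Lemma bis_clean_var_inv x r a br t : bis (clean_e (MCase (HVar x r a) br)) (clean_e t) ->
  exists a' br', t = MCase (HVar x r a') br' /\
    (forall i, i < r -> bisp (clean_p (a i)) (clean_p (a' i))) /\
    forall i, bis (clean_e (br i)) (clean_e (br' i)).
Proof.
  autorewrite with mterm. intro H. apply bis_case_inv in H as (h' & br' & E & Hh & Hb).
  destruct t as [| m | h br1]; autorewrite with mterm in E; inversion E; subst h' br'; clear E.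
  apply head_bis_var_inv in Hh as (a' & E & Ha).
  destruct h as [x' r' a1 | |]; autorewrite with mterm in E; inversion E; subst.
  exists a1, br1. repeat split; auto. intros i Hi. specialize (Ha i). unfold clean_args in Ha.
  now rewrite (proj2 (Nat.ltb_lt _ _)) in Ha.
Qed.

(** ** Evaluation trees are well typed *)

(** [P] and [L] need only cover the variables that survive evaluation, which may be fewer than those
    of the code in [s]. *)
Lemma wEv_code K : forall s t D (P : unit -> nat -> Prop) L,
  @cstate (typing_sys K) D (fun _ _ => True) s -> wEv s t ->
  (forall y, fv_e y t -> L y \/ P tt y) -> @code (typing_sys K) D P L tt t.
Proof.
  intros s t D P L Hs Ht HF.
  apply (@code_coind (typing_sys K) (fun D P L c t => exists s, @cstate (typing_sys K) D (fun _ _ => True) s /\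
    wEv s t /\ (forall y, fv_e y t -> L y \/ P tt y))); [|eauto].
  clear s t D P L Hs Ht HF. intros D P L c t (s & Hs & Ht & HF).
  destruct (wEv_unfold _ _ Ht) as [[-> _]|[(n & -> & _)|(x & r & a & br & J & a' & br' & -> & H & Ha & Hb)]].
  - now left.
  - right; left; eauto.
  - right; right. do 2 eexists; split; [reflexivity|]. split; [exact I|].
    destruct (cstate_reach _ (typing_sys_laws K) _ _ _ _ H Hs) as [[[] E] HJ]. simpl in E, HJ.
    destruct (code_unfold _ _ _ _ _ E) as [F|[(n & F)|(h & br1 & F & _ & Hh & Hbr)]];
      inversion F; subst br1 h; clear F.
    destruct Hh as [(y & r' & a1 & F & Hy & Hr & Ha1)|[(p & r' & a1 & d & u & F & _)|
      (p & r' & a1 & u & F & _)]]; inversion F; subst y r' a1; clear F.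
    split.
    + left. do 3 eexists; split; [reflexivity|]. split.
      { destruct c. apply HF. constructor. }
      split; auto. intros i Hi. destruct (Ha1 i Hi) as (b & Eb & Hcb).
      specialize (Ha i ltac:(lia)). rewrite Eb in Ha. destruct (a' i) as [tys b'] eqn:Ea'.
      destruct Ha as [<- Ha]. exists b'; split; auto. left. exists (b, []). repeat split; auto.
      * exists tt. simpl. eapply (@code_perm (typing_sys K)); [| |exact Hcb]; auto.
      * intros y Hyf. destruct (Nat.lt_ge_cases y (length (argtys (nth i (argtys (D x)) N)))) as [Hl|Hl].
        -- left; now left.
        -- destruct (HF (y - length (argtys (nth i (argtys (D x)) N)))) as [H1|H1].
           ++ apply fv_arg with (i := i); [lia|]. rewrite Ea'. constructor.
              now rewrite Nat.sub_add by lia.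
           ++ left; now right.
           ++ right; now split.
    + intro i. left. exists (br i, J). repeat split; auto.
      * exists tt; apply Hbr.
      * intros y Hyf. apply HF. eapply fv_br; eauto.
Qed.

(** This brings the procedures of a closing substitution, which are only known to be well typed,
    into the coloured setting. *)
Lemma wt_code (S : sys) (d : col S) (Hd : uniform d) : forall G r t D P L,
  wt_p G r t -> (forall y u, nth_error G y = Some u -> D y = u) ->
  (forall y, fv_p y r -> L y \/ P (kind d) y) -> cproc D P L d r t.
Proof.
  destruct Hd as (Hd1 & Hd2 & Hd3).
  assert (HE : forall D P L c e, (c = d /\ exists G, wt_e G e /\
     (forall y u, nth_error G y = Some u -> D y = u) /\
     (forall y, fv_e y e -> L y \/ P (kind d) y)) -> @code S D P L c e).
  2:{ intros G r t D P L H HD HF. destruct H as [G t b H]. exists b; split; auto.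
      apply HE. split; auto. eexists; split; [exact H|]. split.
      - intros y u Hu. destruct (Nat.lt_ge_cases y (length (argtys t))) as [Hl|Hl].
        + rewrite nth_error_app1 in Hu by (rewrite length_rev; lia).
          rewrite updel_lt by lia. apply nth_error_nth with (d := N) in Hu.
          rewrite rev_nth in Hu by lia. rewrite <- Hu. f_equal; lia.
        + rewrite nth_error_app2 in Hu by (rewrite length_rev; lia).
          rewrite length_rev in Hu. rewrite updel_ge by lia. auto.
      - intros y Hy. destruct (Nat.lt_ge_cases y (length (argtys t))) as [Hl|Hl].
        + left; now left.
        + destruct (HF (y - length (argtys t))) as [H1|H1].
          * constructor. now rewrite Nat.sub_add by lia.
          * left; now right.
          * right; now split. }
  apply code_coind. intros D P L c e (-> & G & H & HD & HF).
  destruct H as [G | G n | G x s r a br Hx Hr Ha Hb].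
  - now left.
  - right; left; eauto.
  - right; right. do 2 eexists; split; [reflexivity|]. split; auto. split.
    + left. do 3 eexists; split; [reflexivity|]. split; [apply HF; constructor|].
      rewrite (HD _ _ Hx). split; auto. intros i Hi. rewrite Hd2. specialize (Ha i Hi).
      destruct (a i) as [tys b] eqn:Ea. inversion Ha; subst. exists b; split; auto.
      left. split; auto. eexists; split; [eassumption|]. split.
      * intros y u Hu. destruct (Nat.lt_ge_cases y (length (argtys (nth i (argtys s) N)))) as [Hl|Hl].
        -- rewrite nth_error_app1 in Hu by (rewrite length_rev; lia).
           rewrite updel_lt by lia. apply nth_error_nth with (d := N) in Hu.
           rewrite rev_nth in Hu by lia. rewrite <- Hu. f_equal; lia.
        -- rewrite nth_error_app2 in Hu by (rewrite length_rev; lia).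
           rewrite length_rev in Hu. rewrite updel_ge by lia. auto.
      * intros y Hy. destruct (Nat.lt_ge_cases y (length (argtys (nth i (argtys s) N)))) as [Hl|Hl].
        -- left; now left.
        -- destruct (HF (y - length (argtys (nth i (argtys s) N)))) as [H1|H1].
           ++ eapply fv_arg; [exact Hi|]. rewrite Ea. constructor.
              now rewrite Nat.sub_add by lia.
           ++ left; now right.
           ++ right; now split.
    + intro i. rewrite Hd3. left. split; auto. exists G. repeat split; auto.
      intros y Hy. apply HF. eapply fv_br; eauto.
Qed.

(** ** Substitutions that agree on the free variables *)

Lemma upsub_agree n sg sg' (F : nat -> Prop) :
  (forall y, F y -> item_bis (sg y) (sg' y)) ->
  forall y, (n <= y -> F (y - n)) -> item_bis (upsub n sg y) (upsub n sg' y).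
Proof.
  intros H y Hy. destruct (Nat.lt_ge_cases y n).
  - rewrite !upsub_lt by lia. apply item_bis_refl.
  - rewrite !upsub_ge by lia. apply iren_bis; auto.
Qed.

(** [wEv s e] provides that all meaningful heads of [e] are variables, as [fv_e] presupposes;
    cleaning removes the arguments that [fv_e] ignores. *)
Lemma sub_clean_fvn n : forall s e sg sg', wEv s e ->
  (forall y, fv_e y e -> item_bis (sg y) (sg' y)) ->
  bisn n (sub_e sg (clean_e e)) (sub_e sg' (clean_e e)).
Proof.
  induction n as [|n IH]; [easy|]. intros s e sg sg' He H.
  destruct (wEv_unfold _ _ He) as [[-> _]|[(m & -> & _)|(x & r & a & br & J & a' & br' & -> & _ & Ha & Hb)]];
    autorewrite with mterm; simpl; auto.
  split; [|intro i; eapply IH; [apply Hb|]; intros; apply H; eapply fv_br; eauto].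
  assert (HA : forall i, lam_rel (bisn n) (sub_p sg (clean_args r a' i)) (sub_p sg' (clean_args r a' i))).
  { intro i. unfold clean_args. destruct (Nat.ltb_spec i r) as [Hi|Hi].
    - specialize (Ha i Hi). destruct (a' i) as [tys b'] eqn:Ea, (a i) as [tys' b]. destruct Ha as [-> Ha].
      autorewrite with mterm. split; auto. eapply IH; [exact Ha|].
      intros y Hy. apply (upsub_agree _ _ _ (fun y => fv_p y (a' i))).
      + intros z Hz. apply H. eapply fv_arg; eauto.
      + intro Hl. rewrite Ea. constructor. now rewrite Nat.sub_add by lia.
    - autorewrite with mterm. split; auto using bisn_refl. }
  pose proof (H x (fv_head _ _ _ _) n) as Hx.
  destruct (sg x), (sg' x); simpl in *; try easy; repeat split; auto.
Qed.

(** ** The observational order on tests *)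

Lemma wt_num_test k X : test k X -> forall G, wt_p G X (pure k).
Proof.
  induction 1; intro G.
  - apply (wt_lam G N). constructor.
  - apply wt_lam. constructor.
  - apply (wt_lam G (pure (S k))). constructor.
  - apply (wt_lam G (pure (S j))). simpl rev. simpl app at 1.
    apply wt_case with (s := pure j); auto.
    + intros i Hi. destruct j; simpl in Hi; [lia|].
      assert (i = 0) by lia; subst. apply IHtest.
    + intro i. destruct (i =? n); constructor.
Qed.

(** Turns a pair of tests into one of the closed observers over which [obs_le] quantifies. *)
Definition apply_test (k : nat) (X V : mproc) : mproc :=
  MLam [Arr (pure k) (pure k)] (MCase (HVar 0 2 (two X V)) (fun i => MNum i)).

Lemma wt_apply_test j X V : test (S j) X -> test j V ->
  wt_p [] (apply_test (S j) X V) (Arr (Arr (pure (S j)) (pure (S j))) N).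
Proof.
  intros HX HV. apply (wt_lam [] (Arr (Arr (pure (S j)) (pure (S j))) N)).
  simpl rev. simpl app. apply wt_case with (s := Arr (pure (S j)) (pure (S j))); auto.
  - intros [|[|i]] Hi; simpl in Hi; [| |lia].
    + apply (wt_num_test (S j)); auto.
    + apply (wt_num_test j); auto.
  - intro; constructor.
Qed.

Lemma eval_num_iff e n : eval_e e = MNum n <-> num_of (e, []) n.
Proof.
  split.
  - intro H. pose proof (Ev_eval (e, [])) as HE. simpl in HE. rewrite H in HE.
    destruct (Ev_unfold _ _ HE) as [[F _]|[(m & F & Hm)|(x & r & a & br & J & a' & br' & F & _)]];
      try discriminate. now inversion F; subst.
  - apply (eval_num (e, [])).
Qed.

Lemma num_of_frame e k n : (forall i, k i = MNum i) -> num_of (e, [k]) n <-> num_of (e, []) n.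
Proof.
  intro Hk. split.
  - intros [m H]. apply (run_stack_num _ _ [] [k]) in H as (m' & i & _ & H1 & H2).
    destruct (run_first _ _ _ _ H2 eq_refl eq_refl) as (m2 & _ & H3).
    rewrite Hk in H3. inversion H3; subst; [|discriminate]. eexists; eauto.
  - intro H. eapply reach_trans; [apply (reach_app _ _ _ _ [k] H)|]. simpl.
    eapply reach_step; [reflexivity|]. rewrite Hk. apply reach_refl.
Qed.

Lemma val_apply_test k X V t1 t2 b n :
  (forall sg, sub_p sg X = X) -> (forall sg, sub_p sg V = V) ->
  val (Defs.app (apply_test k X V) (MLam [t1; t2] b)) = Some n <->
  num_of (sub_e (beta_sub 2 (two X V)) b, []) n.
Proof.
  intros HX HV. unfold Defs.app, apply_test. simpl length.
  set (E := sub_e _ _).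
  assert (HE : val (MLam [] (eval_e E)) = Some n <-> eval_e E = MNum n).
  { destruct (eval_e E) as [|m|]; simpl; split; intro H; try discriminate; congruence. }
  rewrite HE, eval_num_iff. unfold E. clear HE E. autorewrite with mterm.
  change (app_sub 0 (MLam [t1; t2] b) 0) with (STerm (ren_p (fun j => j + 0) (MLam [t1; t2] b))).
  cbv iota beta. rewrite ren_lamE.
  assert (HT : forall P Q : state, mstep P = Some Q -> (num_of P n <-> num_of Q n)).
  { intros P Q HPQ; split; [now apply num_of_pull | now apply num_of_push]. }
  rewrite HT; [|reflexivity]. rewrite num_of_frame by (intro; now autorewrite with mterm).
  assert (HB : bis_st (sub_e (beta_sub (length [t1; t2])
      (fun i => sub_p (app_sub 0 (MLam [t1; t2] b)) (two X V i)))
      (ren_e (upren (length [t1; t2]) (fun j => j + 0)) b), [])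
      (sub_e (beta_sub 2 (two X V)) b, [])).
  { apply bis_st_nil. intro m. apply sub_renn. intro y. simpl length.
    destruct (Nat.lt_ge_cases y 2).
    - rewrite upren_lt, !beta_sub_lt by lia. destruct (2 - 1 - y); simpl;
        rewrite ?HX, ?HV; apply item_bis_refl.
    - rewrite upren_ge, !beta_sub_ge by lia. intro z; simpl; lia. }
  split; apply num_of_bis; auto using bis_st_sym.
Qed.

Lemma num_sub_eval sg e n : num_of (sub_e sg (eval_e e), []) n <-> num_of (sub_e sg e, []) n.
Proof.
  assert (H : sameval (sub_e sg (eval_e e), []) (sub_e sg e, [])).
  { apply sameval_sub; [|intro y; destruct (sg y); simpl; auto using samep_refl].
    apply sameval_sym, Pev_sameval, Ev_Pev. apply (Ev_eval (e, [])). }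
  split; apply sameval_num; auto using sameval_sym.
Qed.

Lemma obs_le_eta_tests j b0 : 
  obs_le (Arr (pure (S j)) (pure (S j)))
      (eval_p (lam1 (pure (S j)) (eta (pure (S j)) 0)))
      (eval_p (lam1 (pure (S j)) (MLam [pure j] b0))) ->
  dominates (S j) b0.
Proof.
  intros H X V n HX HV Hn. specialize (H _ (wt_apply_test j X V HX HV) n).
  rewrite etaE in H. cbv zeta in H. simpl lam1 in H. rewrite !eval_lamE in H.
  rewrite !val_apply_test in H by (intro; eauto using test_sub).
  rewrite !num_sub_eval in H. apply H.
  replace (MCase _ _) with (eta_body j); [exact Hn|]. unfold eta_body. do 2 f_equal.
  extensionality i. now destruct i.
Qed.

(** * Codes with a well-founded skeleton *)

(** Inductive where [mexp] is coinductive: code that follows a shape is well-founded, in spite of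
    its infinite branching. *)
Inductive sk : Type :=
| SkLeaf : sk
| SkNode : (nat -> sk) -> (nat -> sk) -> sk.

Inductive sle (q : sk) : sk -> Prop :=
| sle_refl : sle q q
| sle_arg a b i : sle q (a i) -> sle q (SkNode a b)
| sle_br a b i : sle q (b i) -> sle q (SkNode a b).

Lemma sle_trans q r s : sle q r -> sle r s -> sle q s.
Proof. intros H H'; induction H'; eauto using sle. Qed.

(** Tailored to a spine: it meets a node anywhere inside [b] and descends into one of the arguments
    of that node. *)
Lemma sk_ind_strong (Q : sk -> Prop) :
  (forall b, (forall ar brs i, sle (SkNode ar brs) b -> Q (ar i)) -> Q b) -> forall b, Q b.
Proof.
  intros H b. assert (HH : forall q, sle q b -> Q q); [|apply HH; constructor].
  induction b as [|a IHa br IHb]; intros q Hq.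
  - inversion Hq; subst. apply H. intros ar brs i H1; inversion H1.
  - inversion Hq; subst; eauto. apply H. intros ar brs i H1. inversion H1; subst.
    + apply (IHa i). constructor.
    + apply (IHa i0). eapply sle_trans; [|eassumption]. eapply sle_arg; constructor.
    + apply (IHb i0). eapply sle_trans; [|eassumption]. eapply sle_arg; constructor.
Qed.

Inductive spine_col : Type := CO | CR (q : sk) | CD.
Inductive spine_knd : Type := KO | KR | KD.

Definition spine_kind (c : spine_col) : spine_knd := match c with CO => KO | CR _ => KR | CD => KD end.
Definition spine_carg (c : spine_col) (i : nat) : spine_col :=
  match c with CR (SkNode a _) => CR (a i) | _ => c end.
Definition spine_cbr (c : spine_col) (i : nat) : spine_col :=
  match c with CR (SkNode _ b) => CR (b i) | _ => c end.
Definition spine_valid (b : sk) (c : spine_col) : Prop := match c with CR q => sle q b | _ => True end.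
(** The bound [S k] for [KD] is there for the functional argument of [DY s], whose type [Arr s s]
    has level up to [S k]; that argument is part of the [CR] code which called the constant. *)
Definition spine_call (k : nat) (b : sk) (c : spine_knd) (d : spine_col) (t : ty) : Prop :=
  match c with
  | KO => d = CO \/ (spine_valid b d /\ lv t < k)
  | KR => spine_valid b d /\ lv t <= k
  | KD => spine_valid b d /\ (lv t <= k \/ (lv t <= S k /\ exists q, d = CR q))
  end.

(* [CR q]: code of shape [q], a part of the code [b]; [CO]: code that uses the distinguished
   variables only through closures of level below [k]; [CD]: the code of the constants [DY s]. *)
Definition spine_sys (k : nat) (b : sk) (hasO : Prop) : sys.
Proof.
  refine (Sys spine_col spine_knd spine_kind
    (* [hasO] switches [CO] off for the initial code, where no spine variable exists yet. A case
       node of colour [CR q] needs a proper node; [SkLeaf] is left for [MBot] and numerals. *)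
    (fun c => match c with CO => hasO | CR q => sle q b /\ q <> SkLeaf | CD => True end)
    spine_carg spine_cbr (spine_call k b) (fun c => c <> CD) k _ _).
  - intros [|[|]|] i; reflexivity.
  - intros [|[|]|] i; reflexivity.
Defined.

Definition spine_const (c : spine_col) : spine_col := match c with CR _ => CD | _ => c end.

Lemma valid6_carg b c i : spine_valid b c -> spine_valid b (spine_carg c i).
Proof.
  destruct c as [|[|]|]; simpl; auto. intro H. eapply sle_trans; [|exact H].
  eapply sle_arg; constructor.
Qed.

Lemma spine_sys_laws k b hasO : sys_laws (spine_sys k b hasO) spine_const.
Proof.
  split.
  - intros c d t i Hc H Hi. pose proof (lv_nth _ _ Hi) as Hl. simpl in *.
    assert (Hv : spine_valid b (spine_carg c i)).
    { apply valid6_carg. destruct c; simpl in *; tauto. }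
    destruct c as [|q|]; simpl in H.
    + destruct H as [->|[Hd Ht]]; [now left|]. simpl spine_carg.
      destruct d; simpl; [now left | split; auto; lia | split; auto; left; lia].
    + destruct H as [Hd Ht]. destruct d; simpl; [right; split; auto; lia| split; auto; lia|].
      split; auto; left; lia.
    + destruct H as [Hd [Ht|[Ht [q ->]]]].
      * destruct d; simpl; [right; split; auto; lia| split; auto; lia| split; auto; left; lia].
      * simpl; split; auto; lia.
  - intros c s Hc Hk Hs. split.
    + destruct c; simpl in *; [now repeat split | now repeat split | easy].
    + intros i Hi.
      assert (Hl : lv (nth i (argtys (Arr (Arr s s) s)) N) <= S k).
      { destruct i as [|i]; simpl; [simpl in Hs; lia|].
        assert (i < length (argtys s)) by (simpl in Hi; lia).
        pose proof (lv_nth _ _ H). simpl in Hs. lia. }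
      destruct c as [|q|]; [now left | | easy]. simpl spine_const. simpl kind.
      assert (Hv : spine_valid b (spine_carg (CR q) i)) by (apply valid6_carg; apply Hc).
      split; auto. right. split; auto. destruct q; simpl; eauto.
Qed.

Definition spine_perm (xb : nat -> Prop) (c : spine_knd) (y : nat) : Prop :=
  match c with KO => ~ xb y | KR => True | KD => False end.

Definition ext (Om : list ty) (D : nat -> ty) (i : nat) : ty :=
  if i <? length Om then nth i Om N else D (i - length Om).

Lemma ext_nil D : ext [] D = D.
Proof. extensionality i. unfold ext; simpl. f_equal; lia. Qed.

Lemma ext_updel Om tys D : ext Om (updel tys D) = ext (Om ++ rev tys) D.
Proof.
  extensionality i. unfold ext, updel. rewrite length_app, length_rev.
  destruct (Nat.ltb_spec i (length Om)).
  - rewrite (proj2 (Nat.ltb_lt _ _)) by lia. now rewrite app_nth1.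
  - destruct (Nat.ltb_spec (i - length Om) (length tys)).
    + rewrite (proj2 (Nat.ltb_lt _ _)) by lia. rewrite app_nth2 by lia.
      rewrite rev_nth by lia. f_equal; lia.
    + rewrite (proj2 (Nat.ltb_ge _ _)) by lia. f_equal; lia.
Qed.

(** ** Subexpressions of the evaluation tree of a coded state *)

(** Variables bound on the path turn into global ones, open to the kinds [KO] and [KR] and not
    distinguished. [KD] gets none, and needs none because a node with a global variable at its head
    never has that kind. *)
Lemma subexp_coded k b hasO t e' Om : subexp t e' Om -> forall s D xb,
  @cstate (spine_sys k b hasO) D (spine_perm xb) s -> wEv s t ->
  exists s' xb', @cstate (spine_sys k b hasO) (ext Om D) (spine_perm xb') s' /\ wEv s' e' /\
    forall y, xb y -> xb' (y + length Om).
Proof.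
  set (S := spine_sys k b hasO).
  induction 1 as [e | x r a br i e' Om H IH | x r a br i tys b0 e' Om Hi Ha H IH]; intros s D xb Hs Ht.
  - exists s, xb. rewrite ext_nil. repeat split; auto; try apply Hs.
    intros y; simpl. now rewrite Nat.add_0_r.
  - destruct (wEv_unfold _ _ Ht) as [[F _]|[(n & F & _)|(x1 & r1 & a1 & br1 & J & a' & br' & F & Hv & Ha & Hb)]];
      inversion F; subst x1 r1 a' br'; clear F.
    destruct (cstate_reach _ (spine_sys_laws k b hasO) _ _ _ _ Hv Hs) as [[c E] HJ]. simpl in E, HJ.
    destruct (code_unfold _ _ _ _ _ E) as [F|[(n & F)|(h & br2 & F & _ & Hh & Hbr)]];
      inversion F; subst br2; clear F.
    apply (IH (br1 i, J) D xb); auto. split; simpl; eauto.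
  - destruct (wEv_unfold _ _ Ht) as [[F _]|[(n & F & _)|(x1 & r1 & a1 & br1 & J & a' & br' & F & Hv & Ha1 & Hb)]];
      inversion F; subst x1 r1 a' br'; clear F.
    destruct (cstate_reach _ (spine_sys_laws k b hasO) _ _ _ _ Hv Hs) as [[c E] HJ]. simpl in E, HJ.
    destruct (code_unfold _ _ _ _ _ E) as [F|[(n & F)|(h & br2 & F & _ & Hh & Hbr)]];
      inversion F; subst br2 h; clear F.
    destruct Hh as [(y & r' & a2 & F & Hy & Hr & Hc)|[(p & r' & a2 & d & u & F & _)|
      (p & r' & a2 & u & F & _)]]; inversion F; subst y r' a2; clear F.
    destruct (Hc i ltac:(lia)) as (b1 & Eb & Hcb).
    specialize (Ha1 i Hi). rewrite Eb, Ha in Ha1. destruct Ha1 as [<- Hev].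
    set (tys := argtys (nth i (argtys (D x)) N)) in *.
    (* The head is a global variable, which [KD] may not use, and arguments keep the kind of their
       node. *)
    assert (Hk : spine_kind (spine_carg c i) <> KD).
    { change (kind (s := S) (carg (s := S) c i) <> KD). rewrite kind_carg.
      intro E'. destruct Hy as [[]|Hy]. simpl in Hy, E'. rewrite E' in Hy. exact Hy. }
    destruct (IH (b1, []) (updel tys D) (fun y => length tys <= y /\ xb (y - length tys)))
      as (s' & xb' & Hs' & Hev' & Hxb'); auto.
    + split; simpl; auto. exists (spine_carg c i).
      eapply (@code_perm S); [| |exact Hcb].
      * intros κ y [Hy1 Hy2]. destruct κ; simpl in *; auto. intros [_ Hx]; auto.
      * intros y [Hy1|[]]. right. simpl. destruct (spine_kind (spine_carg c i)); simpl; [|exact I|easy].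
        intros [Hx _]; lia.
    + exists s', xb'. rewrite <- ext_updel. split; auto. split; auto.
      intros y Hxy. rewrite length_app, length_rev.
      replace (y + (length Om + length tys)) with (y + length tys + length Om) by lia.
      apply Hxb'. split; [lia|]. now replace (y + length tys - length tys) with y by lia.
Qed.

(** ** A spine node in code that avoids its variable *)

Scheme fv_e_mind := Minimality for fv_e Sort Prop
  with fv_p_mind := Minimality for fv_p Sort Prop.
Combined Scheme fv_mind from fv_e_mind, fv_p_mind.

Lemma wt_fv : (forall y e, fv_e y e -> forall G, wt_e G e -> y < length G) /\
  (forall y p, fv_p y p -> forall G t, wt_p G p t -> y < length G).
Proof.
  apply fv_mind.
  - intros x r a br G H; inversion H; subst. apply nth_error_Some. congruence.
  - intros j x r a br i Hi _ IH G H; inversion H; subst. eapply IH; eauto.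
  - intros j x r a br i _ IH G H; inversion H; subst. eapply IH; eauto.
  - intros j tys b _ IH G t H. inversion H as [G' s' b' Hb E1 E2 E3]; subst. apply IH in Hb.
    rewrite length_app, length_rev in Hb. lia.
Qed.

Lemma retract_sys_uniform K k (d : col (retract_sys K k)) : uniform d.
Proof. now repeat split. Qed.

(** Forgets everything but whether code is [CO]. Such code becomes [true]: what it calls of any
    other colour has level below [k], exactly as [not_dominates] wants. *)
Lemma spine_sys_to_retract_sys k b hasO : recolouring (spine_sys k b hasO) (retract_sys k k)
  (fun c c' => c' = false \/ (c = CO /\ c' = true)).
Proof.
  split; auto. intros c c' Hc _. simpl. repeat split; auto.
  - intros i. destruct Hc as [->|[-> ->]]; auto.
  - intros i. destruct Hc as [->|[-> ->]]; auto.
  - intros d t H. destruct Hc as [->|[-> ->]]; [exists false; auto|].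
    destruct H as [->|[Hd Ht]]; [exists true; auto|]. exists false; intuition.
Qed.

Lemma body_coded_typing j K D o bo sg X V : test (S j) X -> test j V ->
  o = MLam [pure j] bo ->
  @cproc (typing_sys K) D (fun _ y => fv_p y o) noloc tt o (pure (S j)) ->
  (forall y, fv_p y o -> @okitem (typing_sys K) (fun _ => pure (S j)) (fun _ _ => True) noloc tt (D y) (sg y)) ->
  @cstate (typing_sys K) (fun _ => pure (S j)) (fun _ _ => True)
    (sub_e (beta_sub 2 (two X V)) (sub_e (upsub 1 sg) bo), []).
Proof.
  intros HX HV -> Ho Hsg. split; simpl; auto. exists tt.
  apply (cproc_sub _ (fun _ => pure (S j)) _ (fun _ _ => True) _ noloc _ _ _ sg) in Ho;
    [|intros []; exact Hsg|intros y []].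
  destruct Ho as (b' & Eb' & Hb'). autorewrite with mterm in Eb'. simpl in Eb'.
  inversion Eb'; subst b'; clear Eb'.
  assert (HT : forall k Z, test k Z -> @cproc (typing_sys K) (fun _ => pure (S j)) (fun _ _ => True) noloc tt Z (pure k)).
  { intros k Z HZ. apply (wt_code (typing_sys K) tt) with (G := []); [now repeat split|now apply wt_num_test| |].
    - intros [|y] u Hu; discriminate.
    - auto. }
  eapply code_sub; [| |exact Hb'].
  - intros [] y [Hy _]. simpl in Hy. rewrite updel_ge by (simpl; lia).
    destruct (Nat.eq_dec y 1) as [->|Hy1].
    + rewrite beta_sub_lt by lia. right. exists X, tt. split; [reflexivity|]. split; [exact I | now apply HT].
    + rewrite beta_sub_ge by lia. left. eexists; split; [reflexivity|]. auto.
  - intros y [Hy|[]]. simpl in Hy. assert (y = 0) by lia; subst. right.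
    exists V, tt. split; [reflexivity|]. split; [exact I | now apply HT].
Qed.

Lemma fv_clean_both :
  (forall y e, fv_e y e -> forall e', bis (clean_e e) (clean_e e') -> fv_e y e') /\
  (forall y p, fv_p y p -> forall p', bisp (clean_p p) (clean_p p') -> fv_p y p').
Proof.
  apply fv_mind.
  - intros x r a br e' H. apply bis_clean_var_inv in H as (a' & br' & -> & _). constructor.
  - intros y x r a br i Hi _ IH e' H. apply bis_clean_var_inv in H as (a' & br' & -> & Ha & _).
    eapply fv_arg; eauto.
  - intros y x r a br i _ IH e' H. apply bis_clean_var_inv in H as (a' & br' & -> & _ & Hb).
    eapply fv_br; eauto.
  - intros y tys b _ IH [t' b'] H. autorewrite with mterm in H. apply bisp_lam in H as [<- H].
    constructor; auto.
Qed.

Lemma fv_clean y e e' : bis (clean_e e) (clean_e e') -> fv_e y e -> fv_e y e'.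
Proof. intros H H'. eapply fv_clean_both; eauto. Qed.

(** Under the closing substitution the code [a] gets colour [true]: it is barred from [x] itself and
    reaches the target only through closures of level below [k], so [not_dominates] applies. The
    second half of the proof moves the domination from the tree [o] back to the code [a]. *)
Lemma avoiding_node_absurd k b hasO D xb G x V a o sg :
  1 <= k ->
  @cproc (spine_sys k b hasO) D (spine_perm xb) noloc CO a (pure k) -> lam_st wEv a o -> xb x ->
  (forall y t, nth_error G y = Some t -> D y = t) -> nth_error G x = Some (pure k) ->
  xV_closed k G x V o sg ->
  obs_le (Arr (pure k) (pure k)) (eval_p (lam1 (pure k) (eta (pure k) 0)))
      (eval_p (lam1 (pure k) (sub_p sg o))) -> False.
Proof.
  intros Hk Ha Ho Hx HG Hgx [Hsgx Hsg] Hobs. destruct k as [|j]; [lia|]. clear Hk.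
  pose proof Ha as (ba & Eba & Hba). subst a. simpl argtys in *. destruct o as [to bo].
  destruct Ho as [<- Ho]. set (o := MLam [pure j] bo) in *.
  (* The code [a] may mention variables that its tree [o] has lost, and there [sg] is arbitrary;
     these are sent to undefined procedures. *)
  set (sg' := fun y => if excluded_middle_informative (fv_p y o) then sg y
                       else STerm (MLam (argtys (D y)) MBot)).
  assert (Hagree : forall y, fv_p y o -> sg' y = sg y).
  { intros y Hy. unfold sg'. destruct excluded_middle_informative; easy. }
  set (D0 := fun _ : nat => pure (S j)).
  assert (Hr : forall r t (d : bool), wt_p [pure (S j)] r t -> (d = true -> ~ fv_p 0 r) ->
     @cproc (retract_sys (S j) (S j)) D0 (fun (c : bool) y => c = false /\ y = 0) noloc d r t).
  { intros r t d Hw Hd. apply wt_code with (G := [pure (S j)]); auto using retract_sys_uniform.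
    - intros [|[|y]] u Hu; simpl in Hu; inversion Hu; auto.
    - intros y Hy. assert (y = 0) by (pose proof (proj2 wt_fv _ _ Hy _ _ Hw); simpl in *; lia).
      subst y. right. split; auto. destruct d; auto. exfalso; now apply Hd. }
  apply (cproc_recolour _ (retract_sys (S j) (S j)) _ _ _ (fun (c : bool) y => c = true -> y <> x)
           _ noloc _ true _ _ (spine_sys_to_retract_sys (S j) b hasO)) in Ha; auto.
  2:{ intros c c' y Hcc Hy. destruct Hcc as [->|[-> ->]]; [discriminate|].
      intros _ ->. now apply Hy. }
  apply (@cproc_sub (retract_sys (S j) (S j)) _ D0 _ (fun (c : bool) y => c = false /\ y = 0)
           _ noloc _ _ _ sg') in Ha;
    [|intros c y Hy|intros y []].
  2:{ unfold sg'. destruct (excluded_middle_informative (fv_p y o)) as [Hf|Hf].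
      - destruct (Nat.eq_dec y x) as [->|Hyx].
        + rewrite Hsgx. left. exists 0. rewrite (HG _ _ Hgx). repeat split; auto.
          right. split; auto. destruct c; auto. now specialize (Hy eq_refl).
        + destruct (Hsg _ Hyx Hf) as (r & t & -> & Ht & Hw & Hv). rewrite (HG _ _ Ht). right.
          destruct c.
          (* If [r] uses the target, closedness puts its type at level below [S j], and [true] may
             call it as a closure of colour [false]; if not, [r] itself can have colour [true]. *)
          * destruct (classic (fv_p 0 r)) as [Hf0|Hf0].
            -- exists r, false. split; auto. split; [|apply Hr; auto; discriminate].
               right; left. repeat split; auto. now apply Hv.
            -- exists r, true. split; auto. split; [now left | apply Hr; auto].
          * exists r, false. split; auto. split; [now left | apply Hr; auto; discriminate].
      - right. exists (MLam (argtys (D y)) MBot), c. split; auto. split; [now left|].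
        eexists; split; [reflexivity | apply code_bot]. }
  destruct Ha as (b1 & Eb1 & Hb1). autorewrite with mterm in Eb1. simpl in Eb1.
  inversion Eb1; subst b1; clear Eb1. simpl argtys in Hb1. simpl length in Hb1.
  eapply (not_dominates (S j) (S j) (updel [pure j] D0)).
  { split; reflexivity. }
  { eapply (@code_perm (retract_sys (S j) (S j))); [| |exact Hb1].
    - intros c y [H1 [H2 H3]]. right. split; auto; lia.
    - intros y [H1|[]]. right. left. split; auto; lia. }
  replace (sub_p sg o) with (MLam [pure j] (sub_e (upsub 1 sg) bo)) in Hobs
    by (unfold o; now autorewrite with mterm).
  apply obs_le_eta_tests in Hobs.
  intros X W n HX HW Hn. specialize (Hobs X W n HX HW Hn).
  assert (Hcoded : forall w, wEv (ba, []) w ->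
     @cproc (typing_sys (S j)) D (fun _ y => fv_p y (MLam [pure j] w)) noloc tt (MLam [pure j] w) (pure (S j))).
  { intros w Hw. exists w. split; auto. simpl argtys. simpl length.
    apply wEv_code with (s := (ba, [])); auto.
    - split; simpl; auto. exists tt.
      eapply (code_recolour _ (typing_sys (S j)) (fun _ _ => True)); [| | | |exact Hba]; auto.
      + apply (typing_sys_forget (spine_sys (S j) b hasO)).
      + now intros ? ? ? _ _.
    - intros y Hy. destruct y as [|y]; [left; left; lia|]. right. split; [lia|].
      constructor. simpl length. now rewrite Nat.sub_add by lia. }
  pose proof (Hcoded _ Ho) as Ho1. fold o in Ho1.
  assert (Hit : forall y, fv_p y o ->
     @okitem (typing_sys (S j)) D0 (fun _ _ => True) noloc tt (D y) (sg y)).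
  { intros y Hf. destruct (Nat.eq_dec y x) as [->|Hyx].
    - rewrite Hsgx. left. exists 0. rewrite (HG _ _ Hgx). repeat split; auto.
    - destruct (Hsg _ Hyx Hf) as (r & t & -> & Ht & Hw & Hv). rewrite (HG _ _ Ht). right.
      exists r, tt. split; [reflexivity|]. split; [exact I|]. apply wt_code with (G := [pure (S j)]); auto.
      + now repeat split.
      + intros [|[|z]] u Hu; simpl in Hu; inversion Hu; auto. }
  pose proof (body_coded_typing j (S j) D o bo sg X W HX HW eq_refl Ho1 Hit) as C1.
  pose proof (body_coded_typing j (S j) D o bo sg' X W HX HW eq_refl Ho1
    ltac:(intros y Hy; rewrite Hagree; auto)) as C2.
  apply (clean_num _ _ _ _ _ C1) in Hobs.
  assert (HC : forall s1 bo, bis (clean_e (sub_e (beta_sub 2 (two X W)) (sub_e (upsub 1 s1) bo)))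
     (sub_e (fun y => clean_item (beta_sub 2 (two X W) y))
        (sub_e (upsub 1 (fun y => clean_item (s1 y))) (clean_e bo)))).
  { intros s1 b1. eapply bis_trans; [intro m; apply clean_subn; intro; apply item_bis_refl|].
    apply sub_bis; [|intro; apply item_bis_refl]. intro m; apply clean_subn.
    apply clean_upsub; intro; apply item_bis_refl. }
  (* The two substitutions agree on the free variables of [o], but [fv_p] does not see the junk
     arguments; hence the passage through cleaned terms. *)
  assert (Hobs' : num_of (sub_e (beta_sub 2 (two X W)) (sub_e (upsub 1 sg') bo), []) n).
  { apply (clean_num _ _ _ _ _ C2). eapply num_of_bis; [|exact Hobs]. apply bis_st_nil.
    eapply bis_trans; [apply HC|]. eapply bis_trans; [|apply bis_sym, HC].
    apply sub_bis; [|intro; apply item_bis_refl]. intro m.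
    eapply sub_clean_fvn; [exact Ho|]. intros y Hy.
    apply (upsub_agree _ _ _ (fun y => fv_p y o)).
    - intros z Hz. rewrite Hagree by auto. apply item_bis_refl.
    - intro Hl. constructor. simpl length. now rewrite Nat.sub_add by lia. }
  (* [o] is only a weak tree of [ba]. The strong tree [u] agrees with [o] after cleaning, and can be
     exchanged for [ba] by [sameval_sub]. *)
  set (u := eval_e (unload (ba, []))). assert (Hu : Ev (ba, []) u) by apply Ev_eval.
  assert (Hou : bis (clean_e bo) (clean_e u)).
  { apply bis_sym. intro m. eapply Ev_wEv_cleann; eauto. }
  assert (Hu1 : @cproc (typing_sys (S j)) D (fun _ y => fv_p y (MLam [pure j] u)) noloc tt
                  (MLam [pure j] u) (pure (S j))).
  { apply Hcoded, Ev_wEv, Hu. }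
  assert (Hfv : forall y, fv_p y (MLam [pure j] u) -> fv_p y o).
  { intros y Hy. inversion Hy; subst. constructor. eapply fv_clean; [|exact H1].
    apply bis_sym, Hou. }
  pose proof (body_coded_typing j (S j) D _ u sg' X W HX HW eq_refl Hu1
    ltac:(intros y Hy; rewrite Hagree; auto)) as C3.
  apply (clean_num _ _ _ _ _ C2) in Hobs'.
  assert (Hobs2 : num_of (sub_e (beta_sub 2 (two X W)) (sub_e (upsub 1 sg') u), []) n).
  { apply (clean_num _ _ _ _ _ C3). eapply num_of_bis; [|exact Hobs']. apply bis_st_nil.
    eapply bis_trans; [apply HC|]. eapply bis_trans; [|apply bis_sym, HC].
    apply sub_bis; [|intro; apply item_bis_refl]. apply sub_bis; [|intro; apply item_bis_refl].
    exact Hou. }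
  eapply sameval_num; [|exact Hobs2].
  apply sameval_sub; [|intro y; destruct (beta_sub 2 (two X W) y); simpl; auto using samep_refl].
  apply sameval_sub; [|intro y; destruct (upsub 1 sg' y); simpl; auto using samep_refl].
  apply sameval_sym, Pev_sameval, Ev_Pev, Hu.
Qed.

(** ** No spine *)

Definition gty (k : nat) : ty := Arr (pure (S k)) (pure (S k)).

Lemma nth_error_ext Om t G D :
  (forall y u, nth_error G y = Some u -> D y = u) ->
  forall y u, nth_error (Om ++ t :: G) y = Some u -> ext Om (updel [t] D) y = u.
Proof.
  intros H y u Hu. unfold ext. destruct (Nat.ltb_spec y (length Om)).
  - rewrite nth_error_app1 in Hu by lia. now apply nth_error_nth with (d := N) in Hu.
  - rewrite nth_error_app2 in Hu by lia. destruct (y - length Om) as [|z]; simpl in Hu.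
    + inversion Hu; auto.
    + rewrite updel_ge by (simpl; lia). simpl. rewrite Nat.sub_0_r. auto.
Qed.

(** Used on entering the body of a spine node. Code outside the new shape [b1], whatever its colour,
    counts as [CO] from then on; parts of [b1] keep their colour, and everything they call as a
    closure may be regarded as [CO]. *)
Lemma spine_sys_restrict k b hasO b1 : recolouring (spine_sys k b hasO) (spine_sys k b1 True)
  (fun c c' => c' = CO \/ exists q, c = CR q /\ c' = CR q /\ sle q b1).
Proof.
  split; auto. intros c c' Hc Hok. destruct Hc as [->|(q & -> & -> & Hq)].
  - simpl. repeat split; auto; [discriminate|]. intros d t _. exists CO; auto.
  - simpl in *. destruct Hok as [_ Hn]. destruct q as [|ar brs]; [easy|].
    repeat split; auto.
    + intro i. right. eexists; repeat split. eapply sle_trans; [|exact Hq]. eapply sle_arg; constructor.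
    + intro i. right. eexists; repeat split. eapply sle_trans; [|exact Hq]. eapply sle_br; constructor.
    + intros d t [Hd Ht]. exists CO; repeat split; auto.
Qed.

(* In code of shape [q] the head of a spine is followed by a spine in code of a strictly
   smaller shape: only there can the argument [o] of the next node use the new variable. *)
Lemma coded_not_spinal k (Hk : 1 <= k) b : forall hasO D xb s G gi e x V,
  @cstate (spine_sys k b hasO) D (spine_perm xb) s -> wEv s e ->
  (forall y t, nth_error G y = Some t -> D y = t) -> nth_error G gi = Some (gty k) ->
  (hasO -> xb x) -> head_spinal k G gi e x V -> False.
Proof.
  induction b as [b IH] using sk_ind_strong.
  intros hasO D xb s G gi e x V Hs He HG Hgi Hx H.
  destruct H as [G gi e x V a br t body o Om e' sg Hgx _ -> Ha0 Ha1 Hsub HxV Hobs Hnext].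
  destruct (wEv_unfold _ _ He) as [[F _]|[(n & F & _)|(x1 & r1 & a0 & br0 & J & a' & br' & F & Hv & Ha & Hb)]];
    inversion F; subst x1 r1 a' br'; clear F.
  destruct (cstate_reach _ (spine_sys_laws k b hasO) _ _ _ _ Hv Hs) as [[c E] HJ]. simpl in E, HJ.
  destruct (code_unfold _ _ _ _ _ E) as [F|[(n & F)|(h & br2 & F & Hok & Hh & Hbr)]];
    inversion F; subst br2 h; clear F.
  destruct Hh as [(y & r' & a2 & F & Hy & Hr & Hc)|[(p & r' & a2 & d & u & F & _)|
    (p & r' & a2 & u & F & _)]]; inversion F; subst y r' a2; clear F.
  rewrite (HG _ _ Hgi) in Hc. destruct c as [|q|].
  (* Colour [CO] occurs only under [hasO], so [x] is distinguished and the code of [o] avoids it. *)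
  - simpl in Hok. specialize (Hc 1 ltac:(simpl; lia)). specialize (Ha 1 ltac:(lia)).
    eapply (avoiding_node_absurd k b hasO D xb G x V (a0 1) o sg); eauto.
    now rewrite <- Ha1.
  - simpl in Hok. destruct Hok as [Hq Hn]. destruct q as [|ar brs]; [easy|].
    destruct (Hc 0 ltac:(simpl; lia)) as (b0 & Eb0 & Hb0). simpl in Eb0, Hb0.
    specialize (Ha 0 ltac:(lia)). rewrite Ha0, Eb0 in Ha. destruct Ha as [Et Hev]. inversion Et; subst t.
    (* The system restarts with the shape [ar 0] of the body, and the newly bound variable, index 0,
       is the only distinguished one. Closures in the body cannot mention it, since it is local. *)
    assert (Hs' : @cstate (spine_sys k (ar 0) True) (updel [pure k] D) (spine_perm (fun y => y = 0)) (b0, [])).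
    { split; simpl; auto. exists (CR (ar 0)).
      eapply (code_recolour _ (spine_sys k (ar 0) True)); [apply spine_sys_restrict| | | |exact Hb0].
      - right. eexists; repeat split. constructor.
      - intros c c' y Hcc [Hy1 _]. destruct Hcc as [->|(q & -> & -> & _)]; simpl; auto; lia.
      - intros y _. right; exact I. }
    destruct (subexp_coded _ _ _ _ _ _ Hsub _ _ _ Hs' Hev) as (s' & xb' & Hc' & Hev' & Hxb').
    eapply (IH ar brs 0 Hq True _ xb' s'); [exact Hc' | exact Hev'| | | |exact Hnext].
    + now apply nth_error_ext.
    + rewrite nth_error_app2 by lia.
      replace (gi + length Om + 1 - length Om) with (S gi) by lia. exact Hgi.
    + intros _. now apply (Hxb' 0).
  (* The code of a constant mentions no global variable, so [g] cannot be its head. *)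
  - destruct Hy as [[]|[]].
Qed.

(** * Weak equality of evaluation trees *)

Definition wsame (s t : state) : Prop := exists u, wEv s u /\ wEv t u.
Definition wsamep (p q : mproc) : Prop := exists u, lam_st wEv p u /\ lam_st wEv q u.

Lemma wsame_sym s t : wsame s t -> wsame t s.
Proof. intros (u & H1 & H2); exists u; auto. Qed.
Lemma sameval_wsame s t : sameval s t -> wsame s t.
Proof. intros (u & H1 & H2); exists u; auto using Ev_wEv. Qed.

Lemma wEv_coind (X : state -> mexp -> Prop) :
  (forall s t, X s t -> wevF (fun s t => X s t \/ wEv s t) s t) -> forall s t, X s t -> wEv s t.
Proof.
  intros H s t Hs. exists (fun s t => X s t \/ wEv s t). split; auto.
  intros s' t' [H1|H1]; auto. eapply wevF_mono; [|apply wEv_unfold, H1]. auto.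
Qed.

Lemma wsame_num s t n : wsame s t -> num_of s n -> num_of t n.
Proof.
  intros (u & H1 & H2) H.
  destruct (wEv_unfold _ _ H1) as [[-> E]|[(m & -> & E)|(x1 & r1 & a1 & br1 & K1 & a1' & br1' & -> & E & Ea & Eb)]].
  - now apply (proj1 E) in H.
  - rewrite (num_of_inj _ _ _ H E).
    destruct (wEv_unfold _ _ H2) as [[F0 F]|[(m' & F0 & F)|(x2 & r2 & a2 & br2 & K2 & a2' & br2' & F0 & F & Fa & Fb)]];
      try discriminate. now inversion F0; subst.
  - exfalso; eapply num_var_absurd; eauto.
Qed.

Lemma wsame_var s t x r a br K : wsame s t -> var_of s x r a br K ->
  exists a' br' K', var_of t x r a' br' K' /\ (forall i, i < r -> wsamep (a i) (a' i)) /\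
    forall i, wsame (br i, K) (br' i, K').
Proof.
  intros (u & H1 & H2) H.
  destruct (wEv_unfold _ _ H1) as [[-> E]|[(m & -> & E)|(x1 & r1 & a1 & br1 & K1 & a1' & br1' & -> & E & Ea & Eb)]].
  - now apply (proj2 E) in H.
  - exfalso; eapply num_var_absurd; eauto.
  - destruct (var_of_inj _ _ _ _ _ _ _ _ _ _ _ H E) as (-> & -> & -> & -> & ->).
    destruct (wEv_unfold _ _ H2) as [[F0 F]|[(m' & F0 & F)|(x2 & r2 & a2 & br2 & K2 & a2' & br2' & F0 & F & Fa & Fb)]];
      try discriminate. inversion F0; subst.
    exists a2, br2, K2. repeat split; auto.
    + intros i Hi. exists (a2' i); auto.
    + intro i; exists (br2' i); auto.
Qed.

Lemma wsame_stuck s t : wsame s t -> stuck s -> stuck t.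
Proof.
  intros H [H1 H2]. apply wsame_sym in H. split.
  - intros n Hn. eapply H1, wsame_num; eauto.
  - intros x r a br K Hv. destruct (wsame_var _ _ _ _ _ _ _ H Hv) as (a' & br' & K' & Hv' & _).
    eapply H2; eauto.
Qed.

Lemma wsame_wEv s t u : wsame s t -> wEv s u -> wEv t u.
Proof.
  intros H1 H2. exists (fun t u => exists s, wsame s t /\ wEv s u). split; [|eauto].
  clear; intros t u (s & H1 & H2).
  destruct (wEv_unfold _ _ H2) as [[-> E]|[(m & -> & E)|(x & r & a & br & K & a' & br' & -> & E & Ea & Eb)]].
  - left; split; auto. eapply wsame_stuck; eauto.
  - right; left; exists m; split; auto. eapply wsame_num; eauto.
  - right; right. destruct (wsame_var _ _ _ _ _ _ _ H1 E) as (a1 & br1 & K1 & Hv & Ha & Hb).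
    exists x, r, a1, br1, K1, a', br'. repeat split; eauto.
    intros i Hi. destruct (Ha i Hi) as ([tw bw] & W1 & W2). specialize (Ea i Hi).
    destruct (a i), (a1 i), (a' i); simpl in *. destruct W1 as [-> W1], W2 as [-> W2], Ea as [<- Ea].
    split; auto. exists (m, []). split; auto. exists bw; auto.
Qed.

Lemma wsame_trans a b c : wsame a b -> wsame b c -> wsame a c.
Proof. intros (u & H1 & H2) H3. exists u; split; auto. eapply wsame_wEv; eauto. Qed.

Lemma wsamep_lam t b t' b' :
  wsamep (MLam t b) (MLam t' b') <-> t = t' /\ wsame (b, []) (b', []).
Proof.
  split.
  - intros ([t2 u] & [-> H1] & [-> H2]). split; auto. exists u; auto.
  - intros [<- (u & H1 & H2)]. exists (MLam t u). simpl; auto.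
Qed.
Lemma samep_wsamep p q : samep p q -> wsamep p q.
Proof.
  intros (u & H1 & H2); exists u; split; (eapply lam_st_mono; [apply Ev_wEv | assumption]).
Qed.
Lemma wsamep_sym p q : wsamep p q -> wsamep q p.
Proof. intros (u & H1 & H2); exists u; auto. Qed.
Lemma wsamep_trans p q r : wsamep p q -> wsamep q r -> wsamep p r.
Proof.
  destruct p, q, r. rewrite !wsamep_lam. intros [-> H1] [-> H2]. split; auto.
  eapply wsame_trans; eauto.
Qed.

(** ** Typed states that differ in meaningless arguments only *)

Lemma clean_var K D P s x r a br J : @cstate (typing_sys K) D P s -> var_of s x r a br J ->
  exists a' br' J', var_of (clean_st s) x r a' br' J' /\
    (forall i, bisp (a' i) (clean_args r a i)) /\
    forall i, bis_st (br' i, J') (clean_st (br i, J)).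
Proof.
  intros Hc [m H]. destruct (clean_run _ _ _ _ _ _ H Hc _ (bis_st_refl _)) as ([e J'] & H1 & H2 & H3).
  simpl in *. autorewrite with mterm in H2. apply bis_sym, bis_case_inv in H2 as (h & br' & -> & Hh & Hb).
  apply head_bis_var_inv in Hh as (a' & -> & Ha).
  exists a', br', J'. split; [eexists; eauto|]. split; [intro; apply bisp_sym, Ha|].
  intro i; split; simpl; auto using bis_sym.
Qed.

Lemma clean_var_back K D P s x r a' br' J' : @cstate (typing_sys K) D P s ->
  var_of (clean_st s) x r a' br' J' -> exists a br J, var_of s x r a br J.
Proof.
  intros Hc [m H].
  destruct (run_prefix_or_final (S m) s) as [[s' H1]|(m' & f & _ & H1 & Hf)].
  - destruct (clean_run _ _ _ _ _ _ H1 Hc _ (bis_st_refl _)) as (t & H2 & _).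
    destruct (run_final_split _ _ _ H eq_refl _ _ H2). lia.
  - destruct (clean_run _ _ _ _ _ _ H1 Hc _ (bis_st_refl _)) as ([e J] & H2 & H3 & H4).
    destruct (run_final_split _ _ _ H eq_refl _ _ H2) as [_ H5].
    destruct (final_cases _ Hf) as [[z ->]|[[K' ->]|(x1 & r1 & a & br & K' & ->)]];
      simpl in *; autorewrite with mterm in H3; apply bis_sym in H3.
    + apply bis_num_inv in H3; subst. inversion H4; subst. inversion H5; subst; discriminate.
    + apply bis_bot_inv in H3; subst. inversion H5; subst; discriminate.
    + apply bis_case_inv in H3 as (h' & br1 & -> & Hh & _).
      apply head_bis_var_inv in Hh as (a1 & -> & _). inversion H5; subst; [|discriminate].
      exists a, br, K'. eexists; eauto.
Qed.

Definition typed (K : nat) (D : nat -> ty) (s : state) : Prop :=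
  @cstate (typing_sys K) D (fun _ _ => True) s.

Lemma typed_var K D s x r a br J : typed K D s -> var_of s x r a br J ->
  r = length (argtys (D x)) /\
  (forall i, i < r -> @cproc (typing_sys K) D (fun _ _ => True) noloc tt (a i) (nth i (argtys (D x)) N)) /\
  forall i, typed K D (br i, J).
Proof.
  intros Hs Hv. destruct (cstate_reach _ (typing_sys_laws K) _ _ _ _ Hv Hs) as [[[] E] HJ]. simpl in E, HJ.
  destruct (code_unfold _ _ _ _ _ E) as [F|[(n & F)|(h & br1 & F & _ & Hh & Hbr)]];
    inversion F; subst br1 h; clear F.
  destruct Hh as [(y & r' & a1 & F & Hy & Ha)|[(p & r' & a1 & d & u & F & _)|
    (p & r' & a1 & u & F & _)]]; inversion F; subst y r' a1; clear F.
  destruct Ha as [-> Ha]. repeat split; simpl; auto. exists tt; apply Hbr.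
Qed.

Lemma typed_body K D p t b : @cproc (typing_sys K) D (fun _ _ => True) noloc tt p t ->
  p = MLam (argtys t) b -> typed K (updel (argtys t) D) (b, []).
Proof.
  intros (b' & -> & H) E. inversion E; subst. split; simpl; auto. exists tt.
  eapply (@code_perm (typing_sys K)); [| |exact H]; auto.
Qed.

(** Junk arguments never influence the run of a typed state, so the heads of [s] and [s'] can be
    matched through their cleaned states. *)
Lemma clean_wsame K s s' D D' : typed K D s -> typed K D' s' -> 
  bis_st (clean_st s) (clean_st s') -> wsame s s'.
Proof.
  intros H1 H2 H3. exists (eval_e (unload s)). split; [apply Ev_wEv, Ev_eval|].
  exists (fun s' t => exists s D D', typed K D s /\ typed K D' s' /\
    bis_st (clean_st s) (clean_st s') /\ wEv s t).
  split; [|exists s, D, D'; repeat split; auto; try apply H1; try apply H2; try apply H3; apply Ev_wEv, Ev_eval].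
  clear. intros s' t (s & D & D' & H1 & H2 & H3 & Ht).
  assert (Hvar : forall s s' D D', typed K D s -> typed K D' s' -> bis_st (clean_st s) (clean_st s') ->
    forall x r a br J, var_of s x r a br J -> exists a' br' J', var_of s' x r a' br' J' /\
      (forall i, i < r -> bisp (clean_p (a i)) (clean_p (a' i))) /\
      forall i, bis_st (clean_st (br i, J)) (clean_st (br' i, J'))).
  { clear. intros s s' D D' H1 H2 H3 x r a br J Hv.
    destruct (clean_var _ _ _ _ _ _ _ _ _ H1 Hv) as (a1 & br1 & J1 & Hv1 & Ha1 & Hb1).
    destruct (var_of_bis _ _ _ _ _ _ _ H3 Hv1) as (a2 & br2 & J2 & Hv2 & Ha2 & Hb2).
    destruct (clean_var_back _ _ _ _ _ _ _ _ _ H2 Hv2) as (a' & br' & J' & Hv').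
    destruct (clean_var _ _ _ _ _ _ _ _ _ H2 Hv') as (a3 & br3 & J3 & Hv3 & Ha3 & Hb3).
    destruct (var_of_inj _ _ _ _ _ _ _ _ _ _ _ Hv2 Hv3) as (_ & _ & -> & -> & ->).
    exists a', br', J'. split; auto. split.
    - intros i Hi. specialize (Ha1 i). specialize (Ha2 i). specialize (Ha3 i).
      unfold clean_args in Ha1, Ha3. rewrite (proj2 (Nat.ltb_lt _ _) Hi) in Ha1, Ha3.
      eapply bisp_trans; [apply bisp_sym, Ha1|]. eapply bisp_trans; [apply Ha2 | apply Ha3].
    - intro i. eapply bis_st_trans; [apply bis_st_sym, Hb1|].
      eapply bis_st_trans; [apply Hb2 | apply Hb3]. }
  assert (Hnum : forall s s' D D' n, typed K D s -> typed K D' s' -> bis_st (clean_st s) (clean_st s') ->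
    num_of s n -> num_of s' n).
  { clear. intros s s' D D' n H1 H2 H3 H. apply (clean_num _ _ _ _ _ H2).
    eapply num_of_bis; [exact H3|]. now apply (clean_num _ _ _ _ _ H1). }
  destruct (wEv_unfold _ _ Ht) as [[-> E]|[(m & -> & E)|(x & r & a & br & J & a' & br' & -> & E & Ea & Eb)]].
  - left; split; auto. apply bis_st_sym in H3. split.
    + intros n Hn. eapply (proj1 E), Hnum; eauto.
    + intros x r a br J Hv. destruct (Hvar _ _ _ _ H2 H1 H3 _ _ _ _ _ Hv) as (a' & br' & J' & Hv' & _).
      eapply (proj2 E); eauto.
  - right; left; eauto.
  - right; right. destruct (Hvar _ _ _ _ H1 H2 H3 _ _ _ _ _ E) as (a1 & br1 & J1 & Hv1 & Ha1 & Hb1).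
    destruct (typed_var _ _ _ _ _ _ _ _ H1 E) as (Hr & Ta & Tb).
    destruct (typed_var _ _ _ _ _ _ _ _ H2 Hv1) as (Hr' & Ta' & Tb').
    exists x, r, a1, br1, J1, a', br'. split; auto. split; auto. split.
    + intros i Hi. specialize (Ea i Hi). specialize (Ha1 i Hi).
      pose proof (Ta i Hi) as (b & Eb1 & _). pose proof (Ta' i Hi) as (b' & Eb1' & _).
      pose proof (typed_body _ _ _ _ _ (Ta i Hi) Eb1) as Tb1.
      pose proof (typed_body _ _ _ _ _ (Ta' i Hi) Eb1') as Tb1'.
      rewrite Eb1 in Ea, Ha1. rewrite Eb1' in *. destruct (a' i). destruct Ea as [<- Ea].
      autorewrite with mterm in Ha1. apply bisp_lam in Ha1 as [Et Ha1].
      split; auto. do 3 eexists. split; [exact Tb1|]. split; [exact Tb1'|]. split; auto.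
      now apply bis_st_nil.
    + intro i. exists (br i, J), D, D'. auto.
Qed.

(** * The eta law *)

Lemma hstep_eval e e' : hstep e e' -> eval_e e = eval_e e'.
Proof.
  intro H. rewrite (eval_eE e), (eval_eE e').
  assert (E : hnf_of e = hnf_of e'); [|now rewrite E].
  unfold hnf_of at 2. destruct excluded_middle_informative as [[w [H1 H2]]|E].
  - destruct constructive_indefinite_description as [w' [H3 H4]]; simpl.
    apply hnf_of_eq; auto. eapply rt_trans; [apply rt_step, H | exact H3].
  - unfold hnf_of. destruct excluded_middle_informative as [[w [H1 H2]]|E']; auto.
    exfalso. apply E. exists w; split; auto.
    apply hsteps_count in H1 as [n H1]. destruct (hstepsn_hnf_split _ _ _ H1 H2 _ H) as (m & -> & H3).
    clear - H3. induction H3; [apply rt_refl|]. eapply rt_trans; [apply rt_step|]; eauto.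
Qed.

Lemma sameval_hstep e e' : hstep e e' -> sameval (e, []) (e', []).
Proof.
  intro H. exists (eval_e e). split; [apply (Ev_eval (e, []))|].
  rewrite (hstep_eval _ _ H). apply (Ev_eval (e', [])).
Qed.

Lemma sameval_frame e K k : (forall i, k i = MNum i) -> sameval (e, K ++ [k]) (e, K).
Proof.
  intro Hk. exists (eval_e (unload (e, K))). split; [|apply Ev_eval].
  pose proof (Ev_eval (e, K)) as H. revert H. generalize (eval_e (unload (e, K))).
  intros u H. apply (Ev_coind (fun s u => exists e K, s = (e, K ++ [k]) /\ Ev (e, K) u)); [|eauto].
  clear e K u H. intros s u (e & K & -> & H).
  destruct (Ev_unfold _ _ H) as [[-> E]|[(m & -> & E)|(x & r & a & br & J & a' & br' & -> & E & Ea & Eb)]].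
  - left; split; auto. now apply stuck_app.
  - right; left; exists m; split; auto.
    eapply reach_trans; [apply (reach_app _ _ _ _ [k] E)|]. simpl.
    eapply reach_step; [reflexivity|]. rewrite Hk. apply reach_refl.
  - right; right. exists x, r, a, br, (J ++ [k]), a', br'. split; auto.
    split; [now apply reach_app|]. split; [intro i; eapply lam_st_mono; [|apply Ea]; auto|].
    intro i. left. exists (br i), J. auto.
Qed.

Definition etaexp (t : ty) (p : mproc) : mproc :=
  let n := length (argtys t) in
  MLam (argtys t) (MCase (HApp (ren_p (fun j => j + n) p) n
     (fun j => if j <? n then eta (nth j (argtys t) N) (n - 1 - j) else MLam [] MBot))
     (fun i => MNum i)).

Lemma ren_eta s : forall x rho, ren_p rho (eta s x) = eta s (rho x).
Proof.
  remember (tsize s) as n eqn:E. revert s E.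
  induction n as [n IH] using lt_wf_ind. intros s -> x rho.
  rewrite !etaE. cbv zeta. autorewrite with mterm.
  rewrite upren_ge by lia. replace (x + _ - _) with x by lia.
  do 2 f_equal; [f_equal|].
  - extensionality j. destruct (Nat.ltb_spec j (length (argtys s))).
    + erewrite IH; [|apply tsize_nth; eassumption|reflexivity]. f_equal. apply upren_lt; lia.
    + now autorewrite with mterm.
  - extensionality i. now autorewrite with mterm.
Qed.

(** The bound [M] ensures that the argument types of an expanded variable have size below [M], where
    the eta law may be assumed by induction. *)
Definition eta_sub (M : nat) (D : nat -> ty) (th : nat -> sitem) : Prop :=
  forall y, th y = SVar y \/ (th y = STerm (eta (D y) y) /\ tsize (D y) <= M).

Lemma eta_sub_up M D th tys : eta_sub M D th -> eta_sub M (updel tys D) (upsub (length tys) th).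
Proof.
  intros H y. destruct (Nat.lt_ge_cases y (length tys)).
  - left. now apply upsub_lt.
  - rewrite upsub_ge, updel_ge by lia. destruct (H (y - length tys)) as [->|[-> Ht]]; simpl.
    + left. f_equal; lia.
    + right. rewrite ren_eta. rewrite Nat.sub_add by lia. auto.
Qed.

Lemma sub_st_sameval sg s s1 : reach s s1 -> sameval (sub_st sg s) (sub_st sg s1).
Proof.
  intros [n H]. destruct (run_sub _ _ _ sg H _ (bis_st_refl _)) as (t & H1 & H2).
  eapply sameval_trans; [apply reach_sameval; eexists; eauto | now apply bis_st_sameval].
Qed.

(** An expanded head [x] reduces in one step to [x] applied to the eta-expansions of its arguments,
    and [IH] removes these at the smaller argument types. *)
Lemma eta_sub_wEv K M
  (IH : forall t p D, tsize t < M -> @cproc (typing_sys K) D (fun _ _ => True) noloc tt p t ->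
        wsamep (etaexp t p) p) D th s t :
  typed K D s -> eta_sub M D th -> wEv s t -> wEv (sub_st th s) t.
Proof.
  intros Hs Hth Ht.
  apply (wEv_coind (fun s t => exists s0 D th, wsame s (sub_st th s0) /\ typed K D s0 /\
    eta_sub M D th /\ wEv s0 t)).
  2:{ exists s, D, th. repeat split; auto; try apply Hs. apply sameval_wsame, sameval_refl. }
  clear D th s t Hs Hth Ht. intros s t (s0 & D & th & Hsame & Hs & Hth & Ht).
  destruct (wEv_unfold _ _ Ht) as [[-> E]|[(m & -> & E)|(x & r & a & br & J & a' & br' & -> & E & Ea & Eb)]].
  - left; split; auto. eapply wsame_stuck; [apply wsame_sym, Hsame|].
    eapply stuck_sub; [apply bis_st_refl | exact E].
  - right; left; exists m; split; auto. eapply wsame_num; [apply wsame_sym, Hsame|].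
    apply (num_of_sub _ _ th _ E). unfold sub_st; simpl; autorewrite with mterm. apply reach_refl.
  - right; right. destruct (typed_var _ _ _ _ _ _ _ _ Hs E) as (Hr & Ta & Tb).
    assert (H1 : wsame s (sub_st th (MCase (HVar x r a) br, J))).
    { eapply wsame_trans; [exact Hsame|]. apply sameval_wsame, sub_st_sameval, E. }
    assert (HA : exists a1 br1 J1, var_of (sub_st th (MCase (HVar x r a) br, J)) x r a1 br1 J1 /\
       (forall i, i < r -> wsamep (a1 i) (sub_p th (a i))) /\
       forall i, wsame (br1 i, J1) (sub_st th (br i, J))).
    { unfold sub_st; simpl. autorewrite with mterm. destruct (Hth x) as [->|[-> Hx]].
      - do 3 eexists. split; [apply reach_refl|]. split.
        + intros i Hi. apply samep_wsamep, samep_refl.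
        + intro i. apply sameval_wsame, sameval_refl.
      - rewrite etaE. cbv zeta. do 3 eexists. split.
        { eapply reach_step; [reflexivity|]. autorewrite with mterm.
          rewrite beta_sub_ge by lia. replace (x + _ - _) with x by lia. rewrite <- Hr.
          apply reach_refl. }
        split.
        + intros i Hi. rewrite (proj2 (Nat.ltb_lt _ _)) by lia.
          rewrite (sub_eta_term _ _ (sub_p th (a i))).
          2:{ rewrite beta_sub_lt by lia. do 3 f_equal. lia. }
          apply (IH _ _ D); [pose proof (tsize_nth (D x) i); lia|].
          eapply (@cproc_sub (typing_sys K)); [| |apply Ta; auto]; [|intros y []].
          intros [] y _. destruct (Hth y) as [->|[-> _]].
          * left; eauto.
          * right. exists (eta (D y) y), tt. split; auto. split; [exact I|].
            apply cproc_eta; auto. now repeat split.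
        + intro i. apply sameval_wsame, reach_sameval. autorewrite with mterm.
          eapply reach_step; [reflexivity|]. apply reach_refl. }
    destruct HA as (a1 & br1 & J1 & Hv1 & Ha1 & Hb1).
    destruct (wsame_var _ _ _ _ _ _ _ (wsame_sym _ _ H1) Hv1) as (a2 & br2 & J2 & Hv2 & Ha2 & Hb2).
    exists x, r, a2, br2, J2, a', br'. split; auto. split; auto. split.
    + intros i Hi. pose proof (wsamep_trans _ _ _ (wsamep_sym _ _ (Ha2 i Hi)) (Ha1 i Hi)) as W.
      specialize (Ea i Hi). pose proof (Ta i Hi) as (b & Eb1 & _).
      pose proof (typed_body _ _ _ _ _ (Ta i Hi) Eb1) as Tb1.
      rewrite Eb1 in Ea, W. autorewrite with mterm in W.
      destruct (a' i), (a2 i). destruct Ea as [<- Ea]. apply wsamep_lam in W as [-> W].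
      split; auto. left. exists (b, []). do 2 eexists. split; [exact W|]. split; [exact Tb1|].
      split; [now apply eta_sub_up | exact Ea].
    + intro i. left. exists (br i, J), D, th. split; auto.
      eapply wsame_trans; [apply wsame_sym, Hb2 | apply Hb1].
Qed.

(** Eta-expanding [p] amounts to replacing its bound variables by their eta-expansions, and these
    variables have smaller types than [t]. The equality is weak because expansions put a dummy in
    the places beyond the arity. *)
Lemma eta_law K M : forall t p D, tsize t < M ->
  @cproc (typing_sys K) D (fun _ _ => True) noloc tt p t -> wsamep (etaexp t p) p.
Proof.
  induction M as [|M IH]; [lia|]. intros t p D Ht Hp.
  pose proof Hp as (b & Eb & _). pose proof (typed_body _ _ _ _ _ Hp Eb) as Tb. subst p.
  unfold etaexp. cbv zeta. apply wsamep_lam; split; auto.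
  set (n := length (argtys t)) in *.
  set (th := fun y => if y <? n then STerm (eta (updel (argtys t) D y) y) else SVar y).
  apply wsame_trans with (sub_e th b, []).
  - apply sameval_wsame. autorewrite with mterm.
    eapply sameval_trans; [apply reach_sameval; eapply reach_step; [reflexivity | apply reach_refl]|].
    eapply sameval_trans; [apply (sameval_frame _ []); reflexivity|].
    apply bis_st_sameval, bis_st_nil. intro m; apply sub_renn. intro y. fold n. unfold th.
    destruct (Nat.ltb_spec y n).
    + rewrite upren_lt, beta_sub_lt by lia. rewrite (proj2 (Nat.ltb_lt _ _)) by lia.
      rewrite updel_lt by (unfold n in *; lia). fold n.
      replace (n - 1 - (n - 1 - y)) with y by lia. apply item_bis_refl.
    + rewrite upren_ge, beta_sub_ge by lia. intro z; simpl; lia.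
  - exists (eval_e (unload (b, []))). split; [|apply Ev_wEv, Ev_eval].
    apply (eta_sub_wEv K M IH (updel (argtys t) D) th (b, [])); auto.
    + intro y. unfold th. destruct (Nat.ltb_spec y n); [right|now left]. split; auto.
      rewrite updel_lt by auto. fold n. pose proof (tsize_nth t (n - 1 - y)). unfold n in *. lia.
    + apply Ev_wEv, Ev_eval.
Qed.

(** * Hereditary substitution *)

Lemma fun_choice (A : Type) (R : nat -> A -> Prop) :
  (forall i, exists x, R i x) -> exists f, forall i, R i (f i).
Proof.
  intro H. exists (fun i => proj1_sig (constructive_indefinite_description _ (H i))).
  intro i. exact (proj2_sig (constructive_indefinite_description _ (H i))).
Qed.

Definition same_head (h h' : mhead) : Prop :=
  match h, h' with
  | HVar x r a, HVar x' r' a' => x = x' /\ r = r' /\ forall i, samep (a i) (a' i)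
  | HApp p r a, HApp p' r' a' => samep p p' /\ r = r' /\ forall i, samep (a i) (a' i)
  | HExp e, HExp e' => sameval (e, []) (e', [])
  | _, _ => False
  end.

Lemma Pev_case h h' br br' : rhead Pev h h' -> (forall i, Pev (br i, []) (br' i)) ->
  Pev (MCase h br, []) (MCase h' br').
Proof.
  intros H1 H2. apply (Pev_coind (fun s t => s = (MCase h br, []) /\ t = MCase h' br')); auto.
  intros s t [-> ->]. right; right. exists h, h', br, br', []. repeat split; auto using reach_refl.
  eapply rhead_mono; [|exact H1]. auto.
Qed.

Lemma sameval_case h h' br br' : same_head h h' -> (forall i, sameval (br i, []) (br' i, [])) ->
  sameval (MCase h br, []) (MCase h' br', []).
Proof.
  intros Hh Hb. destruct (fun_choice _ _ Hb) as [bu Hbu].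
  assert (HU : exists hu, rhead Pev h hu /\ rhead Pev h' hu).
  { assert (HA : forall (a a' : nat -> mproc), (forall i, samep (a i) (a' i)) ->
      exists au, (forall i, lam_st Pev (a i) (au i)) /\ forall i, lam_st Pev (a' i) (au i)).
    { intros a a' Ha. destruct (fun_choice _ _ Ha) as [au Hau]. exists au.
      split; intro i; apply lam_Ev_Pev, Hau. }
    destruct h as [x r a | p r a | e], h' as [x' r' a' | p' r' a' | e']; try easy.
    - destruct Hh as (<- & <- & Ha). destruct (HA _ _ Ha) as (au & H1 & H2).
      exists (HVar x r au). repeat split; auto.
    - destruct Hh as (Hp & <- & Ha). destruct (HA _ _ Ha) as (au & H1 & H2).
      destruct Hp as (pu & P1 & P2). exists (HApp pu r au).
      repeat split; auto; now apply lam_Ev_Pev.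
    - destruct Hh as (eu & E1 & E2). exists (HExp eu). split; now apply Ev_Pev. }
  destruct HU as (hu & H1 & H2). apply sameval_trans with (MCase hu bu, []).
  - apply Pev_sameval, Pev_case; auto. intro; apply Ev_Pev, Hbu.
  - apply sameval_sym, Pev_sameval, Pev_case; auto. intro; apply Ev_Pev, Hbu.
Qed.

Lemma same_head_refl h : same_head h h.
Proof. destruct h; simpl; auto using samep_refl, sameval_refl. Qed.

Definition sk_arg (q : sk) (i : nat) : sk := match q with SkNode a _ => a i | _ => q end.
Definition sk_br (q : sk) (i : nat) : sk := match q with SkNode _ b => b i | _ => q end.

(* Codes [(true, q)] have shape [q] and call normal closures, of colour [(false, _)], at types
   of size below [n]; codes [(false, q)] have no closures, i.e. they are normal forms. *)
Definition nf_sys (k n : nat) : sys.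
Proof.
  refine (Sys (bool * sk) bool fst (fun c => snd c <> SkLeaf)
    (fun c i => (fst c, sk_arg (snd c) i)) (fun c i => (fst c, sk_br (snd c) i))
    (fun c d t => c = true /\ fst d = false /\ tsize t < n) (fun _ => True) k _ _); reflexivity.
Defined.

(** All variables are declared local: without closures, the distinction from global ones no longer
    matters. *)
Definition nf (k : nat) D (q : sk) (e : mexp) : Prop :=
  @code (nf_sys k 0) D (fun _ _ => False) (fun _ => True) (false, q) e.
Definition nfp (k : nat) D (q : sk) (p : mproc) (t : ty) : Prop :=
  exists b, p = MLam (argtys t) b /\ nf k (updel (argtys t) D) q b.

Lemma nfp_cproc k D q p t : nfp k D q p t ->
  @cproc (nf_sys k 0) D (fun _ _ => False) (fun _ => True) (false, q) p t.
Proof.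
  intros (b & -> & H). exists b; split; auto. eapply (@code_perm (nf_sys k 0)); [| |exact H].
  - intros _ y [].
  - intros y _. left. now right.
Qed.

Lemma nf_recolour (S : sys) (f : sk -> col S) k D q e (P : knd S -> nat -> Prop) L :
  recolouring (nf_sys k 0) S (fun c c' => fst c = false /\ c' = f (snd c)) ->
  (forall y, L y \/ P (kind (f q)) y) -> nf k D q e -> code D P L (f q) e.
Proof.
  intros HR HL. apply (code_recolour _ _ _ _ _ _ _ _ _ _ _ HR); auto.
  intros c c' y _ [].
Qed.

Lemma nf_sys_nf k n : recolouring (nf_sys k 0) (nf_sys k n) (fun c c' => fst c = false /\ c' = (false, snd c)).
Proof.
  split; auto. intros [x q] c' [Hx ->] Hok. simpl in *. subst x. repeat split; auto.
  intros d t [H _]. discriminate.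
Qed.

(** A normal closure calls nothing, so once it is called it can run as active code under any bound
    [n']. *)
Lemma nf_sys_active k n n' : recolouring (nf_sys k n) (nf_sys k n')
  (fun c c' => fst c = false /\ c' = (true, snd c)).
Proof.
  split; auto. intros [x q] c' [Hx ->] Hok. simpl in *. subst x. repeat split; auto.
  intros d t [H _]. discriminate.
Qed.

Lemma nf_var k D y r a br qa qb : r = length (argtys (D y)) ->
  (forall i, i < r -> nfp k D (qa i) (a i) (nth i (argtys (D y)) N)) ->
  (forall i, nf k D (qb i) (br i)) -> nf k D (SkNode qa qb) (MCase (HVar y r a) br).
Proof.
  intros Hr Ha Hb. apply code_fold. right; right. do 2 eexists; split; [reflexivity|].
  split; [discriminate|]. split; [|exact Hb]. left. do 3 eexists; split; [reflexivity|].
  split; [now left|]. split; auto. intros i Hi. apply nfp_cproc; auto.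
Qed.

Lemma nf_const k D p s a r br qa qb : lv s <= k -> bisp p (DY s) ->
  r = length (argtys (Arr (Arr s s) s)) ->
  (forall i, i < r -> nfp k D (qa i) (a i) (nth i (argtys (Arr (Arr s s) s)) N)) ->
  (forall i, nf k D (qb i) (br i)) -> nf k D (SkNode qa qb) (MCase (HApp p r a) br).
Proof.
  intros Hs Hp Hr Ha Hb. apply code_fold. right; right. do 2 eexists; split; [reflexivity|].
  split; [discriminate|]. split; [|exact Hb]. right; right. do 4 eexists; split; [reflexivity|].
  split; [exact I|]. split; [exact Hs|]. split; [exact Hp|]. split; auto.
  intros i Hi. apply nfp_cproc; auto.
Qed.

(** Case-of-case moves [br] to the leaves of [e]; the recursion ends because the shape of [e] is
    well-founded. *)
Lemma nf_case k D br qb : (forall i, nf k D (qb i) (br i)) -> forall q e, nf k D q e ->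
  exists q' e', nf k D q' e' /\ sameval (MCase (HExp e) br, []) (e', []).
Proof.
  intro Hb. induction q as [|qa _ qc IH]; intros e He;
  destruct (code_unfold _ _ _ _ _ He) as [->|[(n & ->)|(h & br1 & -> & Hok & Hh & Hbr)]].
  - exists SkLeaf, MBot. split; [apply code_bot | apply sameval_hstep; constructor].
  - exists (qb n), (br n). split; auto. apply sameval_hstep; constructor.
  - now simpl in Hok.
  - exists SkLeaf, MBot. split; [apply code_bot | apply sameval_hstep; constructor].
  - exists (qb n), (br n). split; auto. apply sameval_hstep; constructor.
  - assert (HI : forall i, exists qe, nf k D (fst qe) (snd qe) /\
       sameval (MCase (HExp (br1 i)) br, []) (snd qe, [])).
    { intro i. destruct (IH i (br1 i) (Hbr i)) as (q' & e' & H1 & H2). exists (q', e'); auto. }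
    destruct (fun_choice _ _ HI) as [f Hf].
    exists (SkNode qa (fun i => fst (f i))), (MCase h (fun i => snd (f i))). split.
    + apply code_fold. right; right. do 2 eexists; split; [reflexivity|]. split; [discriminate|].
      split; [exact Hh|]. intro i; apply Hf.
    + eapply sameval_trans; [apply sameval_hstep, hs_cc|].
      apply sameval_case; [apply same_head_refl|]. intro i; apply Hf.
Qed.

(** Lexicographic induction on [n] and the shape: arguments and branches have smaller shapes.
    Contracting a call at type [t] may yield any shape, but the new closures are the arguments, of
    types smaller than [t], so the bound drops from [n] to [tsize t]. *)
Lemma normalise k n : forall q D e,
  @code (nf_sys k n) D (fun _ _ => True) noloc (true, q) e ->
  exists q' e', nf k D q' e' /\ sameval (e, []) (e', []).
Proof.
  induction n as [n IHn] using lt_wf_ind.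
  induction q as [|qa IHa qb IHb]; intros D e He;
  destruct (code_unfold _ _ _ _ _ He) as [->|[(z & ->)|(h & br & -> & Hok & Hh & Hbr)]].
  - exists SkLeaf, MBot. split; [apply code_bot | apply sameval_refl].
  - exists SkLeaf, (MNum z). split; [apply code_num | apply sameval_refl].
  - now simpl in Hok.
  - exists SkLeaf, MBot. split; [apply code_bot | apply sameval_refl].
  - exists SkLeaf, (MNum z). split; [apply code_num | apply sameval_refl].
  - assert (HB : exists qb' br', forall i, nf k D (qb' i) (br' i) /\ sameval (br i, []) (br' i, [])).
    { assert (HI : forall i, exists qe, nf k D (fst qe) (snd qe) /\ sameval (br i, []) (snd qe, [])).
      { intro i. destruct (IHb i D (br i) (Hbr i)) as (q' & e' & H1 & H2). exists (q', e'); auto. }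
      destruct (fun_choice _ _ HI) as [f Hf].
      exists (fun i => fst (f i)), (fun i => snd (f i)). exact Hf. }
    destruct HB as (qb' & br' & HB).
    assert (HA : forall r a t, @cargs (nf_sys k n) D (fun _ _ => True) noloc (true, SkNode qa qb) r a t ->
       exists qa' a', forall i, (i < r -> nfp k D (qa' i) (a' i) (nth i (argtys t) N)) /\
         samep (a i) (a' i)).
    { intros r a t [Hr Ha].
      assert (HI : forall i, exists qp, (i < r -> nfp k D (fst qp) (snd qp) (nth i (argtys t) N)) /\
         samep (a i) (snd qp)).
      { intro i. destruct (Nat.lt_ge_cases i r) as [Hi|Hi].
        - destruct (Ha i Hi) as (b & Eb & Hb).
          destruct (IHa i (updel (argtys (nth i (argtys t) N)) D) b) as (q' & e' & H1 & H2).
          { eapply (@code_perm (nf_sys k n)); [| |exact Hb]; auto. }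
          exists (q', MLam (argtys (nth i (argtys t) N)) e'). simpl. split.
          + intros _. exists e'. auto.
          + rewrite Eb. apply samep_lam; auto.
        - exists (SkLeaf, a i). split; [lia | apply samep_refl]. }
      destruct (fun_choice _ _ HI) as [f Hf].
      exists (fun i => fst (f i)), (fun i => snd (f i)). exact Hf. }
    destruct Hh as [(y & r & a & -> & Hy & Ha)|[(p & r & a & [d qd] & t & -> & Hd & Hp & Ha)|
      (p & r & a & s & -> & Hk & Hs & Hp & Ha)]].
    + destruct (HA _ _ _ Ha) as (qa' & a' & HA'). exists (SkNode qa' qb'), (MCase (HVar y r a') br').
      split.
      * apply nf_var; [apply Ha | intros; now apply HA' | intro; apply HB].
      * apply sameval_case; [|intro; apply HB]. repeat split; auto. intro; apply HA'.
    + destruct (HA _ _ _ Ha) as (qa' & a' & HA'). simpl in Hd. destruct Hd as (_ & -> & Ht).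
      destruct Hp as (b & -> & Hb). destruct Ha as [-> _].
      assert (HE : @code (nf_sys k (tsize t)) D (fun _ _ => True) noloc (true, qd)
                (sub_e (beta_sub (length (argtys t)) a') b)).
      { eapply code_beta with (ca := fun i => (false, qa' i)).
        - eapply (code_recolour (nf_sys k n) (nf_sys k (tsize t)) _ _ _ _ _ _ (false, qd) (true, qd) _ (nf_sys_active k n (tsize t)));
            [| | |exact Hb]; auto.
          now intros [] [] y _ Hy.
        - intros i Hi. split; [repeat split; auto; now apply tsize_nth|].
          destruct (proj1 (HA' i) Hi) as (b' & -> & Hb'). eexists; split; [reflexivity|].
          apply (nf_recolour (nf_sys k (tsize t)) (fun q => (false, q)) k); auto using nf_sys_nf.
          intro y. destruct (Nat.lt_ge_cases y (length (argtys (nth i (argtys t) N)))).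
          + left; now left.
          + right; now split. }
      destruct (IHn _ Ht _ _ _ HE) as (q2 & e2 & H1 & H2).
      destruct (nf_case k D br' qb' (fun i => proj1 (HB i)) q2 e2 H1) as (q3 & e3 & H3 & H4).
      exists q3, e3. split; auto.
      eapply sameval_trans; [apply sameval_case with (h' := HApp (MLam (argtys t) b) (length (argtys t)) a')
        (br' := br'); [|intro; apply HB]|].
      { repeat split; auto using samep_refl. intro; apply HA'. }
      eapply sameval_trans; [apply sameval_hstep, hs_beta|].
      eapply sameval_trans; [|exact H4]. apply sameval_case; [exact H2|].
      intro; apply sameval_refl.
    + destruct (HA _ _ _ Ha) as (qa' & a' & HA'). exists (SkNode qa' qb'), (MCase (HApp p r a') br').
      split.
      * eapply nf_const; eauto; [apply Ha | intros; now apply HA' | intro; apply HB].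
      * apply sameval_case; [|intro; apply HB]. repeat split; auto using samep_refl.
        intro; apply HA'.
Qed.

(** * Denotations have normal forms *)

(** Code without closures and constants is an NSP, hence weakly its own evaluation tree; this
    settles eta-expansions and the unfolded [DY s]. *)
Definition varhead_sys : sys.
Proof.
  refine (Sys unit unit (fun c => c) (fun _ => True) (fun c _ => c) (fun c _ => c)
    (fun _ _ _ => False) (fun _ => False) 0 _ _); reflexivity.
Defined.

Lemma varhead_sys_uniform (c : col varhead_sys) : uniform c.
Proof. now repeat split. Qed.

Lemma varhead_sys_wEv D P L c e : @code varhead_sys D P L c e -> wEv (e, []) e.
Proof.
  intro H. apply (wEv_coind (fun s t => s = (t, []) /\ exists D P L c, @code varhead_sys D P L c t));
    [|eauto 8]. clear. intros s t (-> & D & P & L & c & H).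
  destruct (code_unfold _ _ _ _ _ H) as [->|[(z & ->)|(h & br & -> & _ & Hh & Hbr)]].
  - left; split; auto. split; intros; intros [m H']; inversion H'; subst; discriminate.
  - right; left. exists z. split; auto. apply reach_refl.
  - destruct Hh as [(y & r & a & -> & Hy & Hr & Ha)|[(p & r & a & d & t & _ & [] & _)|
      (p & r & a & s & _ & [] & _)]].
    right; right. exists y, r, a, br, [], a, br. split; auto. split; [apply reach_refl|]. split.
    + intros i Hi. destruct (Ha i Hi) as (b & -> & Hb). split; auto. left; eauto 8.
    + intro i. left. split; eauto 8.
Qed.

Lemma varhead_sys_wEv_p D P L c p t : @cproc varhead_sys D P L c p t -> lam_st wEv p p.
Proof. intros (b & -> & H). split; auto. eapply varhead_sys_wEv; eauto. Qed.

Lemma nfp_eta k s : forall D x, D x = s -> exists q, nfp k D q (eta s x) s.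
Proof.
  remember (tsize s) as n eqn:E. revert s E.
  induction n as [n IH] using lt_wf_ind. intros s -> D x HD.
  rewrite etaE. cbv zeta. set (m := length (argtys s)).
  assert (HI : forall i, exists q, i < m -> nfp k (updel (argtys s) D) q
     (eta (nth i (argtys s) N) (m - 1 - i)) (nth i (argtys s) N)).
  { intro i. destruct (Nat.lt_ge_cases i m) as [Hi|Hi]; [|exists SkLeaf; lia].
    destruct (IH _ (tsize_nth s i Hi) _ eq_refl (updel (argtys s) D) (m - 1 - i)) as [q Hq]; eauto.
    rewrite updel_lt by (unfold m in *; lia). f_equal. unfold m in *; lia. }
  destruct (fun_choice _ _ HI) as [f Hf].
  exists (SkNode f (fun _ => SkLeaf)). eexists; split; [reflexivity|].
  assert (HD' : updel (argtys s) D (x + m) = s).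
  { rewrite updel_ge by (unfold m; lia). unfold m. now replace (x + _ - _) with x by lia. }
  apply nf_var; rewrite ?HD'; auto.
  - intros i Hi. rewrite (proj2 (Nat.ltb_lt _ _)) by auto. now apply Hf.
  - intro; apply code_num.
Qed.

Lemma nf_var0 k D y a br qb : D y = N -> (forall i, nf k D (qb i) (br i)) ->
  nf k D (SkNode (fun _ => SkLeaf) qb) (MCase (HVar y 0 a) br).
Proof. intros HD Hb. apply nf_var; rewrite ?HD; auto. intros i Hi; lia. Qed.

Lemma wEv_var0 y a br : (forall i, wEv (br i, []) (br i)) ->
  wEv (MCase (HVar y 0 a) br, []) (MCase (HVar y 0 a) br).
Proof.
  intro H. apply (wEv_coind (fun s t => s = (MCase (HVar y 0 a) br, []) /\ t = MCase (HVar y 0 a) br));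
    auto. intros s t [-> ->]. right; right. exists y, 0, a, br, [], a, br.
  split; auto. split; [apply reach_refl|]. split; [intros; lia | auto].
Qed.

Lemma wEv_num n : wEv (MNum n, []) (MNum n).
Proof. apply (varhead_sys_wEv (fun _ => N) (fun _ _ => True) noloc tt), code_num. Qed.
Lemma wEv_bot : wEv (MBot, []) MBot.
Proof. apply (varhead_sys_wEv (fun _ => N) (fun _ _ => True) noloc tt), code_bot. Qed.

Lemma app_sub_lt n q y : y < n -> app_sub n q y = SVar y.
Proof. intro H; unfold app_sub. now rewrite (proj2 (Nat.ltb_lt _ _)). Qed.
Lemma app_sub_eq n q : app_sub n q n = STerm (ren_p (fun j => j + n) q).
Proof. unfold app_sub. now rewrite Nat.ltb_irrefl, Nat.eqb_refl. Qed.
Lemma app_sub_gt n q y : n < y -> app_sub n q y = SVar (y - 1).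
Proof.
  intro H; unfold app_sub. rewrite (proj2 (Nat.ltb_ge _ _)) by lia.
  now rewrite (proj2 (Nat.eqb_neq _ _)) by lia.
Qed.

Lemma okitem_app_sub {S : sys} D (c : knd S) d p s t :
  callk c d s -> @cproc S D (fun _ _ => True) noloc d p s -> forall y,
  okitem (updel (argtys t) D) (fun _ _ => True) noloc c (updel (s :: argtys t) D y)
    (app_sub (length (argtys t)) p y).
Proof.
  intros Hc Hp y. destruct (lt_eq_lt_dec y (length (argtys t))) as [[H|H]|H].
  - rewrite app_sub_lt by lia. left. exists y. rewrite !updel_lt by (simpl; lia).
    repeat split; auto.
    replace (length (s :: argtys t) - 1 - y) with (Datatypes.S (length (argtys t) - 1 - y)) by (simpl; lia).
    reflexivity.
  - subst y. rewrite app_sub_eq. right. do 2 eexists; split; [reflexivity|].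
    rewrite updel_lt by (simpl; lia).
    replace (length (s :: argtys t) - 1 - length (argtys t)) with 0 by (simpl; lia).
    split; [exact Hc|]. simpl nth. apply (cproc_shift _ _ _ _ _ (argtys t)) in Hp.
    eapply (cproc_recolour S S eq); [apply recolouring_eq | reflexivity | | | exact Hp]; auto.
    now intros ? ? ? _ _.
  - rewrite app_sub_gt by lia. left. exists (y - 1). rewrite !updel_ge by (simpl; lia).
    repeat split; auto. f_equal. simpl; lia.
Qed.

Lemma clean_app_sub n p q : bisp (clean_p p) (clean_p q) -> forall y,
  item_bis (clean_item (app_sub n p y)) (clean_item (app_sub n q y)).
Proof.
  intros H y. destruct (lt_eq_lt_dec y n) as [[Hy|Hy]|Hy].
  - rewrite !app_sub_lt by lia. apply item_bis_refl.
  - subst y. rewrite !app_sub_eq.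
    eapply item_bis_trans; [apply (clean_iren _ (STerm p))|].
    eapply item_bis_trans; [|apply item_bis_sym, (clean_iren _ (STerm q))].
    apply item_bis_term. apply ren_p_bis; auto.
  - rewrite !app_sub_gt by lia. apply item_bis_refl.
Qed.

Lemma nfp_typed k D q p t : nfp k D q p t ->
  @cproc (typing_sys k) D (fun _ _ => True) noloc tt p t.
Proof.
  intro H. apply nfp_cproc in H.
  eapply (cproc_recolour (nf_sys k 0) (typing_sys k) (fun _ _ => True)); [| | | |exact H]; auto.
  - apply (typing_sys_forget (nf_sys k 0)).
  - now intros ? ? ? _ _.
Qed.

Lemma nf_typed k D q b : nf k D q b -> typed k D (b, []).
Proof.
  intro H. split; simpl; auto. exists tt.
  apply (code_recolour (nf_sys k 0) (typing_sys k) (fun _ _ => True) D (fun _ _ => False) (fun _ _ => True)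
    (fun _ => True) noloc (false, q) tt); auto.
  - apply (typing_sys_forget (nf_sys k 0)).
  - now intros ? ? ? _ [].
Qed.

Lemma wEv_typed k D s t : typed k D s -> wEv s t -> typed k D (t, []).
Proof.
  intros Hs Ht. split; simpl; auto. exists tt. eapply wEv_code; eauto.
Qed.

Lemma wEv_typed_p k D p p' t : @cproc (typing_sys k) D (fun _ _ => True) noloc tt p t ->
  lam_st wEv p p' -> @cproc (typing_sys k) D (fun _ _ => True) noloc tt p' t.
Proof.
  intros Hp H. pose proof Hp as (b & E & _). pose proof (typed_body _ _ _ _ _ Hp E) as Tb. subst p.
  destruct p' as [t' b']. destruct H as [<- H]. exists b'. split; auto.
  eapply wEv_code; eauto. intros y _. destruct (Nat.lt_ge_cases y (length (argtys t))).
  - left; now left.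
  - right; now split.
Qed.

Lemma typed_app_sub k D s t d e : typed k (updel (s :: argtys t) D) (e, []) ->
  @cproc (typing_sys k) D (fun _ _ => True) noloc tt d s ->
  typed k (updel (argtys t) D) (sub_e (app_sub (length (argtys t)) d) e, []).
Proof.
  intros [[[] He] _] Hd. split; simpl; auto. exists tt.
  eapply (@code_sub (typing_sys k)); [| |exact He]; [|intros y []].
  intros c y _. eapply (@okitem_app_sub (typing_sys k)); [|exact Hd]. exact I.
Qed.

(** Normalising the substituted normal form realises the application. The given trees [e1] and [d]
    are only weak, so they are compared with the strong trees of [b0] and [p0] up to cleaning. *)
Lemma app_wEv k D q1 q2 b0 e1 p0 d s t :
  nf k (updel (s :: argtys t) D) q1 b0 -> wEv (b0, []) e1 ->
  nfp k D q2 p0 s -> lam_st wEv p0 d ->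
  exists q b, nf k (updel (argtys t) D) q b /\
    wEv (b, []) (eval_e (sub_e (app_sub (length (argtys t)) d) e1)).
Proof.
  intros Hb0 He1 Hp0 Hd. set (n := length (argtys t)).
  (* [p0], of type [s], is the only closure inserted, hence the bound [S (tsize s)]; [b0] becomes
     active code and [p0] stays normal. *)
  destruct (normalise k (S (tsize s)) q1 (updel (argtys t) D) (sub_e (app_sub n p0) b0))
    as (q & b & H1 & H2).
  { eapply (@code_sub (nf_sys k (S (tsize s)))) with (D := updel (s :: argtys t) D)
      (P := fun c _ => c = true) (L := noloc); [| intros y [] |].
    - intros c y ->. apply (@okitem_app_sub (nf_sys k (S (tsize s))) D true (false, q2)); [simpl; auto|].
      destruct Hp0 as (bp & -> & Hbp). eexists; split; [reflexivity|].
      apply (nf_recolour (nf_sys k (S (tsize s))) (fun q => (false, q)) k); auto using nf_sys_nf.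
      intro z. destruct (Nat.lt_ge_cases z (length (argtys s))).
      + left; now left.
      + right; now split.
    - apply (nf_recolour (nf_sys k (S (tsize s))) (fun q => (true, q)) k); auto using nf_sys_active. }
  exists q, b. split; auto.
  assert (Tb : typed k (updel (s :: argtys t) D) (b0, [])) by (eapply nf_typed; eauto).
  assert (Tp : @cproc (typing_sys k) D (fun _ _ => True) noloc tt p0 s) by (eapply nfp_typed; eauto).
  pose proof (Ev_eval (b0, [])) as Eu. simpl in Eu.
  assert (Ev0 : lam_st Ev p0 (eval_p p0)).
  { destruct p0. rewrite eval_lamE. split; auto. apply (Ev_eval (m, [])). }
  assert (Ew : lam_st wEv p0 (eval_p p0)) by (eapply lam_st_mono; [apply Ev_wEv | exact Ev0]).
  apply wsame_wEv with (sub_e (app_sub n d) e1, []); [|apply Ev_wEv, (Ev_eval (_, []))].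
  apply wsame_trans with (sub_e (app_sub n p0) b0, []); [|now apply sameval_wsame].
  apply wsame_sym.
  apply wsame_trans with (sub_e (app_sub n (eval_p p0)) (eval_e b0), []).
  - apply sameval_wsame, sameval_sub.
    + apply Pev_sameval, Ev_Pev, Eu.
    + intro y. destruct (lt_eq_lt_dec y n) as [[Hy|Hy]|Hy].
      * now rewrite !app_sub_lt.
      * subst y. rewrite !app_sub_eq. apply Pev_samep, Pev_ren, lam_Ev_Pev, Ev0.
      * now rewrite !app_sub_gt.
  - eapply clean_wsame.
    + eapply typed_app_sub; [|eapply wEv_typed_p; [exact Tp | exact Ew]].
      eapply wEv_typed; [exact Tb | apply Ev_wEv, Eu].
    + eapply typed_app_sub; [|eapply wEv_typed_p; [exact Tp | exact Hd]].
      eapply wEv_typed; [exact Tb | exact He1].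
    + apply bis_st_nil. intro m. simpl.
      eapply bisn_trans; [apply clean_subn with (tau := fun y => clean_item (app_sub n d y))|].
      * apply clean_app_sub. destruct p0 as [tp bp], d as [td bd]. rewrite eval_lamE.
        destruct Hd as [<- Hd]. autorewrite with mterm. apply bisp_lam; split; auto.
        intro m'. eapply Ev_wEv_cleann; [apply (Ev_eval (bp, [])) | exact Hd].
      * eapply bisn_trans; [|apply bisn_sym, clean_subn; intro; apply item_bis_refl].
        apply sub_bis; [|intro; apply item_bis_refl].
        intro m'. eapply Ev_wEv_cleann; eauto.
Qed.

Definition tyenv (G : list ty) (y : nat) : ty := nth y G N.

Lemma updel_cons s tys G : updel (s :: tys) (tyenv G) = updel tys (tyenv (s :: G)).
Proof.
  extensionality y. destruct (lt_eq_lt_dec y (length tys)) as [[H|H]|H].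
  - rewrite !updel_lt by (simpl; lia).
    replace (length (s :: tys) - 1 - y) with (S (length tys - 1 - y)) by (simpl; lia). reflexivity.
  - subst y. rewrite updel_lt, updel_ge by (simpl; lia). simpl. now rewrite !Nat.sub_diag, Nat.sub_0_r, Nat.sub_diag.
  - rewrite !updel_ge by (simpl; lia). unfold tyenv.
    replace (y - length tys) with (S (y - length (s :: tys))) by (simpl; lia). reflexivity.
Qed.

(** In a normal form a constant occurs only as a head, so [PY s] is represented by the eta-expansion
    of [DY s], with [DY s] left folded. *)
Lemma nfp_etaexp_DY k D s : lv s <= k ->
  exists q, nfp k D q (etaexp (Arr (Arr s s) s) (DY s)) (Arr (Arr s s) s).
Proof.
  intro Hs. unfold etaexp. cbv zeta. set (T := Arr (Arr s s) s). set (m := length (argtys T)).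
  assert (HI : forall i, exists q, i < m -> nfp k (updel (argtys T) D) q
     (eta (nth i (argtys T) N) (m - 1 - i)) (nth i (argtys T) N)).
  { intro i. destruct (Nat.lt_ge_cases i m) as [Hi|Hi]; [|exists SkLeaf; lia].
    destruct (nfp_eta k (nth i (argtys T) N) (updel (argtys T) D) (m - 1 - i)) as [q Hq]; eauto.
    rewrite updel_lt by (fold m; lia). f_equal. fold m; lia. }
  destruct (fun_choice _ _ HI) as [f Hf].
  exists (SkNode f (fun _ => SkLeaf)). eexists; split; [reflexivity|].
  apply nf_const with s; auto.
  - apply ren_DY.
  - intros i Hi. rewrite (proj2 (Nat.ltb_lt _ _)) by auto. now apply Hf.
  - intro; apply code_num.
Qed.

Lemma wEv_etaexp_DY s : lam_st wEv (etaexp (Arr (Arr s s) s) (DY s)) (DY s).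
Proof.
  assert (H : wsamep (etaexp (Arr (Arr s s) s) (DY s)) (DY s)).
  { apply (eta_law 0 (S (tsize (Arr (Arr s s) s))) _ _ (fun _ => N)); [lia|].
    apply cproc_DY; [now repeat split | apply bisp_refl]. }
  assert (H1 : lam_st wEv (DY s) (DY s)).
  { apply (varhead_sys_wEv_p (fun _ => N) (fun _ _ => True) noloc tt _ (Arr (Arr s s) s)).
    apply cproc_DY; [apply varhead_sys_uniform | apply bisp_refl]. }
  destruct (DY s) as [td bd]. destruct (etaexp (Arr (Arr s s) s) (MLam td bd)) as [t b].
  apply wsamep_lam in H as [-> H]. split; auto. destruct H1 as [_ H1].
  eapply wsame_wEv; [apply wsame_sym, H | exact H1].
Qed.

(** The side condition of [T_Y] is what admits [DY s] as a constant. Application is hereditary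
    substitution ([app_wEv]), and the denotations of the first-order constants are normal
    already. *)
Lemma den_nf k G M s : has_type k G M s ->
  exists q p, nfp k (tyenv G) q p s /\ lam_st wEv p (den G M).
Proof.
  induction 1 as [G i s Hi | G n | G | G | G | G f | G s Hs | G s t M H IH |
    G s t M M' H1 IH1 H2 IH2]; cbn [den].
  - apply nth_error_nth with (d := N) in Hi. rewrite Hi.
    destruct (nfp_eta k s (tyenv G) i Hi) as [q Hq]. exists q, (eta s i). split; auto.
    apply (varhead_sys_wEv_p (tyenv G) (fun _ _ => True) noloc tt _ s).
    apply cproc_eta; auto using varhead_sys_uniform.
  - exists SkLeaf, (MLam [] (MNum n)). split; [|split; auto using wEv_num].
    eexists; split; [reflexivity|]. apply code_num.
  - eexists; eexists (MLam [N] _). split; [|split; [reflexivity | apply wEv_var0; auto using wEv_num]].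
    eexists; split; [reflexivity|]. apply nf_var0 with (qb := fun _ => SkLeaf); auto.
    intro; apply code_num.
  - eexists; eexists (MLam [N] _). split; [|split; [reflexivity | apply wEv_var0; auto using wEv_num]].
    eexists; split; [reflexivity|]. apply nf_var0 with (qb := fun _ => SkLeaf); auto.
    intro; apply code_num.
  - eexists; eexists (MLam _ _). split; [|split; [reflexivity | apply wEv_var0]].
    + eexists; split; [reflexivity|].
      apply nf_var0 with (qb := fun _ => SkNode (fun _ => SkLeaf) (fun _ => SkLeaf)); auto.
      intros [|i]; apply nf_var0; auto; intro; apply code_num.
    + intros [|i]; apply wEv_var0; auto using wEv_num.
  - eexists; eexists (MLam _ _). split; [|split; [reflexivity | apply wEv_var0]].
    + eexists; split; [reflexivity|]. apply nf_var0 with (qb := fun _ => SkLeaf); auto.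
      intro i; destruct (f i); [apply code_num | apply code_bot].
    + intro i; destruct (f i); auto using wEv_num, wEv_bot.
  - destruct (nfp_etaexp_DY k (tyenv G) s Hs) as [q Hq].
    exists q, (etaexp (Arr (Arr s s) s) (DY s)). split; auto. apply wEv_etaexp_DY.
  - destruct IH as (q & p & (b & -> & Hb) & Hp). destruct (den (s :: G) M) as [t' e].
    destruct Hp as [<- Hp]. exists q, (MLam (s :: argtys t) b). split; [|now split].
    exists b. split; auto. cbn [argtys]. now rewrite updel_cons.
  - destruct IH1 as (q1 & p1 & (b1 & -> & Hb1) & Hp1). destruct IH2 as (q2 & p2 & Hp2 & Hd2).
    destruct (den G M) as [t1 e1]. destruct Hp1 as [<- He1]. cbn [argtys] in *.
    destruct (app_wEv _ _ _ _ _ _ _ _ _ _ Hb1 He1 Hp2 Hd2) as (q & b & Hb & He).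
    exists q, (MLam (argtys t) b). split; [exists b; auto | now split].
Qed.

Lemma nf_sys_spine_sys k b : recolouring (nf_sys k 0) (spine_sys k b False)
  (fun c c' => fst c = false /\ sle (snd c) b /\ c' = CR (snd c)).
Proof.
  split; auto. intros [x q] c' (Hx & Hq & ->) Hok. simpl in Hx, Hq, Hok; subst x.
  split; [simpl; auto|]. split; [intros _; discriminate|].
  assert (HA : forall i, sle (sk_arg q i) b) by
    (intro i; destruct q; auto; eapply sle_trans; [eapply sle_arg, sle_refl | exact Hq]).
  assert (HB : forall i, sle (sk_br q i) b) by
    (intro i; destruct q; auto; eapply sle_trans; [eapply sle_br, sle_refl | exact Hq]).
  split; [|split].
  - intro i. split; [reflexivity|]. split; [apply HA|]. now destruct q.
  - intro i. split; [reflexivity|]. split; [apply HB|]. now destruct q.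
  - intros d t [E _]. discriminate.
Qed.

Lemma ext_tyenv A G y u : nth_error (A ++ G) y = Some u -> ext A (tyenv G) y = u.
Proof.
  unfold ext, tyenv. intro H. apply nth_error_nth with (d := N) in H. rewrite <- H.
  destruct (Nat.ltb_spec y (length A)); [rewrite app_nth1 | rewrite app_nth2]; auto.
Qed.

Theorem theorem4p5 (k : nat) (G : list ty) (gi : nat) (M : pcf) (s : ty) :
  1 <= k ->
  g_regular k G gi ->
  has_type k G M s ->
  ~ g_spinal k G gi (den G M).
Proof.
  intros Hk [Hg _] HM. destruct (den_nf _ _ _ _ HM) as (q & p & (b & -> & Hb) & Hp).
  destruct (den G M) as [tys e]. destruct Hp as [<- He].
  intros (Om & e' & x & V & Hsub & HS).
  (* At the start no spine variable exists: [CO] is switched off, and the demand of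
     [coded_not_spinal] on distinguished variables holds vacuously. *)
  assert (Hs : @cstate (spine_sys k q False) (updel (argtys s) (tyenv G)) (spine_perm (fun _ => True)) (b, [])).
  { split; simpl; auto. exists (CR q).
    apply (code_recolour (nf_sys k 0) (spine_sys k q False) _ _ (fun _ _ => False) _
      (fun _ => True) noloc (false, q) (CR q) b (nf_sys_spine_sys k q)); auto.
    - repeat split. constructor.
    - intros ? ? ? _ []. }
  destruct (subexp_coded _ _ _ _ _ _ Hsub _ _ _ Hs He) as (s' & xb & Hs' & He' & _).
  rewrite ext_updel in Hs'.
  eapply (coded_not_spinal k Hk q False _ xb); [exact Hs' | exact He' | | | intros [] | exact HS].
  - intros y t Hy. rewrite app_assoc in Hy. now apply ext_tyenv.
  - rewrite app_assoc, nth_error_app2 by (rewrite length_app, length_rev; lia).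
    rewrite length_app, length_rev. replace (_ - _) with gi by lia. exact Hg.
Qed.
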